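(* Within $\mathbb{P}$, each of the inclusions $$C_{\mathrm{ICOD}_{0\cap\mathrm{bdd}}}\subsetneq C_{\mathrm{ICOD}_0},\quad C_{\mathrm{ICOD}_{0\cap\mathrm{bdd}}}\subsetneq C_{\mathrm{ICOD}_{\mathrm{bdd}}},\quad C_{\mathrm{ICOD}_0}\subsetneq C_{\mathrm{ICOD}_{<\infty}},\quad C_{\mathrm{ICOD}_{\mathrm{bdd}}}\subsetneq C_{\mathrm{ICOD}_{<\infty}},\quad C_{\mathrm{ICOD}_{<\infty}}\subsetneq C_{\mathrm{ICOD}}=\mathcal{B}(L^2(\mathbb{R}))$$ holds, is strict, and has no intermediate elements (i.e. no element of $\mathbb{P}$ lies strictly between the two sides). Moreover, $C_{\mathrm{ICOD}_0}$ and $C_{\mathrm{ICOD}_{\mathrm{bdd}}}$ are the only elements of $\mathbb{P}$ strictly between $C_{\mathrm{ICOD}_{0\cap\mathrm{bdd}}}$ and $C_{\mathrm{ICOD}_{<\infty}}$.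
   Context: $\mathbb{R}$ carries Lebesgue measure $\mu$; $L^2(\mathbb{R})$ is the complex Hilbert space; for $\xi\in L^2(\mathbb{R})$, $\mathrm{supp}(\xi)=\{x:\xi(x)\ne0\}$ (defined up to a null set). ''Increasing'' and ''decreasing'' are meant in the weak sense. For $a\in\mathcal{B}(L^2(\mathbb{R}))$ define $\Phi_a\colon[0,\infty]\to[0,\infty]$ by $\Phi_a(x)=\sup\{\mu(\mathrm{supp}(a\xi)):\xi\in L^2(\mathbb{R}),\ \mu(\mathrm{supp}(\xi))\le x\}$. For an increasing $f\colon[0,\infty]\to[0,\infty]$ let $B_f=\{a\in\mathcal{B}(L^2(\mathbb{R})):\Phi_a\le f\text{ and }\Phi_{a^*}\le f\}$. For a nonempty family $\mathcal{F}$ of increasing functions $[0,\infty]\to[0,\infty]$ closed under (pointwise) addition and composition, let $B_{\mathcal{F}}=\bigcup_{f\in\mathcal{F}}B_f$ (a $*$-algebra) and let $C_{\mathcal{F}}$ be its operator-norm closure. The $C^*$-algebras $C_{\mathcal{F}}$ obtained this way are the support expansion $C^*$-subalgebras of $\mathcal{B}(L^2(\mathbb{R}))$, and $\mathbb{P}$ is the poset of all of them, ordered by inclusion. $\mathrm{ICOD}$ is the set of all functions $f\colon[0,\infty]\to[0,\infty]$ that are increasing and concave down, with $f(0)=0$ and $\lim_{t\to\infty}f(t)=f(\infty)$. (The value $\infty$ is allowed, so the function equal to $0$ at $0$ and to $\infty$ on $(0,\infty]$ belongs to $\mathrm{ICOD}$.) Further: $\mathrm{ICOD}_0=\{f\in\mathrm{ICOD}:\lim_{t\to0^+}f(t)=0\}$;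 $\mathrm{ICOD}_{\mathrm{bdd}}=\{f\in\mathrm{ICOD}: f\text{ is bounded}\}$ (bounded by a finite constant); $\mathrm{ICOD}_{0\cap\mathrm{bdd}}=\mathrm{ICOD}_0\cap\mathrm{ICOD}_{\mathrm{bdd}}$; $\mathrm{ICOD}_{<\infty}=\{f\in\mathrm{ICOD}:f(x)<\infty\text{ for all }x<\infty\}$. Each of these families is closed under addition and composition. *)

(* Defs.v *)
From HB Require Import structures.
From mathcomp Require Import all_boot all_order all_algebra.
From mathcomp Require Import all_classical all_reals all_analysis.
From mathcomp Require Import measurable_realfun complex.

Set Implicit Arguments.
Unset Strict Implicit.
Unset Printing Implicit Defensive.

Import Order.TTheory GRing.Theory Num.Theory.
Import numFieldNormedType.Exports.
Import ComplexField.Normc.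

Local Open Scope classical_set_scope.
Local Open Scope ring_scope.

Section SquareIntegrable.
Variable R : realType.
Local Notation mu := (@lebesgue_measure R).
Local Notation Re := (@complex.Re R).
Local Notation Im := (@complex.Im R).
Implicit Types f g : R -> R[i].

(* Measurability is Borel measurability; a Lebesgue measurable function is a.e.
   equal to a Borel one, so the quotient L2 below is the same. *)
Definition sq_integrable_set : set (R -> R[i]) :=
  [set f : R -> R[i] | [/\ measurable_fun [set: R] (Re \o f),
               measurable_fun [set: R] (Im \o f) &
               finite_norm mu 2%:E (@normc R \o f)]].

Definition sq_integrable : {pred R -> R[i]} := mem sq_integrable_set.

Lemma sq_integrableP f : reflect (sq_integrable_set f) (f \in sq_integrable).
Proof. by apply: (iffP idP) => [/set_mem|/mem_set]. Qed.

Lemma ReD (a b : R[i]) : Re (a + b) = Re a + Re b.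
Proof. by case: a b => [a1 a2] [b1 b2]. Qed.
Lemma ImD (a b : R[i]) : Im (a + b) = Im a + Im b.
Proof. by case: a b => [a1 a2] [b1 b2]. Qed.
Lemma ReM (a b : R[i]) : Re (a * b) = Re a * Re b - Im a * Im b.
Proof. by case: a b => [a1 a2] [b1 b2]. Qed.
Lemma ImM (a b : R[i]) : Im (a * b) = Re a * Im b + Im a * Re b.
Proof. by case: a b => [a1 a2] [b1 b2]. Qed.

Lemma measurable_normc f : measurable_fun [set: R] (Re \o f) ->
  measurable_fun [set: R] (Im \o f) ->
  measurable_fun [set: R] (@normc R \o f).
Proof.
move=> mr mi.
rewrite (_ : _ \o f = fun x => Num.sqrt (Re (f x) ^+ 2 + Im (f x) ^+ 2)); last first.
  by apply/funext => x /=; case: (f x).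
apply: (measurableT_comp (f := @Num.sqrt R)).
  apply: continuous_measurable_fun; exact: sqrt_continuous.
by apply: measurable_funD; exact: measurable_funX.
Qed.

Lemma sq_integrable_normc f :
  f \in sq_integrable -> (@normc R \o f : R -> R) \in Lfun mu 2%:E.
Proof.
move=> /sq_integrableP[mr mi fin]; apply/andP; split; rewrite inE//=.
exact: measurable_normc.
Qed.

Lemma sq_integrable_le f (g : R -> R) :
  measurable_fun [set: R] (Re \o f) -> measurable_fun [set: R] (Im \o f) ->
  g \in Lfun mu 2%:E -> (forall x, normc (f x) <= g x) -> f \in sq_integrable.
Proof.
move=> mr mi gL fg; apply/sq_integrableP; split => //.
have mf := measurable_normc mr mi.
move: gL; rewrite inE => /andP[/[!inE]/= mg lg].
apply: le_lt_trans lg; rewrite unlock.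
have mp (h : R -> R) : measurable_fun [set: R] h ->
    measurable_fun [set: R] (fun x => (`|(EFin \o h) x| `^ 2)%E).
  move=> mh; apply/measurable_EFinP.
  apply: (@measurableT_comp _ _ _ _ _ _ (fun x : R => x `^ 2)%R) => //.
  exact: measurableT_comp.
have i0 h : ((\int[mu]_x (`|(EFin \o h) x| `^ 2)) \in `[0%E, +oo%E])%E.
  by rewrite in_itv/= leey integral_ge0.
apply: gt0_ler_poweR; rewrite ?invr_ge0//; try exact: i0.
apply: ge0_le_integral => //.
- by move=> x _; exact: poweR_ge0.
- exact: (mp (@normc R \o f)).
- exact: (mp g).
move=> x _.
have n0 : 0 <= normc (f x) by case: (f x) => u v; exact: sqrtr_ge0.
apply: gt0_ler_poweR; rewrite ?in_itv/= ?leey ?lee_fin ?andbT//.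
by rewrite (ger0_norm n0) (ger0_norm (le_trans n0 (fg x))).
Qed.

Lemma sq_integrable_submod_closed : submod_closed sq_integrable.
Proof.
split.
  apply/sq_integrableP; split; [exact: measurable_cst..|].
  rewrite (_ : _ \o _ = cst 0); last by apply/funext => x; exact: normc0.
  by rewrite /finite_norm Lnorm0.
move=> c f g fL gL.
have [fr fi _] := sq_integrableP _ fL; have [gr gi _] := sq_integrableP _ gL.
apply: (@sq_integrable_le _
  ((normc c \o* (@normc R \o f)) \+ (@normc R \o g))%R).
- rewrite (_ : _ \o _ = fun x => Re c * Re (f x) - Im c * Im (f x) + Re (g x));
    last by apply/funext => x /=; rewrite ReD ReM.
  apply: measurable_funD => //.
  by apply: measurable_funB; apply: measurable_funM.
- rewrite (_ : _ \o _ = fun x => Re c * Im (f x) + Im c * Re (f x) + Im (g x));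
    last by apply/funext => x /=; rewrite ImD ImM.
  apply: measurable_funD => //.
  by apply: measurable_funD; apply: measurable_funM.
- have := Lfun_addr_closed mu (lee1n 2).
  case=> _; apply; last exact: sq_integrable_normc.
  by apply: Lfun_scale; [rewrite ler1n | exact: sq_integrable_normc].
- move=> x /=; apply: le_trans (le_normcD _ _) _.
  by rewrite lerD2r [normc (c * _)]normcM mulrC.
Qed.

HB.instance Definition _ := GRing.isSubmodClosed.Build R[i] (R -> R[i])
  sq_integrable sq_integrable_submod_closed.

Record sqfun := Sqfun { sqfun_val :> R -> R[i] ; _ : sqfun_val \in sq_integrable }.
HB.instance Definition _ := [isSub of sqfun for sqfun_val].
HB.instance Definition _ := [Choice of sqfun by <:].
HB.instance Definition _ := [SubChoice_isSubLmodule of sqfun by <:].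

Definition ae_zero_set : set sqfun := [set f : sqfun | {ae mu, forall x, f x = 0}].
Definition ae_zero : {pred sqfun} := mem ae_zero_set.

Lemma ae_zeroP (f : sqfun) : reflect {ae mu, forall x, f x = 0} (f \in ae_zero).
Proof. by apply: (iffP idP) => [/set_mem|?]; [|exact: mem_set]. Qed.

Lemma ae_zero_submod_closed : submod_closed ae_zero.
Proof.
split; first by apply/ae_zeroP; exact: aeW.
move=> c f g /ae_zeroP f0 /ae_zeroP g0; apply/ae_zeroP.
apply: (@filterS2 _ _ (ae_filter_ringOfSetsType mu) _ _ _ _ f0 g0) => x fx gx.
have -> : ((c *: f + g : sqfun) : R -> R[i]) x = c * f x + g x by [].
by rewrite fx gx mulr0 addr0.
Qed.

HB.instance Definition _ := GRing.isSubmodClosed.Build R[i] sqfun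
  ae_zero ae_zero_submod_closed.

Definition L2 : Type := Quotient.quot ae_zero.
HB.instance Definition _ := Choice.on L2.
HB.instance Definition _ := GRing.Zmodule.on L2.
HB.instance Definition _ := EqQuotient.on L2.

Local Open Scope quotient_scope.

Definition L2_scale (c : R[i]) (xi : L2) : L2 :=
  \pi_L2 (c *: (repr xi : sqfun)).

Lemma L2_scale_pi c (f : sqfun) : L2_scale c (\pi_L2 f) = \pi_L2 (c *: f).
Proof.
apply/eqP; rewrite -Quotient.idealrBE -scalerBr; apply: rpredZ.
by rewrite Quotient.idealrBE reprK.
Qed.

Lemma L2_piD (f g : sqfun) : \pi_L2 (f + g) = \pi_L2 f + \pi_L2 g.
Proof. exact: Quotient.pi_add. Qed.

Lemma L2_scaleA a b xi : L2_scale a (L2_scale b xi) = L2_scale (a * b) xi.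
Proof.
elim/quotW: xi => f.
by rewrite [L2_scale b _]L2_scale_pi !L2_scale_pi scalerA.
Qed.

Lemma L2_scale1 : left_id 1 L2_scale.
Proof. by elim/quotW => f; rewrite L2_scale_pi scale1r. Qed.

Lemma L2_scaleDr : right_distributive L2_scale +%R.
Proof.
move=> c; elim/quotW => f; elim/quotW => g.
by rewrite -L2_piD !L2_scale_pi scalerDr L2_piD.
Qed.

Lemma L2_scaleDl xi : {morph L2_scale^~ xi : a b / a + b}.
Proof.
elim/quotW: xi => f a b; rewrite !L2_scale_pi scalerDl.
exact: L2_piD.
Qed.

HB.instance Definition _ := GRing.Zmodule_isLmodule.Build R[i] L2
  L2_scaleA L2_scale1 L2_scaleDr L2_scaleDl.

(* The representative of the class of [xi] picked by the quotient. *)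
Definition L2_fun (xi : L2) : R -> R[i] := (repr xi : sqfun).

End SquareIntegrable.
Coercion L2_fun : L2 >-> Funclass.

Section Operators.
Variable R : realType.
Local Notation mu := (@lebesgue_measure R).
Local Notation L2 := (L2 R).
Implicit Types (xi eta : L2) (a b : L2 -> L2).

Definition L2_norm xi : R := fine ('N[mu]_2%:E[EFin \o (@normc R \o xi)])%E.

Definition L2_inner xi eta : R[i] :=
  Complex (\int[mu]_x complex.Re (xi x * (eta x)^*%C))
          (\int[mu]_x complex.Im (xi x * (eta x)^*%C)).

Definition opnorm a : \bar R :=
  ereal_sup [set (L2_norm (a xi))%:E | xi in [set xi | L2_norm xi <= 1]].

Definition bounded_ops : set (L2 -> L2) :=
  [set a | linear a /\ (opnorm a < +oo)%E].

(* Exists and is unique for a bounded operator by the Riesz representation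
   theorem; for other maps the value is irrelevant. *)
Definition adjoint a : L2 -> L2 :=
  xget (fun=> 0) [set b | bounded_ops b /\
                  forall xi eta, L2_inner (a xi) eta = L2_inner xi (b eta)].

(* The support of the chosen representative: independent of this choice up to
   a null set, which is all that its measure sees. *)
Definition supp xi : set R := [set x | xi x != 0].

(* {nonneg \bar R} is the closed interval [0, +oo]: it contains +oo. *)
Definition Phi a (x : {nonneg \bar R}) : \bar R :=
  ereal_sup [set mu (supp (a xi)) | xi in
    [set xi | (mu (supp xi) <= x%:num)%E]].

End Operators.

Section SupportExpansion.
Variable R : realType.
Local Notation fn := ({nonneg \bar R} -> {nonneg \bar R}).
Implicit Types (f g : fn) (F : set fn).

Definition increasing f : Prop :=
  forall x y, (x%:num <= y%:num)%E -> ((f x)%:num <= (f y)%:num)%E.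

(* [adde x y] is [x + y] on extended reals; only the former is recognized when
   inferring nonnegativity. *)
Definition fn_add f g : fn := fun x => (adde (f x)%:num (g x)%:num)%:nng%E.

Definition B_fun f : set (L2 R -> L2 R) :=
  [set a | [/\ bounded_ops a,
               forall x, (Phi a x <= (f x)%:num)%E &
               forall x, (Phi (adjoint a) x <= (f x)%:num)%E]].

Definition B_fam F : set (L2 R -> L2 R) := \bigcup_(f in F) B_fun f.

Definition C_fam F : set (L2 R -> L2 R) :=
  [set a | bounded_ops a /\
    forall e : R, 0 < e -> exists2 b, B_fam F b & (opnorm (a - b)%R < e%:E)%E].

Definition admissible F : Prop :=
  [/\ F !=set0,
      forall f, F f -> increasing f,
      forall f g, F f -> F g -> F (fn_add f g) &
      forall f g, F f -> F g -> F (f \o g)].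

Definition support_expansion_algebras : set (set (L2 R -> L2 R)) :=
  [set C | exists2 F, admissible F & C = C_fam F].

Definition strictly_between (C D E : set (L2 R -> L2 R)) : Prop :=
  [/\ support_expansion_algebras E, C `<` E & E `<` D].

Definition covered_in_poset (C D : set (L2 R -> L2 R)) : Prop :=
  [/\ support_expansion_algebras C, support_expansion_algebras D,
      C `<` D & ~ exists E, strictly_between C D E].

(* The convention 0 * +oo = 0 is used for the convex combinations. *)
Definition concave_down f : Prop :=
  forall (t : {i01 R}) (x y : {nonneg \bar R}),
    (t%:num%:E * (f x)%:num + (1 - t%:num)%:E * (f y)%:num
      <= (f (adde (t%:num%:E * x%:num) ((1 - t%:num)%:E * y%:num))%:nng)%:num)%E.

(* On the reals t >= 0, the only ones that matter to the limits below, the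
   absolute value is t itself. *)
Definition at_real f (t : R) : \bar R := (f (`|t|%R%:E)%:nng%E)%:num.

Definition ICOD : set fn :=
  [set f | [/\ increasing f, concave_down f, (f 0%:E%:nng%E)%:num = 0%E &
               at_real f t @[t --> +oo] --> (f +oo%:nng%E)%:num]].

Definition ICOD0 : set fn := ICOD `&` [set f | at_real f t @[t --> 0^'+] --> 0%E].

Definition ICODbdd : set fn :=
  ICOD `&` [set f | exists M : R, forall x, ((f x)%:num <= M%:E)%E].

Definition ICOD0bdd : set fn := ICOD0 `&` ICODbdd.

Definition ICODfin : set fn :=
  ICOD `&` [set f | forall x, (x%:num < +oo)%E -> ((f x)%:num < +oo)%E].

End SupportExpansion.

(* Main.v *)
Require Import Defs.
From mathcomp Require Import all_boot all_order all_algebra.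
From mathcomp Require Import all_classical all_reals all_analysis.
From mathcomp Require Import measurable_realfun complex lra ring.

Set Implicit Arguments.
Unset Strict Implicit.
Unset Printing Implicit Defensive.

Import Order.TTheory GRing.Theory Num.Theory.
Import numFieldNormedType.Exports.
Import ComplexField.Normc.

Local Open Scope classical_set_scope.
Local Open Scope ring_scope.

(** Between the algebras of [ICOD0bdd] and [ICODfin], the algebra of an
    admissible family [F] depends only on two properties of [F]: whether
    some [f] in [F] is bounded below by a positive constant on (0, oo] (a jump at
    0), and whether some [f] in [F] dominates the identity.

    Without a jump, every [Phi a] tends to 0 at 0; as [Phi a] is subadditive
    (Lebesgue measure is atomless, so supports can be cut), it lies below the
    concave function inf_s Phi a(s) (1 + x / s), which is at most 2 Phi a.  If no
    element of [F] dominates the identity, then f(f(s)) < s for some finite s,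
    and an operator [a] with [Phi a], [Phi a^*] <= f has mu(supp(a^* eta)) <= s
    for all eta: a set S of measure s inside supp(a^* eta) is moved by [a] into a
    set T of measure at most f(s), so a^* eta agrees on S with a^* (1_T eta),
    whose support has measure at most f(f(s)).

    Conversely, the algebras contain operators that force [F] to be large: the
    identity, a weighted dilation carrying [a_k, 2 a_k[ onto [b_k, 2 b_k[ for all
    k, and the adjoint of eta |-> sum_k <eta, f_k> e_k, with e_k the normalized
    indicator of [2^-k, 2^(1-k)[ and f_k(x) = sqrt 2 cos(2 pi (k + 1) x) on [0, 1].
    An operator at distance less than 1/2 from one of these must still spread
    vectors of small support over large sets, because the images are flat. *)

(** * Functions and classes in L2 *)

Section L2Basics.
Variable R : realType.
Local Notation mu := (@lebesgue_measure R).
Local Notation Re := (@complex.Re R).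
Local Notation Im := (@complex.Im R).
Implicit Types (f g : R -> R[i]) (xi eta zeta : L2 R).

(** Inclusions between the algebras are reduced to the unclosed unions [B_fam]; norm approximation
    enters only when the membership of one explicit operator in [C_fam F] is turned into a lower
    bound for a member of [F]. The obstacle is that [F] is arbitrary: its members need be neither
    concave nor continuous nor zero at 0, so upper bounds in ICOD are sought for [Phi a] and not for
    members of [F]. Whatever [F] is, [Phi a] is zero at 0, subadditive, and determined at +oo by its
    finite values. For lower bounds, estimates along one scale extend to all arguments by
    monotonicity, and closure under sums absorbs constants, so factors such as 3/4 or 3/8 are
    harmless. A scale tending to 0 says nothing about large arguments; there domination of the
    identity, multiplied by an integer, takes over. The top cover needs a third property, a value
    +oo at a finite argument: together with a jump it gives a member of [F] that is +oo on (0, oo];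
    without it, f(1) is finite and [Phi a] is at most f(1) (1 + x). *)

Definition abs2 (z : R[i]) : R := Re z ^+ 2 + Im z ^+ 2.

Lemma abs2_ge0 z : 0 <= abs2 z.
Proof. by rewrite addr_ge0 ?sqr_ge0. Qed.

Lemma abs2_eq0 z : (abs2 z == 0) = (z == 0).
Proof.
case: z => a b; rewrite /abs2/= paddr_eq0 ?sqr_ge0// !sqrf_eq0.
by rewrite eq_complex.
Qed.

Lemma sqr_normc_abs2 z : normc z ^+ 2 = abs2 z.
Proof. by case: z => a b; rewrite /normc sqr_sqrtr ?addr_ge0 ?sqr_ge0. Qed.

Lemma measurable_abs2 f : measurable_fun [set: R] (Re \o f) ->
  measurable_fun [set: R] (Im \o f) ->
  measurable_fun [set: R] (fun x => (abs2 (f x))%:E).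
Proof.
move=> mr mi; apply/measurable_EFinP.
by apply: measurable_funD; exact: measurable_funX.
Qed.

Lemma Lnorm2E f : ('N[mu]_2%:E[EFin \o (@normc R \o f)] =
  (\int[mu]_x (abs2 (f x))%:E) `^ 2^-1)%E.
Proof.
rewrite unlock; congr (_ `^ _)%E; apply: eq_integral => x _ /=.
rewrite -sqr_normc_abs2 ger0_norm; last by case: (f x) => a b; exact: sqrtr_ge0.
by rewrite powR_mulrn// ; case: (f x) => a b; exact: sqrtr_ge0.
Qed.

Lemma sq_integrable_abs2 f :
  f \in @sq_integrable R <->
  [/\ measurable_fun [set: R] (Re \o f), measurable_fun [set: R] (Im \o f) &
      (\int[mu]_x (abs2 (f x))%:E < +oo)%E].
Proof.
split.
  move=> /sq_integrableP[mr mi]; rewrite /finite_norm Lnorm2E => h; split => //.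
  exact: lty_poweRy h.
move=> [mr mi h]; apply/sq_integrableP; split => //.
by rewrite /finite_norm Lnorm2E; exact: poweR_lty.
Qed.

Definition toL2 f : L2 R :=
  if pselect (f \in @sq_integrable R) is left h then
    (\pi_(L2 R) (Sqfun h))%qT else 0.

(* The notation [{ae mu, _}] carries a phantom copy of its predicate, which blocks
   rewriting inside it. *)
Definition ae (P : R -> Prop) : Prop := {ae mu, forall x, P x}.

Lemma ae_filter2 (P Q S : R -> Prop) : (forall x, P x -> Q x -> S x) ->
  ae (fun x => P x) -> ae (fun x => Q x) -> ae (fun x => S x).
Proof. by move=> h p q; exact: (@filterS2 _ _ (ae_filter_ringOfSetsType mu) _ _ _ h p q). Qed.

Lemma ae_filter1 (P S : R -> Prop) : (forall x, P x -> S x) ->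
  ae (fun x => P x) -> ae (fun x => S x).
Proof. by move=> h p; exact: (@filterS _ _ (ae_filter_ringOfSetsType mu) _ _ h p). Qed.

Lemma pi_L2E (f : sqfun R) : ae (fun x => ((\pi_(L2 R) f)%qT : L2 R) x = f x).
Proof.
have : (\pi_(L2 R) (repr (\pi_(L2 R) f)) = \pi_(L2 R) f)%qT by rewrite reprK.
move/eqP; rewrite -Quotient.idealrBE => /ae_zeroP.
apply: ae_filter1 => x /eqP; rewrite -[_ x]/(_ x - _ x) subr_eq0 => /eqP.
by [].
Qed.

Lemma toL2E f : f \in @sq_integrable R -> ae (fun x => toL2 f x = f x).
Proof. by rewrite /toL2; case: pselect => // h _; exact: pi_L2E. Qed.

Lemma L2_sq_integrable xi : (xi : R -> R[i]) \in @sq_integrable R.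
Proof. by rewrite /L2_fun; case: (repr xi). Qed.

Lemma L2_aeP xi eta : ae (fun x => xi x = eta x) -> xi = eta.
Proof.
move=> h; rewrite -[xi]reprK -[eta]reprK; apply/eqP.
rewrite -Quotient.idealrBE; apply/ae_zeroP.
apply: ae_filter1 h => x h; rewrite -[_ x]/(_ x - _ x).
by apply/eqP; rewrite subr_eq0; apply/eqP.
Qed.

Lemma L2_addE xi eta : ae (fun x => L2_fun (xi + eta) x = xi x + eta x).
Proof.
have -> : xi + eta = (\pi_(L2 R) (repr xi + repr eta))%qT.
  by rewrite L2_piD !reprK.
exact: pi_L2E.
Qed.

Lemma L2_scaleE (c : R[i]) xi : ae (fun x => L2_fun (c *: xi) x = c * xi x).
Proof.
have -> : c *: xi = (\pi_(L2 R) (c *: repr xi))%qT by [].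
exact: pi_L2E.
Qed.

Lemma L2_zeroE : ae (fun x => L2_fun (0 : L2 R) x = 0).
Proof.
rewrite -[X in L2_fun X](scale0r (0 : L2 R)).
by apply: ae_filter1 (@L2_scaleE 0 0) => x ->; rewrite mul0r.
Qed.

Lemma L2_oppE xi : ae (fun x => L2_fun (- xi) x = - xi x).
Proof.
by rewrite -scaleN1r; apply: ae_filter1 (@L2_scaleE (-1) xi) => x ->; rewrite mulN1r.
Qed.

Lemma L2_subE xi eta : ae (fun x => L2_fun (xi - eta) x = xi x - eta x).
Proof.
by apply: ae_filter2 (@L2_addE xi (- eta)) (@L2_oppE eta) => x -> ->.
Qed.

Lemma measurable_Re_L2 xi : measurable_fun [set: R] (Re \o xi).
Proof. by have /sq_integrable_abs2[] := L2_sq_integrable xi. Qed.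
Lemma measurable_Im_L2 xi : measurable_fun [set: R] (Im \o xi).
Proof. by have /sq_integrable_abs2[] := L2_sq_integrable xi. Qed.
Lemma measurable_abs2_L2 xi :
  measurable_fun [set: R] (fun x => (abs2 (xi x))%:E).
Proof. exact: measurable_abs2 (@measurable_Re_L2 xi) (@measurable_Im_L2 xi). Qed.
Lemma abs2_L2_lty xi : (\int[mu]_x (abs2 (xi x))%:E < +oo)%E.
Proof. by have /sq_integrable_abs2[] := L2_sq_integrable xi. Qed.

Lemma measurable_neq0 f : measurable_fun [set: R] (Re \o f) ->
  measurable_fun [set: R] (Im \o f) -> measurable [set x | f x != 0].
Proof.
move=> mr mi; rewrite (_ : mkset _ = (fun x => (abs2 (f x))%:E) @^-1` (~` [set 0%E])).
  rewrite -[X in measurable X]setTI.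
  by apply: measurable_abs2 => //; apply: measurableC.
apply/seteqP; split => x /=.
  by rewrite -abs2_eq0 => /negP h [] /eqP.
by move=> h; rewrite -abs2_eq0; apply/negP => /eqP h0; apply: h; rewrite h0.
Qed.

Lemma measurable_supp xi : measurable (supp xi).
Proof. exact: measurable_neq0 (@measurable_Re_L2 xi) (@measurable_Im_L2 xi). Qed.

(** Vectors are seen through chosen representatives, so inclusions between supports hold only almost
    everywhere; the exceptional null set is absorbed into [B]. *)
Lemma le_mu_ae (A B : set R) : measurable A -> measurable B ->
  ae (fun x => A x -> B x) -> (mu A <= mu B)%E.
Proof.
move=> mA mB [N [mN N0 sN]].
have -> : mu B = mu (B `|` N).
  by rewrite measureU0.
apply: le_measure; rewrite ?inE//; first exact: measurableU.
move=> x Ax; case: (pselect (B x)) => [|nB]; [by left|right].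
by apply: sN => /= h; exact: nB (h Ax).
Qed.

End L2Basics.

(** * The real part of the inner product *)

Section RealInnerProduct.
Variable R : realType.
Local Notation mu := (@lebesgue_measure R).
Local Notation Re := (@complex.Re R).
Local Notation Im := (@complex.Im R).
Implicit Types (f g : R -> R[i]) (xi eta zeta : L2 R).

Lemma Lfun2_abs2 xi (f : R -> R) : measurable_fun [set: R] f ->
  (forall x, f x ^+ 2 <= abs2 (xi x)) -> f \in Lfun mu 2%:E.
Proof.
move=> mf h; rewrite inE; apply/andP; split; rewrite inE//=.
rewrite /finite_norm unlock; apply: poweR_lty.
apply: le_lt_trans (abs2_L2_lty xi); apply: ge0_le_integral => //.
- by move=> x _; exact: poweR_ge0.
- apply/measurable_EFinP.
  apply: (@measurableT_comp _ _ _ _ _ _ (fun x : R => x `^ 2)%R) => //.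
  exact: measurableT_comp.
- exact: measurable_abs2_L2.
- move=> x _; rewrite lee_fin /= powR_mulrn// real_normK ?num_real//.
Qed.

Lemma Re_L2_Lfun xi : Re \o xi \in Lfun mu 2%:E.
Proof.
by apply: (@Lfun2_abs2 xi) (@measurable_Re_L2 _ xi) _ => x; rewrite lerDl sqr_ge0.
Qed.

Lemma Im_L2_Lfun xi : Im \o xi \in Lfun mu 2%:E.
Proof.
by apply: (@Lfun2_abs2 xi) (@measurable_Im_L2 _ xi) _ => x; rewrite lerDr sqr_ge0.
Qed.

(** The real part of [xi x] times the conjugate of [eta x]. The space is mostly treated as a real
    Hilbert space: the real form determines norms and adjoints, and complex linearity is recovered
    through [rdot_conj]. *)
Definition rdotf xi eta (x : R) : R :=
  Re (xi x) * Re (eta x) + Im (xi x) * Im (eta x).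

Lemma integrable_rdotf xi eta : mu.-integrable setT (EFin \o rdotf xi eta).
Proof.
have hr := Lfun2_mul_Lfun1 (Re_L2_Lfun xi) (Re_L2_Lfun eta).
have hi := Lfun2_mul_Lfun1 (Im_L2_Lfun xi) (Im_L2_Lfun eta).
have /= := integrableD measurableT (proj1 (Lfun1_integrable _ _) hr) (proj1 (Lfun1_integrable _ _) hi).
by [].
Qed.

Lemma measurable_rdotf xi eta : measurable_fun setT (rdotf xi eta).
Proof. by apply/measurable_EFinP; have /integrableP[] := integrable_rdotf xi eta. Qed.

Definition rdot xi eta : R := \int[mu]_x rdotf xi eta x.

Lemma rdot_ae xi eta (h : R -> R) : measurable_fun setT h ->
  ae (fun x => rdotf xi eta x = h x) -> rdot xi eta = \int[mu]_x h x.
Proof.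
move=> mh e; rewrite /rdot /Rintegral; congr fine.
have m1 : measurable_fun [set: R] (fun x => (rdotf xi eta x)%:E).
  apply/measurable_EFinP; exact: measurable_rdotf.
have m2 : measurable_fun [set: R] (fun x => (h x)%:E) by exact/measurable_EFinP.
apply: ae_eq_integral => //.
by apply: ae_filter1 e => x /= -> _.
Qed.

Lemma rdotC xi eta : rdot xi eta = rdot eta xi.
Proof.
by apply: eq_Rintegral => x _; rewrite /rdotf mulrC [X in _ + X]mulrC.
Qed.

Lemma rdotDl xi eta zeta : rdot (xi + eta) zeta = rdot xi zeta + rdot eta zeta.
Proof.
rewrite /rdot -RintegralD//; [|exact: integrable_rdotf..].
apply: rdot_ae; first by apply: measurable_funD; exact: measurable_rdotf.
apply: ae_filter1 (L2_addE xi eta) => x; rewrite /rdotf => ->.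
by rewrite Defs.ReD Defs.ImD /=; ring.
Qed.

Lemma rdotZl (r : R) xi eta : rdot (r%:C%C *: xi) eta = r * rdot xi eta.
Proof.
rewrite /rdot -RintegralZl//; last exact: integrable_rdotf.
apply: rdot_ae; first by apply: measurable_funM => //; exact: measurable_rdotf.
apply: ae_filter1 (L2_scaleE r%:C%C xi) => x; rewrite /rdotf => ->.
by rewrite Defs.ReM Defs.ImM /=; ring.
Qed.

Lemma rdot_conj (c : R[i]) xi eta : rdot (c *: xi) eta = rdot xi (c^*%C *: eta).
Proof.
apply: rdot_ae; first exact: measurable_rdotf.
apply: ae_filter2 (L2_scaleE c xi) (L2_scaleE c^*%C eta) => x.
rewrite /rdotf => -> ->; rewrite !Defs.ReM !Defs.ImM; case: c => a b /=; ring.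
Qed.

Lemma rdotDr xi eta zeta : rdot xi (eta + zeta) = rdot xi eta + rdot xi zeta.
Proof. by rewrite rdotC rdotDl !(rdotC _ xi). Qed.

Lemma rdotZr (r : R) xi eta : rdot xi (r%:C%C *: eta) = r * rdot xi eta.
Proof. by rewrite rdotC rdotZl rdotC. Qed.

Lemma rdotNl xi eta : rdot (- xi) eta = - rdot xi eta.
Proof. by rewrite -scaleN1r -(rmorph1 (real_complex R)) -rmorphN rdotZl mulN1r. Qed.

Lemma rdotNr xi eta : rdot xi (- eta) = - rdot xi eta.
Proof. by rewrite rdotC rdotNl rdotC. Qed.

Lemma rdotBl xi eta zeta : rdot (xi - eta) zeta = rdot xi zeta - rdot eta zeta.
Proof. by rewrite rdotDl rdotNl. Qed.

Lemma rdotBr xi eta zeta : rdot xi (eta - zeta) = rdot xi eta - rdot xi zeta.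
Proof. by rewrite rdotDr rdotNr. Qed.

Lemma rdot0l xi : rdot 0 xi = 0.
Proof. by rewrite -(subrr (0 : L2 R)) rdotBl subrr. Qed.

Lemma rdotxxE xi : (rdot xi xi)%:E = (\int[mu]_x (abs2 (xi x))%:E)%E.
Proof.
rewrite /rdot /Rintegral fineK.
  by apply: eq_integral => x _; rewrite /rdotf -!expr2.
exact: integrable_fin_num measurableT _ (integrable_rdotf xi xi).
Qed.

Lemma rdot_ge0 xi : 0 <= rdot xi xi.
Proof. by rewrite -lee_fin rdotxxE integral_ge0// => x _; rewrite lee_fin abs2_ge0. Qed.

Lemma rdot_eq0 xi : rdot xi xi = 0 -> xi = 0.
Proof.
move=> h; have := rdotxxE xi; rewrite h => /esym h0.
apply: L2_aeP.
have := proj1 (ae_eq_integral_abs mu measurableT (@measurable_abs2_L2 _ xi)).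
under eq_integral => x _ do rewrite gee0_abs ?lee_fin ?abs2_ge0//.
move=> /(_ h0) e; apply: ae_filter2 e (L2_zeroE R) => x /= e ->.
by have [] := e I => /eqP; rewrite abs2_eq0 => /eqP.
Qed.

Lemma sqr_L2_norm xi : L2_norm xi ^+ 2 = rdot xi xi.
Proof.
rewrite /L2_norm Lnorm2E -rdotxxE /= -powR_mulrn ?powR_ge0//.
by rewrite -powRrM mulVf ?pnatr_eq0// powRr1// rdot_ge0.
Qed.

Lemma L2_norm_ge0 xi : 0 <= L2_norm xi.
Proof. by rewrite /L2_norm Lnorm2E -rdotxxE /= powR_ge0. Qed.

Lemma le_L2_norm xi (r : R) : 0 <= r -> (L2_norm xi <= r) = (rdot xi xi <= r ^+ 2).
Proof. by move=> r0; rewrite -sqr_L2_norm ler_pXn2r// nnegrE// L2_norm_ge0. Qed.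

(** The inner product is conjugate linear on the right, so pairing with i eta multiplies it by -i,
    and the real part of -i z is the imaginary part of z. *)
Lemma L2_innerE xi eta :
  L2_inner xi eta = Complex (rdot xi eta) (rdot xi ('i%C *: eta)).
Proof.
rewrite /L2_inner; congr Complex.
  by apply: eq_Rintegral => x _; rewrite Defs.ReM /rdotf; case: (eta x) => a b /=; ring.
apply/esym/rdot_ae.
  rewrite (_ : (fun _ => _) = fun x => Im (xi x) * Re (eta x) - Re (xi x) * Im (eta x)).
    apply: measurable_funB; apply: measurable_funM.
    - exact: measurable_Im_L2.
    - exact: measurable_Re_L2.
    - exact: measurable_Re_L2.
    - exact: measurable_Im_L2.
  by apply/funext => x; rewrite Defs.ImM; case: (eta x) => a b /=; ring.
apply: ae_filter1 (L2_scaleE 'i%C eta) => x; rewrite /rdotf => ->.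
by rewrite Defs.ReM !Defs.ImM; case: (eta x) => a b /=; ring.
Qed.

End RealInnerProduct.

(** * Completeness and adjoints *)

Section Completeness.
Variable R : realType.
Local Notation mu := (@lebesgue_measure R).
Local Notation Re := (@complex.Re R).
Local Notation Im := (@complex.Im R).
Implicit Types (f g : R -> R[i]) (xi eta zeta : L2 R).

Lemma cvg_fast_Cauchy (K : R) (a : R^nat) :
  (forall n, `|a n.+1 - a n| <= K * 2^-1 ^+ n) -> cvgn a.
Proof.
move=> h.
have K0 : 0 <= K by have := h 0%N; rewrite expr0 mulr1; apply: le_trans.
suff : cvgn (series (telescope a)).
  move=> c; rewrite (_ : a = fun n => a 0%N + series (telescope a) n).
    by apply: is_cvgD => //; exact: is_cvg_cst.
  by apply/funext => n; exact: eq_sum_telescope.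
apply: normed_cvg; apply: (@series_le_cvg _ _ (geometric K 2^-1)).
- by move=> n /=.
- by move=> n; apply: geometric_ge0.
- by move=> n; exact: h.
- by apply: is_cvg_geometric_series; rewrite ger0_norm// invf_lt1// ltr1n.
Qed.

Lemma nneseries_geometric_lty (C q : R) : 0 <= C -> 0 <= q -> q < 1 ->
  (\sum_(0 <= n <oo) (C * q ^+ n)%:E < +oo)%E.
Proof.
move=> C0 q0 q1.
apply: (@le_lt_trans _ _ (C / (1 - q))%:E); last by rewrite ltry.
apply: lime_le.
  by apply: is_cvg_nneseries => n _ _; rewrite lee_fin mulr_ge0// exprn_ge0.
apply: nearW => n; rewrite sumEFin lee_fin.
have -> : \sum_(0 <= i < n) C * q ^+ i = C * (1 - q ^+ n) / (1 - q).
  have := @geometric_seriesE R C q; rewrite lt_eqF// => /(_ isT).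
  by move=> /(congr1 (fun s => s n)); rewrite seriesEnat.
rewrite ler_pM2r ?invr_gt0 ?subr_gt0//.
by rewrite ler_piMr// gerBl exprn_ge0.
Qed.

Lemma abs2D z1 z2 : @abs2 R (z1 + z2) <= 2 * abs2 z1 + 2 * abs2 z2.
Proof.
case: z1 z2 => a b [c d].
rewrite /abs2/= -subr_ge0.
have -> : 2 * (a ^+ 2 + b ^+ 2) + 2 * (c ^+ 2 + d ^+ 2) - ((a + c) ^+ 2 + (b + d) ^+ 2)
  = (a - c) ^+ 2 + (b - d) ^+ 2 by ring.
by rewrite addr_ge0 ?sqr_ge0.
Qed.

Lemma measurable_ReB xi eta : measurable_fun setT (Re \o (fun x => xi x - eta x)).
Proof.
rewrite (_ : _ \o _ = fun x => Re (xi x) - Re (eta x)).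
  by apply: measurable_funB; exact: measurable_Re_L2.
by apply/funext => x /=; case: (xi x) (eta x) => a b [].
Qed.

Lemma measurable_ImB xi eta : measurable_fun setT (Im \o (fun x => xi x - eta x)).
Proof.
rewrite (_ : _ \o _ = fun x => Im (xi x) - Im (eta x)).
  by apply: measurable_funB; exact: measurable_Im_L2.
by apply/funext => x /=; case: (xi x) (eta x) => a b [].
Qed.

Lemma rdotBBE xi eta :
  (rdot (xi - eta) (xi - eta))%:E = (\int[mu]_x (abs2 (xi x - eta x))%:E)%E.
Proof.
rewrite rdotxxE; apply: ae_eq_integral => //.
- exact: measurable_abs2_L2.
- exact: measurable_abs2 (measurable_ReB xi eta) (measurable_ImB xi eta).
- by apply: ae_filter1 (L2_subE xi eta) => x /= -> _.
Qed.

Lemma limn_einf_le (u : (\bar R)^nat) (K : \bar R) :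
  (forall n, (u n <= K)%E) -> (limn_einf u <= K)%E.
Proof.
move=> h; rewrite limn_einf_lim; apply: lime_le; first exact: is_cvg_einfs.
by apply: nearW => n; apply: le_trans (h n); apply: ereal_inf_lbound; exists n => /=.
Qed.

(* [sum_n 4^n |u_(n+1) - u_n|^2] is integrable, hence finite almost everywhere,
   which makes [u n x] a fast Cauchy sequence; the norm bound is Fatou's lemma. *)
Lemma L2_complete (u : nat -> L2 R) (C : R) :
  (forall n m, (n <= m)%N -> rdot (u m - u n) (u m - u n) <= C * 16^-1 ^+ n) ->
  exists w, forall n, rdot (w - u n) (w - u n) <= C * 16^-1 ^+ n.
Proof.
move=> h.
have C0 : 0 <= C by have := h 0%N 0%N isT; rewrite expr0 mulr1; apply: le_trans; exact: rdot_ge0.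
pose d n x := abs2 (u n.+1 x - u n x).
pose H x : \bar R := (\sum_(0 <= n <oo) (4 ^+ n * d n x)%:E)%E.
have md n : measurable_fun [set: R] (fun x => (4 ^+ n * d n x)%:E).
  apply/measurable_EFinP; apply: measurable_funM => //; apply/measurable_EFinP.
  exact: measurable_abs2 (measurable_ReB _ _) (measurable_ImB _ _).
have d0 n x : 0 <= d n x by exact: abs2_ge0.
have mH : measurable_fun [set: R] H.
  by apply: ge0_emeasurable_sum => // n x _ _; rewrite lee_fin mulr_ge0// exprn_ge0.
have H0 x : (0 <= H x)%E.
  by apply: nneseries_ge0 => n _ _; rewrite lee_fin mulr_ge0// exprn_ge0.
(* Integrated termwise, the weight 4^n against the bound C 16^-n leaves a geometric series of ratio
   1/4. *)
have intH : (\int[mu]_x H x < +oo)%E.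
  rewrite integral_nneseries//; last first.
    by move=> n x _; rewrite lee_fin mulr_ge0// exprn_ge0.
  apply: (@le_lt_trans _ _ (\sum_(0 <= n <oo) (C * 4^-1 ^+ n)%:E)%E); last first.
    by apply: nneseries_geometric_lty => //; rewrite invf_lt1// ltr1n.
  apply: lee_nneseries.
    by move=> n _ _; apply: integral_ge0 => x _; rewrite lee_fin mulr_ge0// exprn_ge0.
  move=> n _.
  under eq_integral do rewrite EFinM.
  rewrite ge0_integralZl//; last first.
  - by move=> x _; rewrite lee_fin.
  - exact: measurable_abs2 (measurable_ReB _ _) (measurable_ImB _ _).
  rewrite -rdotBBE -EFinM lee_fin.
  apply: (@le_trans _ _ (4 ^+ n * (C * 16^-1 ^+ n))).
    by rewrite ler_pM2l ?exprn_gt0//; apply: h.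
  rewrite mulrCA -exprMn.
  by rewrite (_ : 4 * 16^-1 = 4^-1 :> R)//; field.
pose G := H @^-1` [set r | r \is a fin_num].
have mG : measurable G.
  rewrite /G -[X in measurable X]setTI.
  exact: emeasurable_fin_num mH.
have aeG : ae G.
  apply: ae_filter1 (integrable_ae measurableT (_ : mu.-integrable setT H)).
    by move=> x; apply.
  apply/integrableP; split => //.
  by under eq_integral do rewrite gee0_abs//.
have dG n x : G x -> d n x <= fine (H x) * 4^-1 ^+ n.
  rewrite /G /= => Gx; rewrite exprVn ler_pdivlMr ?exprn_gt0// mulrC -lee_fin fineK//.
  have := @nneseries_lim_ge R (fun n => (4 ^+ n * d n x)%:E) xpredT 0 n.+1.
  move=> /(_ _)/(le_trans _); apply; last by move=> k _ _; rewrite lee_fin mulr_ge0// exprn_ge0.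
  rewrite big_nat_recr//= leeDr// sume_ge0// => k _.
  by rewrite lee_fin mulr_ge0// exprn_ge0.
(* [M + 1] stands in for the square root of [M], since M <= (M + 1)^2. *)
have sq_bound (M t : R) n : 0 <= M -> t ^+ 2 <= M * 4^-1 ^+ n -> `|t| <= (M + 1) * 2^-1 ^+ n.
  move=> M0 ht; rewrite -ler_sqr ?nnegrE// ?mulr_ge0 ?exprn_ge0 ?addr_ge0//.
  rewrite real_normK ?num_real// (le_trans ht)// exprMn.
  rewrite (_ : (2^-1 ^+ n) ^+ 2 = 4^-1 ^+ n); last first.
    by rewrite -exprM mulnC exprM; congr (_ ^+ _); field.
  by rewrite ler_wpM2r ?exprn_ge0//; nra.
have fH0 x : 0 <= fine (H x) by rewrite fine_ge0.
pose r x := if x \in G then limn (fun n => Re (u n x)) else 0.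
pose i x := if x \in G then limn (fun n => Im (u n x)) else 0.
have cr x : G x -> (fun n => Re (u n x)) @ \oo --> limn (fun n => Re (u n x)).
  move=> Gx; apply: (@cvg_fast_Cauchy (fine (H x) + 1)) => n.
  apply: sq_bound => //; apply: le_trans (dG n x Gx).
  rewrite /d /abs2; case: (u n.+1 x) (u n x) => a b [a' b'] /=.
  by rewrite lerDl sqr_ge0.
have ci x : G x -> (fun n => Im (u n x)) @ \oo --> limn (fun n => Im (u n x)).
  move=> Gx; apply: (@cvg_fast_Cauchy (fine (H x) + 1)) => n.
  apply: sq_bound => //; apply: le_trans (dG n x Gx).
  rewrite /d /abs2; case: (u n.+1 x) (u n x) => a b [a' b'] /=.
  by rewrite lerDr sqr_ge0.
have mlim (v : nat -> R -> R) : (forall n, measurable_fun setT (v n)) ->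
    (forall x, G x -> v ^~ x @ \oo --> limn (v ^~ x)) ->
    measurable_fun setT (fun x => if x \in G then limn (v ^~ x) else 0).
  move=> mv cv.
  apply: (@measurable_fun_cvg _ _ R setT (fun n x => if x \in G then v n x else 0)).
    move=> n; apply: measurable_fun_if => //.
      by apply: (measurable_fun_bool true); rewrite setTI preimage_mem_true.
    by apply: measurable_funTS.
  move=> x _; case: ifPn => [/set_mem|_]; first exact: cv.
  exact: cvg_cst.
have mr : measurable_fun setT r by apply: mlim => // n; exact: measurable_Re_L2.
have mi : measurable_fun setT i by apply: mlim => // n; exact: measurable_Im_L2.
pose w x := Complex (r x) (i x).
have bw n : (\int[mu]_x (abs2 (w x - u n x))%:E <= (C * 16^-1 ^+ n)%:E)%E.
  have mwr : measurable_fun [set: R] (Re \o (fun x => w x - u n x)).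
    rewrite (_ : _ \o _ = fun x => r x - Re (u n x)).
      by apply: measurable_funB => //; exact: measurable_Re_L2.
    by apply/funext => x /=; case: (u n x).
  have mwi : measurable_fun [set: R] (Im \o (fun x => w x - u n x)).
    rewrite (_ : _ \o _ = fun x => i x - Im (u n x)).
      by apply: measurable_funB => //; exact: measurable_Im_L2.
    by apply/funext => x /=; case: (u n x).
  pose F m x := (abs2 (u (m + n)%N x - u n x))%:E.
  have mF m : measurable_fun [set: R] (F m).
    exact: measurable_abs2 (measurable_ReB _ _) (measurable_ImB _ _).
  (* On [G] the shifted sequence converges pointwise, so the integrand is a lower limit almost
     everywhere and Fatou's lemma applies. *)
  have -> : (\int[mu]_x (abs2 (w x - u n x))%:E = \int[mu]_x limn_einf (F ^~ x))%E.
    apply: ae_eq_integral => //.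
    - exact: measurable_abs2.
    - have mes : measurable_fun [set: R] (fun x => limn_esup (fun m => - F m x)%E).
        apply: (@measurable_fun_limn_esup _ _ _ _ (fun m x => - F m x)%E) => m.
        exact: measurableT_comp.
      have -> : (fun x => limn_einf (F ^~ x)) =
          -%E \o (fun x => limn_esup (fun m => - F m x)%E).
        apply/funext => x /=; rewrite -limn_einfN; congr limn_einf.
        by apply/funext => m /=; rewrite opprK.
      exact: measurableT_comp.
    apply: ae_filter1 aeG => x Gx _; apply/esym.
    have : F ^~ x @ \oo --> (abs2 (w x - u n x))%:E.
      apply: cvg_EFin; first by apply: nearW.
      rewrite /F /abs2 /=.
      have -> : (fine \o (fun m => (Re (u (m + n)%N x - u n x) ^+ 2 + Im (u (m + n)%N x - u n x) ^+ 2)%:E)) =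
         (fun m => (Re (u (m + n)%N x) - Re (u n x)) ^+ 2 + (Im (u (m + n)%N x) - Im (u n x)) ^+ 2).
        by apply/funext => m /=; case: (u (m + n)%N x) (u n x) => a b [].
      have -> : Re (w x - u n x) = r x - Re (u n x) by rewrite /w; case: (u n x).
      have -> : Im (w x - u n x) = i x - Im (u n x) by rewrite /w; case: (u n x).
      rewrite /r /i mem_set// !expr2.
      have c1 := cr x Gx; rewrite -(cvg_shiftn n) in c1.
      have c2 := ci x Gx; rewrite -(cvg_shiftn n) in c2.
      by apply: cvgD; apply: cvgM; apply: cvgB => //; exact: cvg_cst.
    by move=> /cvg_limn_einf_sup[].
  apply: le_trans (fatou _ _ _ _) _ => //.
    by move=> m x _; rewrite lee_fin abs2_ge0.
  apply: limn_einf_le => m.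
  by rewrite -rdotBBE lee_fin; apply: h; exact: leq_addl.
have sw : w \in @sq_integrable R.
  apply/sq_integrable_abs2; split => //.
  apply: (@le_lt_trans _ _ (\int[mu]_x (2%:E * (abs2 (w x - u 0%N x))%:E + 2%:E * (abs2 (u 0%N x))%:E))%E).
    apply: ge0_le_integral => //.
    - by move=> x _; rewrite lee_fin abs2_ge0.
    - exact: measurable_abs2.
    - apply: emeasurable_funD; apply: measurable_funeM.
        apply: measurable_abs2.
          rewrite (_ : _ \o _ = fun x => r x - Re (u 0%N x)).
            by apply: measurable_funB => //; exact: measurable_Re_L2.
          by apply/funext => x /=; case: (u 0%N x).
        rewrite (_ : _ \o _ = fun x => i x - Im (u 0%N x)).
          by apply: measurable_funB => //; exact: measurable_Im_L2.
        by apply/funext => x /=; case: (u 0%N x).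
      exact: measurable_abs2_L2.
    move=> x _; rewrite -!EFinM -EFinD lee_fin.
    by rewrite -[w x in leLHS](subrK (u 0%N x)); exact: abs2D.
  have m1 : measurable_fun [set: R] (fun x => (abs2 (w x - u 0%N x))%:E).
    apply: measurable_abs2.
      rewrite (_ : _ \o _ = fun x => r x - Re (u 0%N x)).
        by apply: measurable_funB => //; exact: measurable_Re_L2.
      by apply/funext => x /=; case: (u 0%N x).
    rewrite (_ : _ \o _ = fun x => i x - Im (u 0%N x)).
      by apply: measurable_funB => //; exact: measurable_Im_L2.
    by apply/funext => x /=; case: (u 0%N x).
  have m2 := @measurable_abs2_L2 R (u 0%N).
  have p1 x : [set: R] x -> (0 <= (abs2 (w x - u 0%N x))%:E)%E.
    by move=> _; rewrite lee_fin abs2_ge0.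
  have p2 x : [set: R] x -> (0 <= (abs2 (u 0%N x))%:E)%E.
    by move=> _; rewrite lee_fin abs2_ge0.
  rewrite ge0_integralD//; last 4 first.
  - by move=> x _; rewrite mule_ge0// p1.
  - exact: measurable_funeM.
  - by move=> x _; rewrite mule_ge0// p2.
  - exact: measurable_funeM.
  rewrite !ge0_integralZl//; apply: lte_add_pinfty.
    by apply: lte_mul_pinfty => //; apply: le_lt_trans (bw 0%N) _; rewrite ltry.
  by apply: lte_mul_pinfty => //; exact: abs2_L2_lty.
exists (toL2 w) => n.
rewrite -lee_fin rdotBBE; apply: le_trans (bw n).
rewrite le_eqVlt; apply/orP; left; apply/eqP; apply: ae_eq_integral => //.
- exact: measurable_abs2 (measurable_ReB _ _) (measurable_ImB _ _).
- apply: measurable_abs2.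
    rewrite (_ : _ \o _ = fun x => r x - Re (u n x)).
      by apply: measurable_funB => //; exact: measurable_Re_L2.
    by apply/funext => x /=; case: (u n x).
  rewrite (_ : _ \o _ = fun x => i x - Im (u n x)).
    by apply: measurable_funB => //; exact: measurable_Im_L2.
  by apply/funext => x /=; case: (u n x).
- by apply: ae_filter1 (toL2E sw) => x /= -> _.
Qed.

End Completeness.

(** * Riesz representation and adjoints of bounded operators *)

Section Adjoint.
Variable R : realType.
Local Notation mu := (@lebesgue_measure R).
Implicit Types (xi eta zeta : L2 R) (a b : L2 R -> L2 R).

(** Evaluation at the minimizer -q/p. If p = 0 and q is nonzero, the polynomial is affine and takes
    the value -1 at -(r + 1)/(2q). *)
Lemma quadratic_ge0_discr (p q r : R) : 0 <= p ->
  (forall s, 0 <= p * s ^+ 2 + 2 * q * s + r) -> q ^+ 2 <= p * r.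
Proof.
move=> p0 h; have [p00|pn0] := eqVneq p 0.
  have [->|q0] := eqVneq q 0; first by rewrite p00 expr0n/= mul0r.
  have := h (- (r + 1) / (2 * q)); rewrite p00 mul0r add0r.
  have -> : 2 * q * (- (r + 1) / (2 * q)) + r = -1 by field.
  by rewrite ler0N1.
have pp : 0 < p by rewrite lt_neqAle eq_sym pn0.
have := h (- q / p); rewrite -(pmulr_rge0 _ pp).
have -> : p * (p * (- q / p) ^+ 2 + 2 * q * (- q / p) + r) = p * r - q ^+ 2 by field.
by rewrite subr_ge0.
Qed.

Lemma rdot_CauchySchwarz xi eta : rdot xi eta ^+ 2 <= rdot xi xi * rdot eta eta.
Proof.
rewrite mulrC; apply: quadratic_ge0_discr; first exact: rdot_ge0.
move=> s; have := rdot_ge0 (xi + s%:C%C *: eta).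
rewrite rdotDl !rdotDr !rdotZl !rdotZr (rdotC eta xi) => h.
by apply: le_trans h _; rewrite le_eqVlt; apply/orP; left; apply/eqP; ring.
Qed.

Section LinearMaps.
Variable a : L2 R -> L2 R.
Hypothesis la : linear a.

Lemma L2_lin0 : a 0 = 0.
Proof. by have := la (-1) 0 0; rewrite scaler0 addr0 scaleN1r addNr. Qed.

Lemma L2_linD xi eta : a (xi + eta) = a xi + a eta.
Proof. by have := la 1 xi eta; rewrite !scale1r. Qed.

Lemma L2_linZ (c : R[i]) xi : a (c *: xi) = c *: a xi.
Proof. by have := la c xi 0; rewrite !addr0 L2_lin0 addr0. Qed.

Lemma L2_linN xi : a (- xi) = - a xi.
Proof. by rewrite -scaleN1r L2_linZ scaleN1r. Qed.

Lemma L2_linB xi eta : a (xi - eta) = a xi - a eta.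
Proof. by rewrite L2_linD L2_linN. Qed.

Lemma opnorm_rdot_le (C : R) : 0 <= C -> (opnorm a <= C%:E)%E ->
  forall xi, rdot (a xi) (a xi) <= C ^+ 2 * rdot xi xi.
Proof.
move=> C0 h xi.
have [xi0|xi0] := eqVneq (rdot xi xi) 0.
  by rewrite (rdot_eq0 xi0) L2_lin0 rdot0l mulr0.
have r0 : 0 < rdot xi xi by rewrite lt_neqAle eq_sym xi0 rdot_ge0.
pose s := (Num.sqrt (rdot xi xi))^-1.
have s2 : s * s * rdot xi xi = 1.
  by rewrite -expr2 exprVn sqr_sqrtr ?rdot_ge0// mulVf.
have : ((L2_norm (a (s%:C%C *: xi)))%:E <= C%:E)%E.
  apply: le_trans h; apply: ereal_sup_ubound.
  exists (s%:C%C *: xi) => //=; rewrite le_L2_norm// rdotZl rdotZr expr1n.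
  by rewrite mulrA s2.
rewrite lee_fin le_L2_norm// L2_linZ rdotZl rdotZr mulrA => hC.
rewrite -[leLHS]mul1r -s2 mulrAC ler_pM2r//.
Qed.

Lemma bounded_ops_rdot (C : R) : 0 <= C ->
  (forall xi, rdot (a xi) (a xi) <= C * rdot xi xi) -> bounded_ops a.
Proof.
(* [C + 1] bounds the norm without a square root, since C <= (C + 1)^2. *)
move=> C0 h; split => //; apply: (@le_lt_trans _ _ (C + 1)%:E); last by rewrite ltry.
apply: ge_ereal_sup => _ [xi /= xi1 <-]; rewrite lee_fin.
have x1 : rdot xi xi <= 1 by have := xi1; rewrite le_L2_norm// expr1n.
rewrite le_L2_norm ?addr_ge0//; apply: le_trans (h xi) _.
have := rdot_ge0 xi; nra.
Qed.

End LinearMaps.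

Lemma bounded_ops_bound a : bounded_ops a ->
  exists2 C : R, 0 <= C & forall xi, rdot (a xi) (a xi) <= C * rdot xi xi.
Proof.
move=> [la aoo].
have h : (opnorm a <= (fine (opnorm a))%:E)%E.
  case: (opnorm a) aoo => [r _|//|_] /=; [exact: lexx|exact: leNye].
exists (Num.max 0 (fine (opnorm a)) ^+ 2); first by rewrite sqr_ge0.
apply: opnorm_rdot_le => //; first by rewrite le_max lexx.
by apply: le_trans h _; rewrite lee_fin le_max lexx orbT.
Qed.

(* The representing vector minimizes [rdot xi xi - 2 * phi xi]. *)
Lemma Riesz_rdot (phi : L2 R -> R) (K : R) :
  (forall xi eta, phi (xi + eta) = phi xi + phi eta) ->
  (forall (r : R) xi, phi (r%:C%C *: xi) = r * phi xi) ->
  (forall xi, phi xi ^+ 2 <= K * rdot xi xi) ->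
  exists u, forall xi, phi xi = rdot xi u.
Proof.
move=> phiD phiZ phiK.
have phi0 : phi 0 = 0.
  by have := phiD 0 0; rewrite addr0 => /eqP; rewrite -subr_eq subrr => /eqP.
have phiN xi : phi (- xi) = - phi xi.
  by apply/eqP; rewrite -addr_eq0 -phiD addNr phi0.
pose J xi := rdot xi xi - 2 * phi xi.
(* By the arithmetic-geometric mean inequality, |phi xi| <= (|K| + |xi|^2) / 2. *)
have Jlb xi : - `|K| <= J xi.
  have N0 := rdot_ge0 xi.
  have h : phi xi ^+ 2 <= ((`|K| + rdot xi xi) / 2) ^+ 2.
    apply: le_trans (phiK xi) _; apply: (@le_trans _ _ (`|K| * rdot xi xi)).
      by rewrite ler_wpM2r// ler_norm.
    rewrite -subr_ge0.
    have -> : ((`|K| + rdot xi xi) / 2) ^+ 2 - `|K| * rdot xi xi =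
      ((`|K| - rdot xi xi) / 2) ^+ 2 by field.
    exact: sqr_ge0.
  have h0 : 0 <= (`|K| + rdot xi xi) / 2 by rewrite divr_ge0// addr_ge0.
  have := ler_norm (phi xi); rewrite -(ger0_norm h0) in h.
  have h2 : `|phi xi| <= (`|K| + rdot xi xi) / 2.
    by rewrite -ler_sqr ?nnegrE// -normrX ger0_norm ?sqr_ge0// (le_trans h)// ger0_norm.
  by move=> h3; rewrite /J; lra.
pose A := range J.
have hA : has_inf A.
  split; first by exists (J 0), 0.
  by exists (- `|K|) => _ [xi _ <-].
have hm xi : inf A <= J xi by apply: ge_inf; [case: hA|exists xi].
have e0 n : 0 < 16^-1 ^+ n :> R by rewrite exprn_gt0// invr_gt0.
have /choice[u hu] : forall n, exists u, J u < inf A + 16^-1 ^+ n.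
  by move=> n; have [_ [u _ <-] hu] := inf_adherent (e0 n) hA; exists u.
have cauchy_u n m : (n <= m)%N -> rdot (u m - u n) (u m - u n) <= 4 * 16^-1 ^+ n.
  move=> nm.
  (* Parallelogram law: |u m - u n|^2 = 2 J(u m) + 2 J(u n) - 4 J(midpoint), where the terms in phi
     cancel. Since [J] is at least its infimum at the midpoint, this is at most 4 16^-n, the rate
     that [L2_complete] asks for. *)
  have mid := hm ((2^-1)%:C%C *: (u m + u n)).
  have := hu n; have := hu m; move: mid; rewrite /J.
  rewrite rdotZl rdotZr phiZ !phiD rdotBl !rdotBr !rdotDl !rdotDr (rdotC (u n) (u m)).
  have : 16^-1 ^+ m <= 16^-1 ^+ n :> R.
    by apply: ler_wiXn2l => //; rewrite invf_le1// ler1n.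
  set p := rdot (u m) (u m); set q := rdot (u n) (u n); set r := rdot _ _.
  by lra.
have [w hw] := L2_complete cauchy_u.
exists w => xi; apply/eqP; rewrite -subr_eq0 -sqrf_eq0; apply/eqP/le_anti.
rewrite sqr_ge0 andbT; apply/ler_addgt0Pl => e e_gt0; rewrite addr0.
have N0 := rdot_ge0 xi.
pose N := rdot xi xi + 1.
have N1 : 0 < N by rewrite /N ltr_wpDl.
(* For all s, J(u n + s xi) - inf J is nonnegative and at most a quadratic in s with constant term
   16^-n; its discriminant bounds the defect of [u n] as a representing vector. *)
have near_u n : (rdot xi (u n) - phi xi) ^+ 2 <= 16^-1 ^+ n * rdot xi xi.
  rewrite mulrC; apply: quadratic_ge0_discr => // s.
  have := hm (u n + s%:C%C *: xi); have := hu n; rewrite /J.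
  rewrite phiD phiZ rdotDl !rdotDr !rdotZl !rdotZr (rdotC (u n) xi).
  by rewrite expr2; set d := 16^-1 ^+ n; lra.
have near_w n : (rdot xi (w - u n)) ^+ 2 <= rdot xi xi * (4 * 16^-1 ^+ n).
  by apply: le_trans (rdot_CauchySchwarz _ _) _; rewrite ler_wpM2l.
(* The constant 10 is 2 * 4 from [near_w] plus 2 * 1 from [near_u]. *)
have [n hn] : exists n, 10 * 16^-1 ^+ n * N < e.
  have : (fun n => geometric 1 16^-1 n : R) @ \oo --> (0 : R).
    by apply: cvg_geometric; rewrite ger0_norm// invf_lt1// ltr1n.
  have e10 : 0 < e / (10 * N) by rewrite divr_gt0// mulr_gt0.
  move=> /cvgrPdist_lt/(_ _ e10)[n _ /(_ n (leqnn n))] /=.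
  rewrite mul1r sub0r normrN ger0_norm; last exact: ltW.
  by rewrite ltr_pdivlMr ?mulr_gt0// => h; exists n; rewrite mulrAC mulrC.
apply: le_trans (ltW hn).
have := near_u n; have := near_w n; rewrite rdotBr.
have := e0 n; set d := 16^-1 ^+ n; set p := rdot xi w; set q := rdot xi (u n).
move=> d0 h1 h2.
have : (phi xi - p) ^+ 2 <= 2 * (p - q) ^+ 2 + 2 * (q - phi xi) ^+ 2.
  rewrite -subr_ge0.
  have -> : 2 * (p - q) ^+ 2 + 2 * (q - phi xi) ^+ 2 - (phi xi - p) ^+ 2 =
    (p - q - (q - phi xi)) ^+ 2 by ring.
  exact: sqr_ge0.
move=> h3; apply: le_trans h3 _; rewrite /N; nra.
Qed.

Lemma adjoint_exists a : bounded_ops a ->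
  exists2 b, bounded_ops b & forall xi eta, rdot (a xi) eta = rdot xi (b eta).
Proof.
move=> ba; have [C C0 aC] := bounded_ops_bound ba; have [la _] := ba.
have /choice[b hb] : forall eta, exists u, forall xi, rdot (a xi) eta = rdot xi u.
  move=> eta; apply: (@Riesz_rdot (fun xi => rdot (a xi) eta) (C * rdot eta eta)).
  - by move=> xi zeta; rewrite L2_linD// rdotDl.
  - by move=> r xi; rewrite L2_linZ// rdotZl.
  - move=> xi; apply: le_trans (rdot_CauchySchwarz _ _) _.
    by rewrite mulrAC ler_wpM2r// rdot_ge0.
have uniq u v : (forall xi, rdot xi u = rdot xi v) -> u = v.
  move=> h; apply/eqP; rewrite -subr_eq0; apply/eqP/rdot_eq0.
  by rewrite rdotBr !h subrr.
have lb : linear b.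
  move=> c eta zeta; apply: uniq => xi.
  (* Uniqueness of the representing vector gives complex linearity: the scalar crosses the real form
     as its conjugate, and the linearity of [a] moves it out. *)
  rewrite -hb !rdotDr -hb; congr +%R.
  have -> : c = (c^*)^*%C by rewrite conjcK.
  by rewrite -!rdot_conj -L2_linZ// hb.
exists b => //; apply: (@bounded_ops_rdot b lb C) => // eta.
(* Duality turns <a (b eta), eta> into p = |b eta|^2, so Cauchy-Schwarz reads p^2 <= C p q, and p
   can be cancelled. *)
have := rdot_CauchySchwarz (a (b eta)) eta; rewrite hb.
have := aC (b eta); have := rdot_ge0 (b eta); have := rdot_ge0 eta.
set p := rdot (b eta) (b eta); set q := rdot eta eta; set r := rdot _ _.
move=> q0 p0 rC h.
have [->|pn0] := eqVneq p 0; first by rewrite mulr_ge0.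
have pp : 0 < p by rewrite lt_neqAle eq_sym pn0.
rewrite -(ler_pM2l pp) -expr2; apply: le_trans h _.
by rewrite mulrA [p * C]mulrC ler_wpM2r.
Qed.

Lemma rdot_duality_L2_inner a b : linear b ->
  (forall xi eta, rdot (a xi) eta = rdot xi (b eta)) ->
  forall xi eta, L2_inner (a xi) eta = L2_inner xi (b eta).
Proof. by move=> lb h xi eta; rewrite !L2_innerE !h L2_linZ. Qed.

(** Pins down the choice made in [adjoint]: real duality of a linear map upgrades to complex
    duality, and nondegeneracy of the real form leaves at most one dual map. *)
Lemma adjoint_uniq a b : bounded_ops b ->
  (forall xi eta, rdot (a xi) eta = rdot xi (b eta)) -> adjoint a = b.
Proof.
move=> bb hb; rewrite /adjoint; case: xgetP => [c _ [bc hc]|]; last first.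
  by move=> /(_ b) []; split => //; apply: rdot_duality_L2_inner => //; case: bb.
apply/funext => eta; apply/eqP; rewrite -subr_eq0; apply/eqP/rdot_eq0.
have h xi : rdot xi (c eta) = rdot xi (b eta).
  by rewrite -hb; have := hc xi eta; rewrite !L2_innerE => -[].
by rewrite rdotBr !h subrr.
Qed.

Lemma adjoint_spec a : bounded_ops a -> bounded_ops (adjoint a) /\
  forall xi eta, rdot (a xi) eta = rdot xi (adjoint a eta).
Proof.
by move=> /adjoint_exists[b bb hb]; rewrite (adjoint_uniq bb hb).
Qed.

Lemma adjointK a : bounded_ops a -> adjoint (adjoint a) = a.
Proof.
move=> ba; have [bb hb] := adjoint_spec ba.
by apply: adjoint_uniq => // xi eta; rewrite rdotC -hb rdotC.
Qed.

End Adjoint.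

(** * Supports of vectors *)

Section Supports.
Variable R : realType.
Local Notation mu := (@lebesgue_measure R).
Local Notation Re := (@complex.Re R).
Local Notation Im := (@complex.Im R).
Implicit Types (xi eta zeta : L2 R) (a b : L2 R -> L2 R) (S T W : set R).

Lemma le_mu (A B : set R) : measurable A -> measurable B -> A `<=` B ->
  (mu A <= mu B)%E.
Proof. by move=> mA mB AB; apply: le_measure; rewrite ?inE. Qed.

Definition restr S xi : L2 R := toL2 (fun x => if x \in S then xi x else 0).

Lemma measurable_mem S : measurable S -> measurable_fun [set: R] (fun x => x \in S).
Proof.
by move=> mS; apply: (measurable_fun_bool true); rewrite setTI preimage_mem_true.
Qed.

Lemma restr_sq_integrable S xi : measurable S ->
  (fun x => if x \in S then xi x else 0) \in @sq_integrable R.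
Proof.
move=> mS.
have mr : measurable_fun setT (Re \o (fun x => if x \in S then xi x else 0)).
  rewrite (_ : _ \o _ = fun x => if x \in S then Re (xi x) else 0).
    apply: measurable_fun_ifT => //; first exact: measurable_mem.
    exact: measurable_Re_L2.
  by apply/funext => x /=; case: ifP.
have mi : measurable_fun setT (Im \o (fun x => if x \in S then xi x else 0)).
  rewrite (_ : _ \o _ = fun x => if x \in S then Im (xi x) else 0).
    apply: measurable_fun_ifT => //; first exact: measurable_mem.
    exact: measurable_Im_L2.
  by apply/funext => x /=; case: ifP.
apply/sq_integrable_abs2; split => //.
apply: le_lt_trans (abs2_L2_lty xi); apply: ge0_le_integral => //.
- by move=> x _; rewrite lee_fin abs2_ge0.
- exact: measurable_abs2.
- exact: measurable_abs2_L2.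
- move=> x _; rewrite lee_fin; case: ifP => // _.
  by rewrite (_ : abs2 0 = 0) ?abs2_ge0//; apply/eqP; rewrite abs2_eq0.
Qed.

Lemma restrE S xi : measurable S ->
  ae (fun x => restr S xi x = if x \in S then xi x else 0).
Proof. by move=> mS; apply: toL2E; exact: restr_sq_integrable. Qed.

Lemma rdot_ae0 xi eta : ae (fun x => rdotf xi eta x = 0) -> rdot xi eta = 0.
Proof.
move=> h; rewrite (@rdot_ae _ _ _ (cst 0))//.
by rewrite Rintegral_cst// mul0r.
Qed.

Lemma rdot_ae_eq xi eta xi' eta' :
  ae (fun x => rdotf xi eta x = rdotf xi' eta' x) -> rdot xi eta = rdot xi' eta'.
Proof. by move=> h; apply: rdot_ae => //; exact: measurable_rdotf. Qed.

Lemma restr_split S xi : measurable S -> xi = restr S xi + restr (~` S) xi.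
Proof.
move=> mS; apply: L2_aeP.
have mC := measurableC mS.
have h : ae (fun x => xi x = restr S xi x + restr (~` S) xi x).
  apply: ae_filter2 (restrE xi mS) (restrE xi mC) => x -> ->.
  rewrite in_setC; case: ifP => _; first by rewrite addr0.
  by rewrite add0r.
by apply: ae_filter2 h (L2_addE (restr S xi) (restr (~` S) xi)) => x -> ->.
Qed.

Lemma rdot_restr_id S xi : measurable S ->
  rdot (restr S xi) (restr S xi) = rdot (restr S xi) xi.
Proof.
move=> mS; apply: rdot_ae_eq.
apply: ae_filter1 (restrE xi mS) => x; rewrite /rdotf => ->.
by case: ifP => // _; rewrite !(mulr0, mul0r).
Qed.

Lemma rdot_restrE S xi : measurable S ->
  (rdot (restr S xi) (restr S xi))%:E = (\int[mu]_(x in S) (abs2 (xi x))%:E)%E.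
Proof.
move=> mS; rewrite rdotxxE [RHS]integral_mkcond; apply: ae_eq_integral => //.
- exact: measurable_abs2_L2.
- by apply/(measurable_restrictT _ mS); apply: measurable_funTS; exact: measurable_abs2_L2.
- apply: ae_filter1 (restrE xi mS) => x /= -> _; rewrite patchE.
  by case: ifP => // _; rewrite /abs2 expr0n/= addr0.
Qed.

Lemma rdot_restr_sum S xi : measurable S ->
  rdot xi xi = rdot (restr S xi) (restr S xi) + rdot (restr (~` S) xi) (restr (~` S) xi).
Proof.
move=> mS; rewrite !rdot_restr_id//; last exact: measurableC.
by rewrite -rdotDl -restr_split.
Qed.

Lemma rdot_restr_le S xi : measurable S -> rdot (restr S xi) (restr S xi) <= rdot xi xi.
Proof. by move=> mS; rewrite (rdot_restr_sum xi mS) lerDl rdot_ge0. Qed.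

Lemma le_mu_supp xi S : measurable S -> ae (fun x => xi x != 0 -> S x) ->
  (mu (supp xi) <= mu S)%E.
Proof. by move=> mS h; apply: le_mu_ae => //; exact: measurable_supp. Qed.

Lemma supp_restr S xi : measurable S ->
  (mu (supp (restr S xi)) <= mu (supp xi `&` S))%E.
Proof.
move=> mS; apply: le_mu_supp; first by apply: measurableI => //; exact: measurable_supp.
apply: ae_filter1 (restrE xi mS) => x ->; case: ifP => [/set_mem Sx x0|_]; last by rewrite eqxx.
by split.
Qed.

Lemma mu_supp0 : mu (supp (0 : L2 R)) = 0%E.
Proof.
apply/eqP; rewrite eq_le measure_ge0 andbT -(measure0 mu); apply: le_mu_supp => //.
by apply: ae_filter1 (L2_zeroE R) => x ->; rewrite eqxx.
Qed.

Lemma mu_supp_eq0 xi : mu (supp xi) = 0%E -> xi = 0.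
Proof.
move=> h; apply: L2_aeP.
have : ae (fun x => ~ supp xi x).
  exists (supp xi); split => //; first exact: measurable_supp.
  by move=> x /= /contrapT.
move=> h'; apply: ae_filter2 h' (L2_zeroE R) => x; rewrite /supp /= => hx ->.
by apply/eqP/negP => /negP.
Qed.

Lemma mu_suppD xi eta : (mu (supp (xi + eta)%R) <= mu (supp xi) + mu (supp eta))%E.
Proof.
have mU : measurable (supp xi `|` supp eta).
  by apply: measurableU; exact: measurable_supp.
apply: (@le_trans _ _ (mu (supp xi `|` supp eta))); last first.
  by apply: measureU2; exact: measurable_supp.
apply: le_mu_supp => //.
apply: ae_filter1 (L2_addE xi eta) => x -> h.
have [x0|x0] := eqVneq (xi x) 0; [right|by left].
by apply: contra_neq h => e0; rewrite x0 e0 addr0.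
Qed.

(** Localizes the adjoint without computing it: the part [xi] of [adjoint a eta] outside [W]
    satisfies |xi|^2 = <a xi, eta>, which is zero by hypothesis. *)
Lemma adjoint_supp a eta W : bounded_ops a -> measurable W ->
  (forall xi, ae (fun x => W x -> xi x = 0) -> rdot (a xi) eta = 0) ->
  ae (fun x => adjoint a eta x != 0 -> W x).
Proof.
move=> ba mW h; have [bb hb] := adjoint_spec ba; have mC := measurableC mW.
pose xi := restr (~` W) (adjoint a eta).
have xi0 : xi = 0.
  apply: rdot_eq0; rewrite rdot_restr_id// -hb; apply: h.
  by apply: ae_filter1 (restrE (adjoint a eta) mC) => x -> Wx; rewrite in_setC mem_set.
have := restrE (adjoint a eta) mC; rewrite -/xi xi0 => h1.
apply: ae_filter2 h1 (L2_zeroE R) => x -> h2 hx; apply: contrapT => nW.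
by move: h2; rewrite mem_set// => /eqP; rewrite (negbTE hx).
Qed.

(* Intermediate value theorem for [r |-> mu (S `&` `]-oo, r])], which is
   1-Lipschitz. *)
Lemma exists_subset_measure S (t : R) : measurable S -> 0 <= t -> (t%:E <= mu S)%E ->
  exists S', [/\ S' `<=` S, measurable S' & mu S' = t%:E].
Proof.
move=> mS t0; rewrite le_eqVlt => /predU1P[->|tS]; first by exists S; split => // x.
(* [S] may have infinite measure; a bounded truncation of measure above [t] makes [g] below finite
   and continuous. *)
pose F n := S `&` `[- n%:R, n%:R]%classic.
have mF n : measurable (F n) by exact: measurableI.
have UF : \bigcup_n F n = S.
  apply/seteqP; split => [x [n _ []//]|x Sx].
  exists (Num.truncn `|x|).+1 => //; split => //=.
  by rewrite in_itv/= -ler_norml ltW// truncnS_gt.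
have ndF : nondecreasing_seq F.
  move=> n m nm; apply/subsetPset => x [Sx]; rewrite /= in_itv/= -ler_norml => h.
  by split => //=; rewrite in_itv/= -ler_norml (le_trans h)// ler_nat.
have [n tn] : exists n, (t%:E < mu (F n))%E.
  apply: contrapT => h.
  have : (mu S <= t%:E)%E; last by rewrite leNgt tS.
  have cF := nondecreasing_cvg_mu (mu := mu) mF (bigcupT_measurable _ mF) ndF.
  rewrite -UF -(cvg_lim _ cF)//; apply: lime_le; first by apply/cvg_ex; eexists; exact: cF.
  by apply: nearW => n; rewrite leNgt; apply/negP => hn; apply: h; exists n.
have muF : (mu (F n) < +oo)%E.
  apply: (@le_lt_trans _ _ (mu `[- n%:R, n%:R]%classic)).
    by apply: le_mu => // x [].
  by rewrite lebesgue_measure_itv/=; case: ifP => _; rewrite ltry.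
pose I r := F n `&` `]-oo, r]%classic.
have mI r : measurable (I r) by exact: measurableI.
have Ifin r : mu (I r) \is a fin_num.
  rewrite ge0_fin_numE//; apply: le_lt_trans muF.
  by apply: le_mu => // x [].
pose g r := fine (mu (I r)).
have gE r : (g r)%:E = mu (I r) by rewrite /g fineK.
have g_lip r r' : r <= r' -> g r <= g r' <= g r + (r' - r).
  move=> rr'; rewrite -!lee_fin EFinD !gE; apply/andP; split.
    apply: le_mu => // x [Fx]; rewrite /= in_itv/= => xr.
    by split => //=; rewrite in_itv/= (le_trans xr).
  apply: (@le_trans _ _ (mu (I r `|` `]r, r']%classic))).
    apply: le_mu => //; first exact: measurableU.
    move=> x [Fx]; rewrite /= in_itv/= => xr'; have [xr|xr] := leP x r.
      by left; split => //=; rewrite in_itv.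
    by right => /=; rewrite in_itv/= xr.
  apply: (@le_trans _ _ (mu (I r) + mu `]r, r']%classic)%E).
    by apply: measureU2; [exact: mI|exact: measurable_itv].
  apply: leeD2l.
  rewrite lebesgue_measure_itv/= lte_fin; case: ifP => _; first by rewrite -EFinB.
  by rewrite lee_fin subr_ge0.
have g_cont : continuous g.
  move=> r; apply/cvgrPdist_le => e e0; near=> r'.
  have h : `|r - r'| <= e by near: r'; apply: cvgr_dist_le.
  apply: le_trans h.
  have [rr'|rr'] := leP r r'.
    have /andP[h1 h2] := g_lip _ _ rr'.
    by rewrite distrC ger0_norm ?subr_ge0// distrC ger0_norm ?subr_ge0//; lra.
  have /andP[h1 h2] := g_lip _ _ (ltW rr').
  by rewrite ger0_norm ?subr_ge0// ger0_norm ?subr_ge0 ?(ltW rr')//; lra.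
have nn : - n%:R <= n%:R :> R by rewrite (@le_trans _ _ 0)// oppr_le0.
(* Since [F n] lies in [-n, n], only the point -n remains. *)
have gl : g (- n%:R) <= 0.
  rewrite -lee_fin gE; apply: (@le_trans _ _ (mu [set - n%:R])).
    2: by rewrite lebesgue_measure_set1.
  apply: le_mu => // x [[_]]; rewrite /= !in_itv/= => /andP[h1 _] h2.
  by apply/le_anti/andP.
have gr : t <= g n%:R.
  rewrite -lee_fin gE; apply: le_trans (ltW tn) _.
  apply: le_mu => // x Fx; split => //.
  by case: Fx => _; rewrite /= !in_itv/= => /andP[].
have [] := @IVT R g (- n%:R) n%:R t nn.
- exact: continuous_subspaceT.
- by rewrite ge_min le_max (le_trans gl t0) gr orbT.
move=> r _ gt; exists (I r); split => //; last by rewrite -gE gt.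
by move=> x [[]].
Unshelve. all: by end_near. Qed.
End Supports.

(** * Support expansion of an operator *)

Section PhiBounds.
Variable R : realType.
Local Notation mu := (@lebesgue_measure R).
Local Notation Re := (@complex.Re R).
Local Notation Im := (@complex.Im R).
Implicit Types (xi eta zeta : L2 R) (a b : L2 R -> L2 R) (S T W : set R).

(* Junk value [- x] for [x < 0]. *)
Definition nn (x : \bar R) : {nonneg \bar R} := (`|x|)%:nng%E.

Lemma nnE x : (0 <= x)%E -> (nn x)%:num = x.
Proof. by move=> x0; rewrite /nn /= gee0_abs. Qed.

Lemma nnK (x : {nonneg \bar R}) : nn x%:num = x.
Proof. by apply: val_inj => /=; rewrite gee0_abs. Qed.

Lemma le_Phi a (x : {nonneg \bar R}) xi :
  (mu (supp xi) <= x%:num)%E -> (mu (supp (a xi)) <= Phi a x)%E.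
Proof. by move=> h; apply: ereal_sup_ubound; exists xi. Qed.

Lemma Phi_le a (x : {nonneg \bar R}) (y : \bar R) :
  (forall xi, (mu (supp xi) <= x%:num)%E -> (mu (supp (a xi)) <= y)%E) ->
  (Phi a x <= y)%E.
Proof. by move=> h; apply: ge_ereal_sup => _ [xi /= hx <-]; exact: h. Qed.

Lemma Phi_ge0 a x : (0 <= Phi a x)%E.
Proof.
apply: le_trans (measure_ge0 mu (supp (a 0))) _; apply: le_Phi.
by rewrite mu_supp0.
Qed.

Lemma Phi_incr a (x y : {nonneg \bar R}) :
  (x%:num <= y%:num)%E -> (Phi a x <= Phi a y)%E.
Proof. by move=> xy; apply: Phi_le => xi h; apply: le_Phi; exact: le_trans xy. Qed.

Lemma Phi0 a (x : {nonneg \bar R}) : a 0 = 0 -> x%:num = 0%E -> Phi a x = 0%E.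
Proof.
move=> a0 x0; apply/eqP; rewrite eq_le Phi_ge0 andbT; apply: Phi_le => xi.
rewrite x0 => h; have /mu_supp_eq0 -> : mu (supp xi) = 0%E.
  by apply/eqP; rewrite eq_le h measure_ge0.
by rewrite a0 mu_supp0.
Qed.

Lemma supp_restrC S xi : S `<=` supp xi -> measurable S ->
  (mu S < +oo)%E -> (mu (supp (restr (~` S) xi)) <= mu (supp xi) - mu S)%E.
Proof.
move=> Ss mS Soo; have ms := measurable_supp xi.
have mC := measurableC mS.
apply: le_trans (supp_restr xi mC) _.
rewrite -setDE [X in (_ <= X - _)%E](measureDI mu ms mS).
have -> : supp xi `&` S = S by apply/setIidPr.
by rewrite addeK// ge0_fin_numE.
Qed.

Lemma Phi_subadd_nat a (s : R) k xi : linear a -> 0 <= s ->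
  (mu (supp xi) <= (k.+1%:R * s)%:E)%E ->
  (mu (supp (a xi)) <= k.+1%:R%:E * Phi a (nn s%:E))%E.
Proof.
move=> la s0; have ns : (nn s%:E)%:num = s%:E by rewrite nnE.
elim: k xi => [|k IH] xi h.
  by rewrite mul1e; apply: le_Phi; rewrite ns -[s]mul1r.
have [hs|hs] := leP (mu (supp xi)) s%:E.
  apply: (@le_trans _ _ (Phi a (nn s%:E))); first by apply: le_Phi; rewrite ns.
  rewrite -[leLHS]mul1e; apply: lee_wpmul2r; first exact: Phi_ge0.
  by rewrite lee_fin ler1n.
(* Cutting off a piece of measure exactly [s] leaves a support of measure at most (k + 1) s, ready
   for the induction hypothesis. *)
have [S [Ss mS muS]] := exists_subset_measure (measurable_supp xi) s0 (ltW hs).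
rewrite (restr_split xi mS) L2_linD//.
apply: le_trans (mu_suppD _ _) _.
have -> : (k.+2%:R%:E * Phi a (nn s%:E) =
    Phi a (nn s%:E) + k.+1%:R%:E * Phi a (nn s%:E))%E.
  by rewrite -[k.+2]add1n natrD EFinD ge0_muleDl ?lee_fin// mul1e.
apply: leeD.
  apply: le_Phi; rewrite ns -muS; apply: le_trans (supp_restr xi mS) _.
  have mI : measurable (supp xi `&` S).
    by apply: measurableI => //; exact: measurable_supp.
  by apply: (le_mu mI mS); apply: subIsetr.
apply: IH; apply: le_trans (supp_restrC Ss mS _) _; first by rewrite muS ltry.
rewrite muS leeBlDr//; apply: le_trans h _.
by rewrite -EFinD lee_fin -[k.+2]addn1 natrD mulrDl mul1r.
Qed.

(** The support is cut into floor(t/s) + 1 pieces. The bound is affine in [t], which makes its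
    infimum over [s] concave. *)
Lemma Phi_affine_le a (s t : R) : linear a -> 0 < s -> 0 <= t ->
  (Phi a (nn t%:E) <= Phi a (nn s%:E) + (t / s)%:E * Phi a (nn s%:E))%E.
Proof.
move=> la s0 t0; apply: Phi_le => xi; rewrite nnE ?lee_fin// => h.
have ts : 0 <= t / s by rewrite divr_ge0// ltW.
pose k := Num.truncn (t / s).
apply: (@le_trans _ _ (k.+1%:R%:E * Phi a (nn s%:E))%E).
  apply: Phi_subadd_nat => //; first exact: ltW.
  by apply: le_trans h _; rewrite lee_fin -ler_pdivrMr// ltW// truncnS_gt.
rewrite -[X in (_ <= X + _)%E]mul1e -ge0_muleDl ?lee_fin//.
apply: lee_wpmul2r; first exact: Phi_ge0.
by rewrite -EFinD lee_fin -addn1 natrD addrC lerD2l truncn_le.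
Qed.

(** Chebyshev's inequality off [V]. *)
Lemma mul_mu_abs2_gt eta V (d : R) : 0 < d -> measurable V ->
  (d%:E * mu ([set x | (d < abs2 (eta x))%R] `\` V) <=
   (rdot (restr (~` V) eta) (restr (~` V) eta))%:E)%E.
Proof.
move=> d0 mV; have mC := measurableC mV.
rewrite rdot_restrE//.
have mA : measurable [set x | (d < abs2 (eta x))%R].
  rewrite (_ : mkset _ = (fun x => (abs2 (eta x))%:E) @^-1` `]d%:E, +oo[%classic).
    rewrite -[X in measurable X]setTI; apply: measurable_abs2_L2 => //.
    exact: emeasurable_itv.
  by apply/seteqP; split => x /=; rewrite in_itv/= andbT lte_fin.
rewrite -integral_cst; last exact: measurableD.
apply: (@le_trans _ _ (\int[mu]_(x in [set x | (d < abs2 (eta x))%R] `\` V) (abs2 (eta x))%:E)%E).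
  apply: ge0_le_integral => //.
  - exact: measurableD.
  - by move=> x _; rewrite lee_fin ltW.
  - by apply: measurable_funTS; exact: measurable_abs2_L2.
  - by move=> x [/ltW h _]; rewrite lee_fin.
apply: ge0_subset_integral => //.
- exact: measurableD.
- by apply: measurable_funTS; exact: measurable_abs2_L2.
- by move=> x _; rewrite lee_fin abs2_ge0.
Qed.

(** Off the support of [zeta], the vectors [eta] and [eta - zeta] coincide. *)
Lemma rdot_off_supp_le eta zeta :
  rdot (restr (~` supp zeta) eta) (restr (~` supp zeta) eta) <=
  rdot (eta - zeta) (eta - zeta).
Proof.
have mC := measurableC (measurable_supp zeta).
apply: le_trans (rdot_restr_le (eta - zeta) mC).
rewrite le_eqVlt; apply/orP; left; apply/eqP; apply: rdot_ae_eq.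
have h := restrE eta mC; have h' := restrE (eta - zeta) mC.
have h'' := L2_subE eta zeta.
have {}h' : ae (fun x => restr (~` supp zeta) (eta - zeta) x = 
   if x \in ~` supp zeta then eta x - zeta x else 0).
  by apply: ae_filter2 h' h'' => x -> ->.
apply: ae_filter2 h h' => x; rewrite /rdotf => -> ->.
case: ifPn => // /set_mem/= hx.
by have -> : zeta x = 0 by [apply/eqP/negP => /negP; exact: hx]; rewrite subr0.
Qed.

(** By Chebyshev, the support of a close [zeta] misses only a small part of the set where |eta|^2 >
    1/(n + 1), and these sets increase to the support of [eta]. *)
Lemma mu_supp_lsc eta (K : \bar R) :
  (forall e : R, 0 < e -> exists2 zeta, (mu (supp zeta) <= K)%E &
     rdot (eta - zeta) (eta - zeta) <= e) ->
  (mu (supp eta) <= K)%E.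
Proof.
move=> h.
pose A n := [set x | (n.+1%:R^-1 < abs2 (eta x))%R].
have mA n : measurable (A n).
  rewrite (_ : A n = (fun x => (abs2 (eta x))%:E) @^-1` `](n.+1%:R^-1)%:E, +oo[%classic).
    rewrite -[X in measurable X]setTI; apply: measurable_abs2_L2 => //.
    exact: emeasurable_itv.
  by apply/seteqP; split => x /=; rewrite in_itv/= andbT lte_fin.
have AK n : (mu (A n) <= K)%E.
  apply/lee_addgt0Pr => e e0.
  have n0 : 0 < n.+1%:R^-1 :> R by rewrite invr_gt0.
  have [zeta zK hz] := h (n.+1%:R^-1 * e) (mulr_gt0 n0 e0).
  have ms := measurable_supp zeta.
  rewrite (measureDI mu (mA n) ms) addeC; apply: leeD.
    apply: le_trans zK; apply: le_mu => //; exact: measurableI.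
  rewrite -(@lee_pmul2l _ (n.+1%:R^-1)%:E)//.
  apply: le_trans (mul_mu_abs2_gt _ _ _) _ => //.
  by rewrite -EFinM lee_fin (le_trans (rdot_off_supp_le _ _)).
have UA : \bigcup_n A n = supp eta.
  apply/seteqP; split => [x [n _]|x]; rewrite /A /supp /=.
    rewrite -abs2_eq0 => h0; rewrite gt_eqF// (lt_trans _ h0)// invr_gt0//.
  rewrite -abs2_eq0 => h0; have p0 : 0 < abs2 (eta x) by rewrite lt_neqAle eq_sym h0 abs2_ge0.
  exists (Num.truncn (abs2 (eta x))^-1) => //.
  by rewrite /= invf_plt ?posrE// truncnS_gt.
have ndA : nondecreasing_seq A.
  move=> n m nm; apply/subsetPset => x; rewrite /A /=; apply: le_lt_trans.
  by rewrite lef_pV2 ?posrE// ler_nat.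
have cA := nondecreasing_cvg_mu (mu := mu) mA (bigcupT_measurable _ mA) ndA.
rewrite -UA -(cvg_lim _ cA)//; apply: lime_le; first by apply/cvg_ex; eexists; exact: cA.
by apply: nearW.
Qed.

Lemma restr_itv_approx xi (e : R) : 0 < e -> exists n : nat,
  let zeta := restr `[- n%:R, n%:R]%classic xi in
  rdot (xi - zeta) (xi - zeta) <= e.
Proof.
move=> e0; pose F n : set R := `[- n%:R, n%:R]%classic.
have mF n : measurable (F n) by exact: measurable_itv.
have UF : \bigcup_n F n = setT.
  apply/seteqP; split => [x [n _ []//]|x Sx].
  exists (Num.truncn `|x|).+1 => //.
  by rewrite /F /= in_itv/= -ler_norml ltW// truncnS_gt.
have ndF : nondecreasing_seq F.
  move=> n m nm; apply/subsetPset => x; rewrite /F /= !in_itv/= -!ler_norml => h.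
  by rewrite (le_trans h)// ler_nat.
have diffE n : rdot (xi - restr (F n) xi) (xi - restr (F n) xi) =
    rdot xi xi - rdot (restr (F n) xi) (restr (F n) xi).
  rewrite rdotBl !rdotBr (rdotC xi (restr _ _)) -(rdot_restr_id xi (mF n)); ring.
have cI : (\int[mu]_(x in F i) (abs2 (xi x))%:E)%E @[i --> \oo] -->
    (\int[mu]_(x in \bigcup_i F i) (abs2 (xi x))%:E)%E.
  apply: ge0_nondecreasing_set_cvg_integral => //.
  - by move=> i; apply: measurable_funTS; exact: measurable_abs2_L2.
  - by move=> i x _; rewrite lee_fin abs2_ge0.
move: cI; rewrite UF -rdotxxE.
under eq_fun do rewrite -rdot_restrE//.
move=> /fine_cvgP[_ /cvgrPdist_le /(_ e e0)[n _ /(_ n (leqnn n))]] /=.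
move=> h; exists n; rewrite diffE; apply: le_trans h; exact: ler_norm.
Qed.

(** Truncations of [xi] to [-n, n] converge to [xi], hence so do their images, and the measure of
    the support is lower semicontinuous. This supplies the limit at +oo required in ICOD. *)
Lemma Phi_oo_le a (K : \bar R) : bounded_ops a ->
  (forall t : R, 0 <= t -> (Phi a (nn t%:E) <= K)%E) ->
  (Phi a (nn +oo%E) <= K)%E.
Proof.
move=> ba h; apply: Phi_le => xi _; have [la _] := ba.
have [C C0 hC] := bounded_ops_bound ba.
apply: mu_supp_lsc => e e0.
have eC : 0 < e / (C + 1) by rewrite divr_gt0// ltr_wpDl.
have [n /= hn] := restr_itv_approx xi eC.
set zeta := restr _ _ in hn; exists (a zeta).
  apply: le_trans (h (n%:R + n%:R) _); last by rewrite addr_ge0.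
  apply: le_Phi; rewrite nnE ?lee_fin ?addr_ge0//.
  apply: le_trans (supp_restr _ _) _; first exact: measurable_itv.
  apply: (@le_trans _ _ (mu `[- n%:R, n%:R]%classic)).
    apply: le_mu; [|exact: measurable_itv|by move=> x []].
    by apply: measurableI; [exact: measurable_supp|exact: measurable_itv].
  rewrite lebesgue_measure_itv/=; case: ifP => _; last by rewrite lee_fin addr_ge0.
  by rewrite -EFinB opprK.
rewrite -L2_linB//; apply: le_trans (hC _) _.
move: hn; rewrite ler_pdivlMr ?ltr_wpDl//; apply: le_trans.
by rewrite mulrC ler_wpM2l ?rdot_ge0// lerDl.
Qed.

End PhiBounds.

(** * Common supports of linear families of vectors *)

Section EssentialSupport.
Variable R : realType.
Local Notation mu := (@lebesgue_measure R).
Implicit Types (xi eta zeta u v : L2 R) (a b : L2 R -> L2 R) (S T W : set R).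

Lemma mu_small_term (E : nat -> set R) V (e : R) : (forall n, measurable (E n)) ->
  measurable V -> trivIset setT E -> (forall n, E n `<=` V) -> (mu V < +oo)%E ->
  0 < e -> exists n, (mu (E n) <= e%:E)%E.
Proof.
move=> mE mV tE EV Voo e0; apply: contrapT => h.
have en n : (e%:E <= mu (E n))%E.
  by rewrite ltW// ltNge; apply/negP => hn; apply: h; exists n.
have mUE : measurable (\bigcup_n E n) by exact: bigcupT_measurable.
have UV : (mu (\bigcup_n E n) <= mu V)%E by apply: le_mu => // x [n _ /EV].
have Vfin : mu V \is a fin_num by rewrite ge0_fin_numE.
have kV (k : nat) : (k%:R * e <= fine (mu V)).
  rewrite -lee_fin fineK//; apply: le_trans UV; rewrite measure_bigcup//.
  apply: le_trans (nneseries_lim_ge k _) => //=.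
  rewrite big_mkcond/=.
  apply: (@le_trans _ _ (\sum_(0 <= i < k) e%:E)%E).
    by rewrite sumEFin lee_fin big_const_nat subn0 iter_addr_0 mulr_natl.
  by apply: lee_sum => i _; rewrite mem_set.
  by move=> i _; exact: mE.
have := kV (Num.truncn (fine (mu V) / e)).+1.
by rewrite -ler_pdivlMr// leNgt truncnS_gt.
Qed.

(* The sets where [u + n v] vanishes but [v] does not are disjoint subsets of
   [supp v] for distinct [n], so some [u + n v] in [P] has a support that almost
   fills [supp u `|` supp v].  The set [T] is then the lower limit of the supports
   of a maximizing sequence. *)
Lemma essential_support (P : set (L2 R)) (M : R) : P !=set0 ->
  (forall u v (n : nat), P u -> P v -> P (u + n%:R *: v)) ->
  (forall u, P u -> (mu (supp u) <= M%:E)%E) ->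
  exists T, [/\ measurable T, (mu T <= M%:E)%E &
    forall v, P v -> ae (fun x => v x != 0 -> T x)].
Proof.
move=> [u0 Pu0] PD PM.
have ms := @measurable_supp R.
pose s := ereal_sup [set mu (supp u) | u in P].
have sM : (s <= M%:E)%E by apply: ge_ereal_sup => _ [u Pu <-]; exact: PM.
have s0 : (0 <= s)%E.
  by apply: le_trans (measure_ge0 mu (supp u0)) _; apply: ereal_sup_ubound; exists u0.
have sfin : s \is a fin_num by rewrite ge0_fin_numE// (le_lt_trans sM)// ltry.
have sub u : P u -> (mu (supp u) <= s)%E by move=> Pu; apply: ereal_sup_ubound; exists u.
have supU u v : P u -> P v -> (mu (supp u `|` supp v) <= s)%E.
  move=> Pu Pv; apply/lee_addgt0Pr => e e0.
  pose E n := [set x | v x != 0 /\ u x + n%:R * v x = 0].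
  pose w n : L2 R := u + n%:R *: v.
  have aew n : ae (fun x => w n x = u x + n%:R * v x).
    by apply: ae_filter2 (L2_addE u (n%:R *: v)) (L2_scaleE n%:R v) => x -> ->.
  have mE n : measurable (E n).
    rewrite (_ : E n = supp v `&` ~` [set x | u x + n%:R * v x != 0]).
      apply: measurableI => //; apply: measurableC; apply: measurable_neq0.
        rewrite (_ : _ \o _ = fun x => complex.Re (u x) + n%:R * complex.Re (v x)).
          apply: measurable_funD; first exact: measurable_Re_L2.
          by apply: measurable_funM => //; exact: measurable_Re_L2.
        apply/funext => x /=; case: (u x) (v x) => p q [p' q'].
        by rewrite Defs.ReD mulr_natl raddfMn/= mulr_natl.
      rewrite (_ : _ \o _ = fun x => complex.Im (u x) + n%:R * complex.Im (v x)).
        apply: measurable_funD; first exact: measurable_Im_L2.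
        by apply: measurable_funM => //; exact: measurable_Im_L2.
      apply/funext => x /=; case: (u x) (v x) => p q [p' q'].
      by rewrite Defs.ImD mulr_natl raddfMn/= mulr_natl.
    apply/seteqP; split => x /=.
      by move=> [vx ux]; split => //; rewrite ux eqxx.
    by move=> [vx /negP/negPn/eqP].
  have tE : trivIset setT E.
    apply/trivIsetP => n m _ _ nm; apply/seteqP; split => // x [[vx h1] [_ h2]].
    have : (n%:R - m%:R) * v x = 0 :> R[i].
      move/eqP: h1; rewrite addrC addr_eq0 => /eqP h1.
      move/eqP: h2; rewrite addrC addr_eq0 => /eqP h2.
      by rewrite mulrBl h1 h2 subrr.
    move/eqP; rewrite mulf_eq0 (negbTE vx) orbF subr_eq0 eqr_nat.
    by move=> /eqP nm'; rewrite nm' eqxx in nm.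
  have voo : (mu (supp v) < +oo)%E by apply: le_lt_trans (PM _ Pv) _; rewrite ltry.
  have [] := @mu_small_term E (supp v) e mE (ms v) tE _ voo e0; first by move=> n x [].
  move=> n hn.
  have Pw : P (w n) by exact: PD.
  apply: (@le_trans _ _ (mu (supp (w n) `|` E n))).
    apply: le_mu_ae; [exact: measurableU|exact: measurableU|].
    apply: ae_filter1 (aew n) => x hw; rewrite /supp /E /= hw.
    have [h0|h0] := eqVneq (u x + n%:R * v x) 0; last by move=> _; left.
    move=> h; right; split => //.
    have [v0|//] := eqVneq (v x) 0.
    case: h => [ux|]; last by rewrite v0 eqxx.
    by move: h0; rewrite v0 mulr0 addr0 => ux0; rewrite ux0 eqxx in ux.
  apply: (@le_trans _ _ (mu (supp (w n)) + mu (E n))%E).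
    by apply: measureU2; [exact: ms|exact: mE].
  by apply: leeD => //; exact: sub.
have e0 n : 0 < 2^-1 ^+ n :> R by rewrite exprn_gt0.
have /choice[u hu] : forall n, exists u, P u /\ (s <= mu (supp u) + (2^-1 ^+ n)%:E)%E.
  move=> n; have [_ [u Pu <-] h] := ub_ereal_sup_adherent (e0 n) sfin.
  by exists u; split => //; rewrite -leeBlDr// ltW.
pose G m := \bigcap_(n in [set n | (m <= n)%N]) supp (u n).
have mG m : measurable (G m).
  by apply: bigcap_measurable; [exists m => /=|move=> k _; exact: ms].
exists (\bigcup_m G m); split; first exact: bigcupT_measurable.
  have ndG : nondecreasing_seq G.
    by move=> n m nm; apply/subsetPset => x hx k /= mk; apply: hx => /=; exact: leq_trans mk.
  have cG := nondecreasing_cvg_mu (mu := mu) mG (bigcupT_measurable _ mG) ndG.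
  rewrite -(cvg_lim _ cG)//; apply: lime_le; first by apply/cvg_ex; eexists; exact: cG.
  apply: nearW => m /=; apply: le_trans (PM (u m) (hu m).1).
  by apply: le_mu => // x; apply => /=.
(* Since [supp (u n)] attains [s] up to 2^-n, [supU] bounds [F n] by 2^-n. By Borel-Cantelli, almost
   every point of [supp v] lies in [supp (u n)] for all large n. *)
move=> v Pv; pose F n := supp v `\` supp (u n).
have mF n : measurable (F n) by exact: measurableD.
have F2 n : (mu (F n) <= (1 * 2^-1 ^+ n)%:E)%E.
  have [Pun sun] := hu n; have ufin : mu (supp (u n)) \is a fin_num.
    by rewrite ge0_fin_numE// (le_lt_trans (PM _ Pun))// ltry.
  have := supU _ _ Pun Pv; rewrite mul1r.
  have -> : supp (u n) `|` supp v = supp (u n) `|` supp v `\` supp (u n).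
    apply/seteqP; split => x; last by move=> [h|[h _]]; [left|right].
    by move=> [h|h]; [left|have [?|?] := pselect (supp (u n) x); [left|right]].
  have -> : mu (supp (u n) `|` supp v `\` supp (u n)) = (mu (supp (u n)) + mu (F n))%E.
    apply: measureU; [exact: ms|exact: mF|].
    by apply/seteqP; split => x // [? []].
  move=> /le_trans/(_ sun); by rewrite leeD2lE.
have : mu (lim_sup_set F) = 0.
  apply: lim_sup_set_cvg0 => //.
  apply: (@le_lt_trans _ _ (\sum_(0 <= n <oo) (1 * 2^-1 ^+ n : R)%:E)%E).
    by apply: lee_nneseries => // n _; exact: F2.
  by apply: nneseries_geometric_lty => //; rewrite invf_lt1// ltr1n.
move=> h0; exists (lim_sup_set F); split => //.
  by apply: bigcapT_measurable => n; apply: bigcup_measurable => k _; exact: mF.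
move=> x /= /not_implyP[vx nG] n _.
apply: contrapT => nF; apply: nG; exists n => // k /= nk.
by apply: contrapT => hk; apply: nF; exists k.
Qed.

Lemma Phi_adjoint_le a (f : {nonneg \bar R} -> {nonneg \bar R}) (s : R) :
  increasing f -> B_fun f a -> 0 <= s -> ((f (f (nn s%:E)))%:num < s%:E)%E ->
  forall eta, (mu (supp (adjoint a eta)) <= s%:E)%E.
Proof.
move=> fI [ba Pa Pa'] s0 ffs eta; rewrite leNgt; apply/negP => hs.
have [bb hb] := adjoint_spec ba; have [la _] := ba; have [lb _] := bb.
have ns : (nn s%:E)%:num = s%:E by rewrite nnE.
have [S [Ss mS muS]] := exists_subset_measure (measurable_supp (adjoint a eta)) s0 (ltW hs).
(* Otherwise f(f(s)) >= f(s) >= s. In particular f(s) is finite, as [essential_support] requires. *)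
have fs : ((f (nn s%:E))%:num < s%:E)%E.
  rewrite ltNge; apply/negP => h; move: ffs; rewrite ltNge; move/negP; apply.
  by apply: (le_trans h); apply: fI; rewrite ns.
have fsfin : (f (nn s%:E))%:num \is a fin_num.
  by rewrite ge0_fin_numE// (lt_trans fs)// ltry.
(* The images of all vectors carried by [S] form a linear space, so a single set [T] carries them
   all. *)
pose P := a @` [set xi : L2 R | ae (fun x => ~ S x -> xi x = 0)].
have [] := @essential_support P (fine (f (nn s%:E))%:num).
- by exists (a 0), 0 => //=; apply: ae_filter1 (L2_zeroE R) => x -> _.
- move=> _ _ n [xi /= hxi <-] [zeta hzeta <-]; exists (xi + n%:R *: zeta).
    have h1 := L2_addE xi (n%:R *: zeta); have h2 := L2_scaleE n%:R zeta.
    have h3 : ae (fun x => L2_fun (xi + n%:R *: zeta) x = xi x + n%:R * zeta x).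
      by apply: ae_filter2 h1 h2 => x -> ->.
    have h4 : ae (fun x => ~ S x -> xi x + n%:R * zeta x = 0).
      apply: ae_filter2 hxi hzeta => x hx hz nS.
      by rewrite hx// hz// mulr0 addr0.
    by apply: ae_filter2 h3 h4 => x -> h nS; exact: h.
  by rewrite L2_linD// L2_linZ.
- move=> _ [xi /= hxi <-]; rewrite fineK//; apply: le_trans (Pa (nn s%:E)).
  apply: le_Phi; rewrite ns -muS; apply: le_mu_supp => //.
  by apply: ae_filter1 hxi => x h hx; apply: contrapT => /h h0; rewrite h0 eqxx in hx.
move=> T [mT muT hT]; have mC := measurableC mT.
pose eta1 := restr T eta; pose eta2 := restr (~` T) eta.
(* [eta2] lives off [T], hence is orthogonal to [a xi] whenever [xi] is carried by [S]. So on [S]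
   only [eta1] contributes to [adjoint a eta]. *)
have h2 : ae (fun x => adjoint a eta2 x != 0 -> (~` S) x).
  apply: adjoint_supp => //; first exact: measurableC.
  move=> xi hxi; apply: rdot_ae0.
  have h1 : ae (fun x => a xi x != 0 -> T x) by apply: hT; exists xi.
  apply: ae_filter2 h1 (restrE eta mC) => x hx.
  rewrite /rdotf /eta2 => ->; rewrite in_setC.
  have [xT|xT] := boolP (x \in T); first by rewrite !mulr0 addr0.
  suff -> : a xi x = 0 by rewrite !mul0r addr0.
  by apply/eqP/negP => /negP/hx; rewrite notin_setE in xT.
have : (s%:E <= mu (supp (adjoint a eta1)))%E.
  rewrite -muS; apply: le_mu_ae => //; first exact: measurable_supp.
  have -> : eta1 = eta - eta2 by rewrite /eta1 /eta2 {2}(restr_split eta mT) addrK.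
  rewrite L2_linB//.
  apply: ae_filter2 h2 (L2_subE (adjoint a eta) (adjoint a eta2)) => x h hx Sx.
  rewrite /supp /= hx.
  have -> : adjoint a eta2 x = 0 by apply/eqP/negP => /negP/h.
  by rewrite subr0; exact: Ss.
rewrite leNgt => /negP; apply; apply: le_lt_trans ffs.
apply: le_trans (Pa' (f (nn s%:E))); apply: le_Phi.
apply: le_trans (supp_restr eta mT) _.
apply: (@le_trans _ _ (mu T)); last by move: muT; rewrite fineK.
by apply: le_mu => //; apply: measurableI => //; exact: measurable_supp.
Qed.

Lemma B_fun_adjoint a f : B_fun f a -> B_fun f (@adjoint R a).
Proof.
move=> [ba Pa Pa']; have [bb hb] := adjoint_spec ba.
by split; [exact: bb|exact: Pa'|rewrite (adjointK ba); exact: Pa].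
Qed.

End EssentialSupport.

(** * Increasing concave functions *)

Section ConcaveFunctions.
Variable R : realType.
Local Notation fn := ({nonneg \bar R} -> {nonneg \bar R}).
Implicit Types (f g : fn) (h : \bar R -> \bar R).
Local Open Scope ereal_scope.

Lemma nonneg_num_ge0 (x : {nonneg \bar R}) : 0 <= x%:num.
Proof. by []. Qed.

(** The even extension of [f] to the extended line, so that arguments carry no proof of
    nonnegativity. *)
Definition fv f (x : \bar R) : \bar R := (f (nn x))%:num.

Lemma fvE f (x : {nonneg \bar R}) : fv f x%:num = (f x)%:num.
Proof. by rewrite /fv nnK. Qed.

Lemma fv_ge0 f x : 0 <= fv f x.
Proof. by rewrite /fv. Qed.

Lemma fv_comp f g x : fv (f \o g) x = fv f (fv g x).
Proof. by rewrite /fv /= nnK. Qed.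

Lemma fv_add f g x : fv (fn_add f g) x = fv f x + fv g x.
Proof. by []. Qed.

Definition fn_of h : fn := fun x => nn (h x%:num).

Lemma fv_fn_of h x : 0 <= x -> 0 <= h x -> fv (fn_of h) x = h x.
Proof. by move=> x0 hx0; rewrite /fv /fn_of nnE nnE. Qed.

Lemma incrP f : increasing f <-> (forall x y, 0 <= x -> x <= y -> fv f x <= fv f y).
Proof.
split=> [h x y x0 xy|h x y xy].
  by apply: h; rewrite !nnE// (le_trans x0).
by rewrite -!fvE; apply: h.
Qed.

Lemma concaveP f : concave_down f <->
  (forall (t : R) x y, (0 <= t <= 1)%R -> 0 <= x -> 0 <= y ->
    t%:E * fv f x + (1 - t)%:E * fv f y <= fv f (t%:E * x + (1 - t)%:E * y)).
Proof.
split=> [h t x y /andP[t0 t1] x0 y0|h t x y].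
  have := h (Itv01 t0 t1) (nn x) (nn y).
  move=> /le_trans; apply; rewrite /fv /= le_eqVlt; apply/orP; left; apply/eqP.
  congr ((f _)%:num); apply: val_inj => /=; rewrite !gee0_abs//.
  by rewrite adde_ge0// mule_ge0// lee_fin// subr_ge0.
have t01 : (0 <= t%:num <= 1)%R by apply/andP; split.
have := h t%:num x%:num y%:num t01 (nonneg_num_ge0 x) (nonneg_num_ge0 y).
rewrite !fvE => /le_trans; apply.
rewrite -fvE /=; exact: lexx.
Qed.

Lemma at_realE f (t : R) : (0 <= t)%R -> at_real f t = fv f t%:E.
Proof.
move=> t0; rewrite /at_real /fv; congr ((f _)%:num); apply: val_inj => /=.
by rewrite !ger0_norm// ?gee0_abs// lee_fin.
Qed.

Lemma cvg_pinftyP f : increasing f ->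
  at_real f t @[t --> +oo%R] --> (f +oo%:nng)%:num <->
  (forall y, y < fv f +oo -> exists2 t : R, (0 <= t)%R & y < fv f t%:E).
Proof.
(* [at_real f] is even in t, hence not monotone on the line; the truncation [g] is monotone and
   agrees with it near +oo. *)
move=> /incrP fI; pose g (t : R) := fv f (Num.max 0%R t)%:E.
have gI : {homo g : x y / (x <= y)%R >-> x <= y}.
  move=> x y xy; apply: fI; first by rewrite lee_fin le_max lexx.
  by rewrite lee_fin ge_max !le_max lexx xy orbT.
have cg := nondecreasing_cvge gI.
have gf : {near +oo%R, g =1 at_real f}.
  near=> t; have t0 : (0 <= t)%R by near: t; apply: nbhs_pinfty_ge; rewrite num_real.
  by rewrite /g at_realE// (max_idPr t0).
have fg : {near +oo%R, at_real f =1 g}.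
  near=> t; have t0 : (0 <= t)%R by near: t; apply: nbhs_pinfty_ge; rewrite num_real.
  by rewrite /g at_realE// (max_idPr t0).
have fE : (f +oo%:nng)%:num = fv f +oo.
  by rewrite /fv; congr ((f _)%:num); apply: val_inj.
have gl t : g t <= fv f +oo by apply: fI; rewrite ?leey// lee_fin le_max lexx.
rewrite fE; split=> [cf y yf|h].
  have cf' : g x @[x --> +oo%R] --> fv f +oo by exact: cvg_trans (near_eq_cvg fg) cf.
  have e : ereal_sup (range g) = fv f +oo by rewrite -(cvg_lim _ cg)// -(cvg_lim _ cf').
  move: yf; rewrite -e => /ereal_sup_gt[_ [t _ <-] yg].
  by exists (Num.max 0%R t) => //; rewrite le_max lexx.
suff -> : fv f +oo = ereal_sup (range g) by exact: cvg_trans (near_eq_cvg gf) cg.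
apply/eqP; rewrite eq_le; apply/andP; split; last first.
  by apply: ge_ereal_sup => _ [t _ <-].
rewrite leNgt; apply/negP => /h[t t0]; rewrite ltNge => /negP; apply.
apply: ereal_sup_ubound; exists t => //.
by rewrite /g (max_idPr t0).
Unshelve. all: by end_near. Qed.


Lemma cvg_at0P f : increasing f ->
  at_real f t @[t --> 0%R^'+] --> 0 <->
  (forall e : R, (0 < e)%R -> exists2 t : R, (0 < t)%R & fv f t%:E <= e%:E).
Proof.
move=> /incrP fI; split=> [h e e0|h].
  have : \forall t \near 0%R^'+, at_real f t < e%:E.
    by apply: (h [set u | u < e%:E]); apply: open_ereal_lt'; rewrite lte_fin.
  move=> he.
  have : \forall t \near 0%R^'+, (0 < t)%R /\ at_real f t < e%:E.
    near=> t; split; first by near: t; exact: nbhs_right_gt.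
    by near: t.
  move=> /filter_ex[t [t0 ht]]; exists t => //.
  by rewrite -at_realE ?(ltW t0)// ltW.
have bd (e : R) : (0 < e)%R -> \forall t \near 0%R^'+, at_real f t <= e%:E.
  move=> e0; have [t0 t0p ht] := h e e0; near=> t.
  have tp : (0 < t)%R by near: t; exact: nbhs_right_gt.
  have tt : (t <= t0)%R by near: t; apply: nbhs_right_le.
  rewrite at_realE ?(ltW tp)//; apply: le_trans ht.
  by apply: fI; rewrite lee_fin ?ltW.
have a0 t : 0 <= at_real f t by rewrite /at_real.
apply/fine_cvgP; split.
  have := bd 1%R ltr01; apply: filterS => t ht.
  by rewrite ge0_fin_numE// (le_lt_trans ht)// ltry.
apply/cvgrPdist_le => e e0; have := bd e e0; apply: filterS => t ht.
rewrite sub0r normrN /= ger0_norm ?fine_ge0//.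
rewrite -lee_fin fineK//.
by rewrite ge0_fin_numE// (le_lt_trans ht)// ltry.
Unshelve. all: by end_near. Qed.

(** A form of the conditions of ICOD free of filters and subtypes. For an increasing function the
    last clause is continuity at +oo. *)
Definition icod h :=
  [/\ (forall x y, 0 <= x -> x <= y -> h x <= h y),
      (forall (t : R) x y, (0 <= t <= 1)%R -> 0 <= x -> 0 <= y ->
         t%:E * h x + (1 - t)%:E * h y <= h (t%:E * x + (1 - t)%:E * y)),
      h 0 = 0 &
      (forall y, y < h +oo -> exists2 t : R, (0 <= t)%R & y < h t%:E)].

Lemma fv0E f : (f 0%:E%:nng)%:num = fv f 0.
Proof. by rewrite /fv; congr ((f _)%:num); apply: val_inj; rewrite /= normr0. Qed.

Lemma ICODP f : ICOD f <-> icod (fv f).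
Proof.
have f0 := fv0E f.
split=> [[fI /concaveP fc ff fl]|[/incrP fI /concaveP fc ff fl]].
  by split; [exact/incrP|exact: fc|rewrite -f0|exact/cvg_pinftyP].
by split=> //; [rewrite f0|exact/cvg_pinftyP].
Qed.

Lemma icod_ge0 h x : icod h -> 0 <= x -> 0 <= h x.
Proof. by move=> [hI _ h0 _] x0; rewrite -h0; exact: hI. Qed.

Lemma ICOD_fn_of h : icod h -> ICOD (fn_of h).
Proof.
move=> hh; have [hI hc h0 hl] := hh; apply/ICODP.
have E x : 0 <= x -> fv (fn_of h) x = h x.
  by move=> x0; rewrite fv_fn_of//; exact: icod_ge0.
split.
- by move=> x y x0 xy; rewrite !E//; [exact: hI|exact: le_trans xy].
- move=> t x y t01 x0 y0; rewrite !E//; first exact: hc.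
  by case/andP: t01 => t0 t1; rewrite adde_ge0// mule_ge0// lee_fin// subr_ge0.
- by rewrite E.
- by rewrite E// => y /hl[t t0 ht]; exists t => //; rewrite E.
Qed.

Lemma icod_scale h (t : R) x : icod h -> (0 <= t <= 1)%R -> 0 <= x ->
  t%:E * h x <= h (t%:E * x).
Proof.
move=> [_ hc h0 _] t01 x0; have := hc t x 0 t01 x0 (lexx _).
by rewrite h0 !mule0 !adde0.
Qed.

(** Left continuity on (0, oo]: at a finite point, concavity and h(0) = 0 give h(lam x) >= lam h(x),
    with lam close to 1; at +oo it is the last clause of [icod]. *)
Lemma icod_left_lim h (x y : \bar R) : icod h -> 0 < x -> y < h x ->
  exists2 z : R, (0 <= z)%R /\ z%:E < x & y < h z%:E.
Proof.
move=> hh x0 yx; have [hI hc h0 hl] := hh.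
case: x x0 yx => [x|_ /hl[t t0 ht]|//]; last first.
  by exists t => //; split => //; rewrite ltry.
rewrite lte_fin => x0 yx.
have [lam l01 hlam] : exists2 lam : R, (0 <= lam < 1)%R & y < lam%:E * h x%:E.
  have hx0 : 0 <= h x%:E by apply: icod_ge0; rewrite ?lee_fin// ltW.
  case: (h x%:E) hx0 yx => [r r0 yr|_ yoo|//]; last first.
    exists 2^-1%R; first by rewrite invr_ge0 ler0n/= invf_lt1// ltr1n.
    by rewrite gt0_muley// lte_fin.
  case: y yr => [y yr|//|_]; last by exists 0%R; rewrite ?lexx//= -EFinM ltNyr.
  move: yr r0; rewrite lte_fin lee_fin => yr r0.
  have [y0|y0] := ltP y 0%R; first by exists 0%R; rewrite ?lexx//= -EFinM mul0r lte_fin.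
  have rp : (0 < r)%R by exact: le_lt_trans yr.
  (* Chosen so that lam r is the midpoint of y and r. *)
  exists ((y + r) / (2 * r))%R.
    rewrite divr_ge0/= ?addr_ge0// ?mulr_ge0// ltr_pdivrMr ?mulr_gt0// mul1r; lra.
  rewrite -EFinM lte_fin.
  have -> : ((y + r) / (2 * r) * r = (y + r) / 2)%R by field; rewrite gt_eqF.
  by rewrite ltr_pdivlMr//; lra.
case/andP: l01 => l0 l1; exists (lam * x)%R.
  split; first by rewrite mulr_ge0// ltW.
  by rewrite lte_fin gtr_pMl.
apply: lt_le_trans hlam _; rewrite EFinM; apply: icod_scale => //.
- by rewrite l0 ltW.
- by rewrite lee_fin ltW.
Qed.

Lemma ICOD_add f g : ICOD f -> ICOD g -> ICOD (fn_add f g).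
Proof.
move=> If Ig; have [I1 /concaveP c1 z1 l1] := If; have [I2 /concaveP c2 z2 l2] := Ig.
split.
- by move=> x y xy /=; apply: leeD; [exact: I1|exact: I2].
- apply/concaveP => t x y t01 x0 y0; rewrite !fv_add.
  have /andP[t0 t1] := t01; have u0 : 0 <= (1 - t)%:E by rewrite lee_fin subr_ge0.
  rewrite !ge0_muleDr ?fv_ge0// addeACA.
  by apply: leeD; [exact: c1|exact: c2].
- by rewrite fv0E fv_add -!fv0E z1 z2 adde0.
- apply: cvgeD => //.
  by apply: ge0_adde_def; rewrite inE.
Qed.

(** The delicate point is the limit at +oo: g(+oo) may be finite, and there the left continuity of
    [f] is needed. *)
Lemma ICOD_comp f g : ICOD f -> ICOD g -> ICOD (f \o g).
Proof.
move=> /ICODP If /ICODP Ig; apply/ICODP.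
have [I1 c1 z1 l1] := If; have [I2 c2 z2 l2] := Ig.
split.
- by move=> x y x0 xy; rewrite !(fv_comp f g); apply: I1; [exact: fv_ge0|exact: I2].
- move=> t x y t01 x0 y0; rewrite !(fv_comp f g).
  apply: le_trans (c1 t _ _ t01 (fv_ge0 _ _) (fv_ge0 _ _)) _.
  have /andP[t0 t1] := t01; have u0 : 0 <= (1 - t)%:E by rewrite lee_fin subr_ge0.
  apply: I1; last exact: c2.
  by rewrite adde_ge0// mule_ge0// ?lee_fin// fv_ge0.
- by rewrite (fv_comp f g) z2 z1.
- move=> y; rewrite (fv_comp f g) => hy.
  have [g0|g0] := eqVneq (fv g +oo) 0.
    by exists 0%R => //; rewrite (fv_comp f g) z2 -g0.
  have gp : 0 < fv g +oo by rewrite lt_neqAle eq_sym g0 fv_ge0.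
  have [z [z0 zg] yz] := icod_left_lim If gp hy.
  have [t t0 zt] := l2 _ zg; exists t => //; rewrite (fv_comp f g).
  by apply: (lt_le_trans yz); apply: I1; [rewrite lee_fin|exact: ltW].
Qed.

Lemma ICOD_incr f : ICOD f -> increasing f.
Proof. by case. Qed.

Lemma ICOD_incr_fv f x y : ICOD f -> 0 <= x -> x <= y -> fv f x <= fv f y.
Proof. by move=> /ICODP[h _ _ _]; exact: h. Qed.

Lemma ICOD_fv0 f : ICOD f -> fv f 0 = 0.
Proof. by move=> /ICODP[]. Qed.

Lemma ICOD_scale f (t : R) x : ICOD f -> (0 <= t <= 1)%R -> 0 <= x ->
  t%:E * fv f x <= fv f (t%:E * x).
Proof. by move=> /ICODP h; exact: icod_scale. Qed.

Lemma ICOD0P f : ICOD0 f <-> ICOD f /\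
  (forall e : R, (0 < e)%R -> exists2 t : R, (0 < t)%R & fv f t%:E <= e%:E).
Proof. by split=> -[If h]; split=> //; apply/(cvg_at0P (ICOD_incr If)). Qed.

Lemma ICODbddP f : ICODbdd f <-> ICOD f /\ exists M : R, fv f +oo <= M%:E.
Proof.
split=> -[If [M hM]]; split=> //; exists M; first exact: hM.
by move=> x; rewrite -fvE; apply: le_trans hM; apply: ICOD_incr_fv; rewrite ?leey.
Qed.

Lemma ICODfinP f : ICODfin f <-> ICOD f /\ forall t : R, (0 <= t)%R -> fv f t%:E < +oo.
Proof.
split=> -[If h]; split=> //.
  by move=> t t0; apply: h; rewrite nnE ?lee_fin// ltry.
move=> x; rewrite -fvE; case: (x%:num) (nonneg_num_ge0 x) => [r|//|//].
by rewrite lee_fin => r0 _; exact: h.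
Qed.

(** For t <= s this is monotonicity; beyond s, concavity and f(0) = 0 make f(t)/t decreasing. The
    bound has the same shape as [Phi_affine_le]. *)
Lemma ICOD_linear_growth f (s t : R) : ICOD f -> (0 < s)%R -> (0 <= t)%R ->
  fv f t%:E <= fv f s%:E + (t / s)%:E * fv f s%:E.
Proof.
move=> If s0 t0.
have [ts|st] := leP t s.
  rewrite -[X in X <= _]adde0; apply: leeD.
    by apply: ICOD_incr_fv; rewrite ?lee_fin.
  by rewrite mule_ge0 ?fv_ge0// lee_fin divr_ge0// ltW.
have tp : (0 < t)%R by exact: lt_trans st.
have st01 : (0 <= s / t <= 1)%R.
  by rewrite divr_ge0 ?ltW//= ltr_pdivrMr// mul1r.
have := ICOD_scale If st01 (_ : 0 <= t%:E); rewrite lee_fin => /(_ t0).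
rewrite -EFinM divfK ?gt_eqF// => h.
apply: (@le_trans _ _ ((t / s)%:E * fv f s%:E)); last first.
  by rewrite leeDr// fv_ge0.
apply: (@le_trans _ _ ((t / s)%:E * ((s / t)%:E * fv f t%:E))).
  rewrite muleA -EFinM (_ : (t / s * (s / t) = 1)%R) ?mul1e//.
  by field; rewrite !gt_eqF.
by apply: lee_wpmul2l => //; rewrite lee_fin divr_ge0// ltW.
Qed.

Lemma ICOD0_fin f : ICOD0 f -> ICODfin f.
Proof.
move=> /ICOD0P[If h0]; apply/ICODfinP; split=> // t t0.
have [s s0 hs] := h0 1%R ltr01.
apply: le_lt_trans (ICOD_linear_growth If s0 t0) _.
have hfin : fv f s%:E < +oo by rewrite (le_lt_trans hs)// ltry.
apply: lte_add_pinfty => //; apply: lte_mul_pinfty => //.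
by rewrite lee_fin divr_ge0// ltW.
Qed.

Lemma ICODbdd_fin f : ICODbdd f -> ICODfin f.
Proof.
move=> /ICODbddP[If [M hM]]; apply/ICODfinP; split=> // t t0.
apply: (@le_lt_trans _ _ (fv f +oo)); last by rewrite (le_lt_trans hM)// ltry.
by apply: ICOD_incr_fv; rewrite ?lee_fin ?leey.
Qed.

Lemma ICOD_zero : icod (cst 0).
Proof.
split=> //; first by move=> t x y t01 x0 y0 /=; rewrite !mule0 adde0.
by move=> y y0; exists 0%R.
Qed.

Lemma ICOD0bdd_zero : ICOD0bdd (fn_of (cst 0)).
Proof.
have I0 := ICOD_fn_of ICOD_zero.
have E x : fv (fn_of (cst 0)) x = 0 by rewrite /fv /fn_of nnE.
split.
  apply/ICOD0P; split=> // e e0; exists 1%R => //.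
  by rewrite E lee_fin ltW.
by apply/ICODbddP; split=> //; exists 0%R; rewrite E.
Qed.

Lemma ICOD0_add f g : ICOD0 f -> ICOD0 g -> ICOD0 (fn_add f g).
Proof.
move=> /ICOD0P[If f0] /ICOD0P[Ig g0]; apply/ICOD0P.
split; first exact: ICOD_add.
move=> e e0; have e2 : (0 < e / 2)%R by rewrite divr_gt0.
have [s s0 hs] := f0 _ e2; have [t t0 ht] := g0 _ e2.
exists (Num.min s t); first by rewrite lt_min s0.
rewrite fv_add (splitr e) EFinD; apply: leeD.
  apply: le_trans hs; apply: ICOD_incr_fv => //; rewrite lee_fin ?ge_min ?lexx//.
  by rewrite le_min !ltW.
apply: le_trans ht; apply: ICOD_incr_fv => //; rewrite lee_fin ?ge_min ?lexx ?orbT//.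
by rewrite le_min !ltW.
Qed.

Lemma ICOD0_comp f g : ICOD0 f -> ICOD0 g -> ICOD0 (f \o g).
Proof.
move=> /ICOD0P[If f0] /ICOD0P[Ig g0]; apply/ICOD0P.
split; first exact: ICOD_comp.
move=> e e0; have [s s0 hs] := f0 _ e0; have [t t0 ht] := g0 _ s0.
exists t => //; rewrite (fv_comp f g); apply: le_trans hs.
by apply: ICOD_incr_fv => //; exact: fv_ge0.
Qed.

Lemma ICODbdd_add f g : ICODbdd f -> ICODbdd g -> ICODbdd (fn_add f g).
Proof.
move=> /ICODbddP[If [M hM]] /ICODbddP[Ig [N hN]]; apply/ICODbddP.
split; first exact: ICOD_add.
by exists (M + N)%R; rewrite fv_add EFinD; apply: leeD.
Qed.

Lemma ICODbdd_comp f g : ICODbdd f -> ICODbdd g -> ICODbdd (f \o g).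
Proof.
move=> /ICODbddP[If [M hM]] /ICODbddP[Ig [N hN]]; apply/ICODbddP.
split; first exact: ICOD_comp.
exists M; rewrite (fv_comp f g); apply: le_trans hM.
by apply: ICOD_incr_fv => //; [exact: fv_ge0|rewrite leey].
Qed.

Lemma ICODfin_add f g : ICODfin f -> ICODfin g -> ICODfin (fn_add f g).
Proof.
move=> /ICODfinP[If hf] /ICODfinP[Ig hg]; apply/ICODfinP.
split; first exact: ICOD_add.
by move=> t t0; rewrite fv_add; apply: lte_add_pinfty; [exact: hf|exact: hg].
Qed.

Lemma ICODfin_comp f g : ICODfin f -> ICODfin g -> ICODfin (f \o g).
Proof.
move=> /ICODfinP[If hf] /ICODfinP[Ig hg]; apply/ICODfinP.
split; first exact: ICOD_comp.
move=> t t0; rewrite (fv_comp f g); have := hg t t0; have := fv_ge0 g t%:E.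
by case: (fv g t%:E) => [r|//|//]; rewrite lee_fin => r0 _; exact: hf.
Qed.

Lemma admissible_ICOD : admissible (@ICOD R).
Proof.
split; [|exact: ICOD_incr|exact: ICOD_add|exact: ICOD_comp].
by exists (fn_of (cst 0)); case: ICOD0bdd_zero => -[].
Qed.

Lemma admissible_ICOD0 : admissible (@ICOD0 R).
Proof.
split; [|by move=> f [/ICOD_incr]|exact: ICOD0_add|exact: ICOD0_comp].
by exists (fn_of (cst 0)); case: ICOD0bdd_zero.
Qed.

Lemma admissible_ICODbdd : admissible (@ICODbdd R).
Proof.
split; [|by move=> f [/ICOD_incr]|exact: ICODbdd_add|exact: ICODbdd_comp].
by exists (fn_of (cst 0)); case: ICOD0bdd_zero.
Qed.

Lemma admissible_ICOD0bdd : admissible (@ICOD0bdd R).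
Proof.
split; first by exists (fn_of (cst 0)); exact: ICOD0bdd_zero.
- by move=> f [[/ICOD_incr]].
- by move=> f g [? ?] [? ?]; split; [exact: ICOD0_add|exact: ICODbdd_add].
- by move=> f g [? ?] [? ?]; split; [exact: ICOD0_comp|exact: ICODbdd_comp].
Qed.

Lemma admissible_ICODfin : admissible (@ICODfin R).
Proof.
split; [|by move=> f [/ICOD_incr]|exact: ICODfin_add|exact: ICODfin_comp].
by exists (fn_of (cst 0)); case: ICOD0bdd_zero => /ICOD0_fin.
Qed.

Lemma icod_jump (c : \bar R) : 0 <= c -> icod (fun x => if x == 0 then 0 else c).
Proof.
move=> c0; split.
- move=> x y x0 xy; case: (eqVneq y 0) => [y0|y0].
    by rewrite ifT// eq_le x0 andbT -[X in _ <= X]y0.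
  by case: ifP.
- move=> t x y /andP[t0 t1] x0 y0; have u0 : 0 <= (1 - t)%:E by rewrite lee_fin subr_ge0.
  have t0' : 0 <= t%:E by rewrite lee_fin.
  have [|_] := boolP (t%:E * x + (1 - t)%:E * y == 0).
    rewrite padde_eq0 ?mule_ge0// !mule_eq0 => /andP[h1 h2].
    have -> : t%:E * (if x == 0 then 0 else c) = 0.
      by case: (eqVneq x 0) h1 => [_|_]; rewrite ?mule0// orbF => /eqP ->; rewrite mul0e.
    have -> : (1 - t)%:E * (if y == 0 then 0 else c) = 0.
      by case: (eqVneq y 0) h2 => [_|_]; rewrite ?mule0// orbF => /eqP ->; rewrite mul0e.
    by rewrite adde0.
  apply: (@le_trans _ _ (t%:E * c + (1 - t)%:E * c)).
    by apply: leeD; apply: lee_wpmul2l => //; case: ifP.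
  by rewrite -ge0_muleDl// -EFinD addrC subrK mul1e.
- by rewrite eqxx.
- by move=> y hy; exists 1%R => //; rewrite eqe oner_eq0.
Qed.

Lemma icod_lin (d : R) : (0 <= d)%R -> icod (fun x => d%:E * x).
Proof.
move=> d0; have d0' : 0 <= d%:E by rewrite lee_fin.
split.
- by move=> x y x0 xy; exact: lee_wpmul2l.
- move=> t x y /andP[t0 t1] x0 y0; have u0 : 0 <= (1 - t)%:E by rewrite lee_fin subr_ge0.
  rewrite ge0_muleDr ?mule_ge0 ?lee_fin//; apply: leeD.
    by rewrite muleCA.
  by rewrite muleCA.
- by rewrite mule0.
- move=> y; have [->|dn0] := eqVneq d 0%R.
    by rewrite mul0e => y0; exists 0%R => //; rewrite mul0e.
  have dp : (0 < d)%R by rewrite lt_neqAle eq_sym dn0.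
  rewrite gt0_muley// => yoo.
  have [r yr] : exists r : R, y <= r%:E.
    by case: y yoo => [r _|//|_]; [exists r|exists 0%R; rewrite leNye].
  exists ((`|r| + 1) / d)%R; first by rewrite divr_ge0// addr_ge0.
  rewrite -EFinM mulrC divfK//; apply: le_lt_trans yr _.
  by rewrite lte_fin ltr_pwDr// ler_norm.
Qed.

End ConcaveFunctions.

(** * Concave majorants of the support expansion *)

Section ConcaveMajorant.
Variable R : realType.
Local Notation fn := ({nonneg \bar R} -> {nonneg \bar R}).
Local Open Scope ereal_scope.

Lemma Phi_majorant (a : L2 R -> L2 R) : bounded_ops a ->
  (forall e : R, (0 < e)%R -> exists2 t : R, (0 < t)%R & Phi a (nn t%:E) <= e%:E) ->
  exists g : fn, [/\ ICOD0 g, (forall x, Phi a x <= (g x)%:num) &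
    fv g +oo <= Phi a (nn +oo)].
Proof.
move=> ba small; have [la _] := ba.
pose p s := Phi a (nn s).
have p0 s : 0 <= p s by exact: Phi_ge0.
have pI s t : 0 <= s -> s <= t -> p s <= p t.
  by move=> s0 st; apply: Phi_incr; rewrite !nnE// (le_trans s0).
pose A (s : R) x := p s%:E + (s^-1%:E * x) * p s%:E.
have V0 (s : R) : (0 < s)%R -> 0 <= s^-1%:E by move=> s0; rewrite lee_fin invr_ge0 ltW.
have AI (s : R) x y : (0 < s)%R -> 0 <= x -> x <= y -> A s x <= A s y.
  move=> s0 x0 xy; apply: leeD => //; apply: lee_wpmul2r => //.
  by apply: lee_wpmul2l => //; exact: V0.
have A0 s x : (0 < s)%R -> 0 <= x -> 0 <= A s x.
  by move=> s0 x0; rewrite adde_ge0// mule_ge0// mule_ge0// V0.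
(* The constant [p +oo] is included so that [h] does not exceed [p +oo]; the functions [A s] alone
   grow linearly and would lose boundedness. *)
pose F x := [set z | z = p +oo \/ exists2 s : R, (0 < s)%R & z = A s x].
pose h x := ereal_inf (F x).
have h_le_A s x : (0 < s)%R -> h x <= A s x.
  by move=> s0; apply: ereal_inf_lbound; right; exists s.
have h_le_oo x : h x <= p +oo by apply: ereal_inf_lbound; left.
have p_le_h x : 0 <= x -> p x <= h x.
  have real_le (s t : R) : (0 < s)%R -> (0 <= t)%R -> p t%:E <= A s t%:E.
    move=> s0 t0; apply: le_trans (Phi_affine_le la s0 t0) _.
    by rewrite /A -EFinM mulrC.
  move=> x0; apply: le_ereal_inf_tmp => _ [->|[s s0 ->]].
    by apply: pI => //; rewrite leey.
  case: x x0 => [t t0|_|//]; first exact: real_le.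
  apply: Phi_oo_le => // t t0; apply: le_trans (real_le s t s0 t0) _.
  by apply: AI; rewrite ?lee_fin ?leey.
have hI x y : 0 <= x -> x <= y -> h x <= h y.
  move=> x0 xy; apply: le_ereal_inf_tmp => _ [->|[s s0 ->]] //.
  by apply: le_trans (AI s x y s0 x0 xy); exact: h_le_A.
have hh : icod h.
  split=> //.
  - move=> t x y /andP[t0 t1] x0 y0; have u0 : 0 <= (1 - t)%:E by rewrite lee_fin subr_ge0.
    have t0' : 0 <= t%:E by rewrite lee_fin.
    have sum1 z : 0 <= z -> t%:E * z + (1 - t)%:E * z = z.
      by move=> z0; rewrite -ge0_muleDl// -EFinD addrC subrK mul1e.
    apply: le_ereal_inf_tmp => _ [->|[s s0 ->]].
      rewrite -[leRHS]sum1//; apply: leeD; exact: lee_wpmul2l.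
    apply: (@le_trans _ _ (t%:E * A s x + (1 - t)%:E * A s y)).
      by apply: leeD; apply: lee_wpmul2l => //; exact: h_le_A.
    have v0 := V0 s s0.
    rewrite /A !ge0_muleDr ?mule_ge0// addeACA sum1//.
    rewrite !ge0_muleDl ?mule_ge0//.
    rewrite le_eqVlt; apply/orP; left; apply/eqP; congr (_ + (_ + _)).
      by rewrite !muleA [t%:E * _]muleC.
    by rewrite !muleA [(1 - t)%:E * _]muleC.
  - apply/eqP; rewrite eq_le (le_trans (p0 0) (p_le_h 0 _))// andbT.
    apply/lee_addgt0Pr => e e0; rewrite add0e.
    have [t t0 ht] := small e e0; apply: le_trans (h_le_A t 0 t0) _.
    by rewrite /A mule0 mul0e adde0.
  - move=> y yh; apply: contrapT => hn.
    (* If [h], and hence [p], stayed below y at all finite arguments, then [Phi_oo_le] would give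
       p(+oo) <= y, against y < h(+oo) <= p(+oo). *)
    have : p +oo <= y.
      apply: Phi_oo_le => // t t0; rewrite leNgt; apply/negP => yt; apply: hn.
      by exists t => //; apply: lt_le_trans yt (p_le_h _ _).
    by rewrite leNgt (lt_le_trans yh).
have E x : 0 <= x -> fv (fn_of h) x = h x.
  by move=> x0; rewrite fv_fn_of//; exact: icod_ge0.
exists (fn_of h); split.
- apply/ICOD0P; split; first exact: ICOD_fn_of.
  move=> e e0; have e2 : (0 < e / 2)%R by rewrite divr_gt0.
  have [t t0 ht] := small _ e2; exists t => //.
  rewrite E ?lee_fin ?(ltW t0)//; apply: le_trans (h_le_A t _ t0) _.
  (* At its own parameter the affine bound is twice [p t], which explains the choice of e/2. *)
  rewrite /A -EFinM mulVf ?gt_eqF// mul1e (splitr e) EFinD.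
  by apply: leeD.
- move=> x; rewrite -fvE E//; have := p_le_h x%:num (nonneg_num_ge0 x).
  by rewrite /p nnK.
- by rewrite E.
Qed.

End ConcaveMajorant.

(** * Weighted dilations *)

Section Dilation.
Variable R : realType.
Local Notation mu := (@lebesgue_measure R).

Lemma measurable_dil (c : R) : measurable_fun [set: R] (fun x : R => c * x).
Proof. by apply: measurable_funM. Qed.

Definition pushforward_dil (c : R) : {measure set (measurableTypeR R) -> \bar R} :=
  measure_function_pushforward__canonical__measure_function_Measure
    (lebesgue_measure : {measure set (measurableTypeR R) -> \bar R})
    (measurable_dil c : measurable_fun [set: measurableTypeR R]
       (fun x : measurableTypeR R => (c * x : measurableTypeR R))).

(** The rescaled pushforward agrees with Lebesgue measure on half-open intervals, and these
    determine it. *)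
Lemma lebesgue_measure_dil (c : R) (A : set R) : 0 < c -> measurable A ->
  (c%:E * mu ((fun x => c * x)%R @^-1` A) = mu A)%E.
Proof.
move=> c0 mA; have c1 : 0 <= c by exact: ltW.
have : mu A = mscale (NngNum c1) (pushforward_dil c) A; last by move=> ->.
apply: lebesgue_measure_unique => // _ [[p q]] _ <-.
have E : (fun x : R => c * x) @^-1` `]p, q]%classic = `]p / c, q / c]%classic.
  apply/seteqP; split => x /=; rewrite !in_itv/= ltr_pdivrMr// ler_pdivlMr//.
    by rewrite ![c * _]mulrC.
  by rewrite ![c * _]mulrC.
transitivity (c%:E * mu ((fun x : R => c * x)%R @^-1` `]p, q]%classic))%E; last by [].
rewrite E !lebesgue_measure_itv/= !lte_fin ltr_pM2r ?invr_gt0//.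
case: ifP => _; last by rewrite mule0.
by rewrite -!EFinB -EFinM; congr EFin; field; rewrite gt_eqF.
Qed.

Lemma ge0_integral_dil (c : R) (D : set R) (f : R -> \bar R) : 0 < c ->
  measurable D -> measurable_fun [set: R] f -> (forall x, (0 <= f x)%E) ->
  (c%:E * \int[mu]_(x in (fun x => c * x)%R @^-1` D) f (c * x)%R = \int[mu]_(x in D) f x)%E.
Proof.
move=> c0 mD mf f0; have c1 : 0 <= c by exact: ltW.
have mfD : measurable_fun D f by exact: measurable_funTS.
have := @ge0_integral_pushforward _ _ (measurableTypeR R) (measurableTypeR R) R
  (fun x => c * x) (measurable_dil c) mu D f mD mfD (fun y _ => f0 y).
move=> /= <-.
transitivity (\int[mscale (NngNum c1) (pushforward_dil c)]_(x in D) f x)%E.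
  by rewrite ge0_integral_mscale.
apply: eq_measure_integral => // A mA AD.
by rewrite /mscale/= -(lebesgue_measure_dil c0 mA).
Qed.

End Dilation.

(** * Functions defined piecewise on disjoint sets *)

Section Piecewise.
Variable R : realType.
Local Notation mu := (@lebesgue_measure R).
Local Notation Re := (@complex.Re R).
Local Notation Im := (@complex.Im R).
Implicit Types (xi eta zeta : L2 R).

(* A vector [eta] with [|eta|^2 <= K] cannot be approximated by vectors of small
   support. *)
Lemma flat_supp_ge eta zeta (K : R) : 0 <= K -> ae (fun x => abs2 (eta x) <= K) ->
  rdot (eta - zeta) (eta - zeta) <= rdot eta eta / 4 ->
  ((rdot eta eta * 3 / 4)%:E <= K%:E * mu (supp zeta))%E.
Proof.
move=> K0 etaK h; have ms := measurable_supp zeta.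
have h1 := le_trans (rdot_off_supp_le eta zeta) h.
apply: (@le_trans _ _ (rdot (restr (supp zeta) eta) (restr (supp zeta) eta))%:E).
  by rewrite lee_fin; have := rdot_restr_sum eta ms; lra.
rewrite rdot_restrE// -integral_cst//; apply: ae_ge0_le_integral => //.
- by move=> x _; rewrite lee_fin abs2_ge0.
- by apply: measurable_funTS; exact: measurable_abs2_L2.
- by apply: ae_filter1 etaK => x hx _; rewrite lee_fin.
Qed.

Section PiecewiseFun.
Variable A : nat -> set R.
Hypotheses (mA : forall k, measurable (A k)) (tA : trivIset setT A).

(** The index is picked by choice; disjointness of the pieces makes it unique ([piecewiseE]). *)
Definition piecewise (F : nat -> R -> R[i]) (x : R) : R[i] :=
  if pselect (exists k, A k x) is left h then F (projT1 (cid h)) x else 0.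

Lemma piecewiseE F k x : A k x -> piecewise F x = F k x.
Proof.
move=> Ak; rewrite /piecewise; case: pselect => [h|]; last by case; exists k.
case: cid => j Aj /=; suff -> : j = k by [].
by apply: (tA I I); exists x.
Qed.

Lemma piecewise_out F x : (forall k, ~ A k x) -> piecewise F x = 0.
Proof. by move=> h; rewrite /piecewise; case: pselect => // -[k Ak]; case: (h k Ak). Qed.

Lemma measurable_piecewise (g : R -> R) (G : nat -> R -> R) :
  (forall k, measurable_fun setT (G k)) -> (forall k x, A k x -> g x = G k x) ->
  (forall x, (forall k, ~ A k x) -> g x = 0) -> measurable_fun [set: R] g.
Proof.
move=> mG gG g0.
(* The index is shifted by one to make room for the complement of all pieces, so that the [E k]
   cover the line. *)
pose E k := if k is k'.+1 then A k' else ~` \bigcup_k A k.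
have mE k : measurable (E k).
  by case: k => [|k] /=; [apply: measurableC; exact: bigcupT_measurable|exact: mA].
have -> : setT = \bigcup_k E k.
  apply/seteqP; split => // x _; have [[k Ak]|h] := pselect (exists k, A k x).
    by exists k.+1.
  by exists 0%N => //= -[k _ Ak]; apply: h; exists k.
have h0 : measurable_fun (E 0%N) g.
  apply: (eq_measurable_fun (cst 0 : R -> R)) => // x.
  by rewrite inE => /= h; rewrite g0// => k Ak; apply: h; exists k.
have h1 k : measurable_fun (E k.+1) g.
  apply: (eq_measurable_fun (G k)); last exact: measurable_funTS.
  by move=> x; rewrite inE => Ax; rewrite (gG _ _ Ax).
by apply/measurable_fun_bigcup => // -[//|k]; exact: h1.
Qed.

Lemma piecewise_measurable F :
  (forall k, measurable_fun setT (Re \o F k)) -> (forall k, measurable_fun setT (Im \o F k)) ->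
  measurable_fun setT (Re \o piecewise F) /\ measurable_fun setT (Im \o piecewise F).
Proof.
move=> mr mi; split.
  apply: (measurable_piecewise mr) => [k x Ak|x h] /=; first by rewrite (piecewiseE _ Ak).
  by rewrite piecewise_out.
apply: (measurable_piecewise mi) => [k x Ak|x h] /=; first by rewrite (piecewiseE _ Ak).
by rewrite piecewise_out.
Qed.

Lemma integral_abs2_piecewise F :
  (forall k, measurable_fun setT (Re \o F k)) -> (forall k, measurable_fun setT (Im \o F k)) ->
  (\int[mu]_x (abs2 (piecewise F x))%:E =
   \sum_(0 <= k <oo) \int[mu]_(x in A k) (abs2 (F k x))%:E)%E.
Proof.
move=> mr mi; have [gr gi] := piecewise_measurable mr mi.
have mg := measurable_abs2 gr gi.
transitivity (\int[mu]_(x in \bigcup_k A k) (abs2 (piecewise F x))%:E)%E.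
  rewrite [RHS]integral_mkcond; apply: eq_integral => x _; rewrite patchE.
  case: ifPn => // /negP hx; rewrite piecewise_out.
    by rewrite /abs2 expr0n/= addr0.
  by move=> k Ak; apply: hx; apply/mem_set; exists k.
rewrite ge0_integral_bigcup//; last 2 first.
- exact: measurable_funTS.
- by move=> x _; rewrite lee_fin abs2_ge0.
apply: eq_eseriesr => k _; apply: eq_integral => x /set_mem Ak.
by rewrite (piecewiseE _ Ak).
Qed.

End PiecewiseFun.

Lemma ae_dil (c : R) (P : R -> Prop) : 0 < c -> ae P -> ae (fun x => P (c * x)).
Proof.
move=> c0 [N [mN N0 PN]]; exists ((fun x => c * x) @^-1` N); split.
- by rewrite -[X in measurable X]setTI; apply: (measurable_dil c) => //.
- have := lebesgue_measure_dil c0 mN; rewrite N0 => /eqP.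
  by rewrite mule_eq0 eqe gt_eqF//= => /eqP.
- by move=> x /= h; exact: PN.
Qed.

Lemma ae_forall_nat (P : nat -> R -> Prop) : (forall n, ae (P n)) ->
  ae (fun x => forall n, P n x).
Proof. by move=> h; apply: ae_foralln. Qed.

(** An interval whose measure equals its left endpoint, so one sequence fixes both the positions and
    the sizes of the pieces. *)
Definition dyad (a : R) : set R := `[a, 2 * a[%classic.

Lemma measurable_dyad a : measurable (dyad a).
Proof. exact: measurable_itv. Qed.

Lemma mu_dyad a : 0 <= a -> mu (dyad a) = a%:E.
Proof.
move=> a0; rewrite /dyad lebesgue_measure_itv/= lte_fin.
case: ifPn => h; first by rewrite -EFinB; congr EFin; ring.
by congr EFin; lra.
Qed.

Definition halving (a : R^nat) := (forall k, 0 < a k) /\ (forall k, 2 * a k.+1 <= a k).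

Lemma halving_le a j k : halving a -> (j < k)%N -> 2 * a k <= a j.
Proof.
move=> [a0 ah]; elim: k => // k IH; rewrite ltnS leq_eqVlt => /predU1P[->//|/IH h].
by have := ah k; have := a0 k; lra.
Qed.

Lemma trivIset_halving a : halving a -> trivIset setT (fun k => dyad (a k)).
Proof.
move=> ha.
have h j k x : (j < k)%N -> dyad (a j) x -> dyad (a k) x -> False.
  move=> jk; rewrite /dyad /= !in_itv/= => /andP[h1 _] /andP[_ h2].
  by have := halving_le ha jk; lra.
move=> j k _ _ [x [xj xk]]; case: (ltngtP j k) => // jk.
  by case: (h j k x).
by case: (h k j x).
Qed.

(** Disjointness suffices to define a dilation operator. The stronger [halving] is needed to bound
    supports; the sequence 2^k is a scale but not halving, and gives an operator outside the algebra
    of ICODfin. *)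
Definition scale (a : R^nat) :=
  (forall k, 0 < a k) /\ trivIset setT (fun k => dyad (a k)).

Lemma halving_scale a : halving a -> scale a.
Proof. by move=> ha; split; [case: ha|exact: trivIset_halving]. Qed.

Lemma halving_exp : halving (fun k => 2^-1 ^+ k).
Proof.
split=> k; first by rewrite exprn_gt0.
by rewrite exprS mulrA mulfV// mul1r.
Qed.

Lemma scale_exp : scale (fun k => 2 ^+ k).
Proof.
split=> [k|]; first by rewrite exprn_gt0.
have h j k x : (j < k)%N -> dyad (2 ^+ j) x -> dyad (2 ^+ k) x -> False.
  move=> jk; rewrite /dyad /= !in_itv/= => /andP[_ h1] /andP[h2 _].
  by have := le_lt_trans h2 h1; rewrite -exprS ltNge ler_eXn2l// ?ltr1n// jk.
move=> j k _ _ [x [xj xk]]; case: (ltngtP j k) => // jk.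
  by case: (h j k x).
by case: (h k j x).
Qed.

End Piecewise.

(** * The weighted dilation between two scales *)

Section DilationOperator.
Variable R : realType.
Local Notation mu := (@lebesgue_measure R).
Local Notation Re := (@complex.Re R).
Local Notation Im := (@complex.Im R).
Implicit Types (xi eta zeta : L2 R).
Variables a b : nat -> R.
Hypotheses (ha : scale a) (hb : scale b).

Let c k := a k / b k.
Let A k := dyad (a k).
Let B k := dyad (b k).

Let a0 k : 0 < a k. Proof. by case: ha. Qed.
Let b0 k : 0 < b k. Proof. by case: hb. Qed.
Let c0 k : 0 < c k. Proof. by rewrite divr_gt0. Qed.
Let mA k : measurable (A k). Proof. exact: measurable_dyad. Qed.
Let mB k : measurable (B k). Proof. exact: measurable_dyad. Qed.
Let tA : trivIset setT A. Proof. by case: ha. Qed.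
Let tB : trivIset setT B. Proof. by case: hb. Qed.

(** The square root of the ratio makes each piece isometric from functions on [A k] to functions on
    [B k]. *)
Definition dilop_piece xi k x : R[i] := (Num.sqrt (c k))%:C%C * xi (c k * x).

Definition dilop_fun xi : R -> R[i] := piecewise B (dilop_piece xi).

Definition dilop xi : L2 R := toL2 (dilop_fun xi).

Lemma dyad_dil k x : B k x <-> A k (c k * x).
Proof.
rewrite /A /B /dyad /= !in_itv/= /c.
have -> : (a k <= a k / b k * x) = (b k <= x).
  by rewrite -mulrA ler_pMr// mulrC ler_pdivlMr// mul1r.
have -> : (a k / b k * x < 2 * a k) = (x < 2 * b k).
  rewrite mulrAC ltr_pdivrMr//.
  have -> : 2 * a k * b k = a k * (2 * b k) by ring.
  by rewrite ltr_pM2l.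
by [].
Qed.

Lemma measurable_dilop_piece xi k :
  measurable_fun setT (Re \o dilop_piece xi k) /\ measurable_fun setT (Im \o dilop_piece xi k).
Proof.
split.
  rewrite (_ : _ \o _ = fun x => Num.sqrt (c k) * Re (xi (c k * x))).
    apply: measurable_funM => //.
    exact: (measurableT_comp (@measurable_Re_L2 R xi) (measurable_dil (c k))).
  by apply/funext => x /=; rewrite /dilop_piece Defs.ReM /= mul0r subr0.
rewrite (_ : _ \o _ = fun x => Num.sqrt (c k) * Im (xi (c k * x))).
  apply: measurable_funM => //.
  exact: (measurableT_comp (@measurable_Im_L2 R xi) (measurable_dil (c k))).
by apply/funext => x /=; rewrite /dilop_piece Defs.ImM /= mul0r addr0.
Qed.

Lemma abs2_dilop_piece xi k x : abs2 (dilop_piece xi k x) = c k * abs2 (xi (c k * x)).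
Proof.
rewrite /abs2 /dilop_piece Defs.ReM Defs.ImM /= !mul0r subr0 addr0.
by rewrite !exprMn sqr_sqrtr ?(ltW (c0 k))// mulrDr.
Qed.

Lemma integral_dilop xi : (\int[mu]_x (abs2 (dilop_fun xi x))%:E <=
  \int[mu]_x (abs2 (xi x))%:E)%E.
Proof.
rewrite integral_abs2_piecewise//; last 2 first.
- by move=> k; case: (measurable_dilop_piece xi k).
- by move=> k; case: (measurable_dilop_piece xi k).
have E k : (\int[mu]_(x in B k) (abs2 (dilop_piece xi k x))%:E =
    \int[mu]_(x in A k) (abs2 (xi x))%:E)%E.
  rewrite -(@ge0_integral_dil _ (c k) (A k) (fun x => (abs2 (xi x))%:E))//; last 2 first.
  - exact: measurable_abs2_L2.
  - by move=> x; rewrite lee_fin abs2_ge0.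
  have -> : (fun x => c k * x) @^-1` A k = B k.
    by apply/seteqP; split => x /= /dyad_dil.
  rewrite -ge0_integralZl//; last 4 first.
  - exact: mB.
  - apply: measurable_funTS.
    exact: (measurableT_comp (@measurable_abs2_L2 R xi) (measurable_dil (c k))).
  - by move=> x _; rewrite lee_fin abs2_ge0.
  - by rewrite lee_fin ltW.
  by apply: eq_integral => x _; rewrite abs2_dilop_piece EFinM.
rewrite (eq_eseriesr (fun k _ => E k)).
rewrite -ge0_integral_bigcup//; last 2 first.
- by apply: measurable_funTS; exact: measurable_abs2_L2.
- by move=> x _; rewrite lee_fin abs2_ge0.
apply: ge0_subset_integral => //.
- exact: bigcupT_measurable.
- exact: measurable_abs2_L2.
- by move=> x _; rewrite lee_fin abs2_ge0.
Qed.

Lemma dilop_sq_integrable xi : dilop_fun xi \in @sq_integrable R.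
Proof.
have [mr mi] : measurable_fun setT (Re \o dilop_fun xi) /\ measurable_fun setT (Im \o dilop_fun xi).
  by apply: piecewise_measurable => // k; case: (measurable_dilop_piece xi k).
apply/sq_integrable_abs2; split => //.
by apply: le_lt_trans (integral_dilop xi) _; exact: abs2_L2_lty.
Qed.

Lemma dilopE xi : ae (fun x => dilop xi x = dilop_fun xi x).
Proof. exact: toL2E (dilop_sq_integrable xi). Qed.

Lemma rdot_dilop_le xi : rdot (dilop xi) (dilop xi) <= rdot xi xi.
Proof.
rewrite -lee_fin !rdotxxE; apply: le_trans (integral_dilop xi).
rewrite le_eqVlt; apply/orP; left; apply/eqP; apply: ae_eq_integral => //.
- exact: measurable_abs2_L2.
- have /sq_integrable_abs2[mr mi _] := dilop_sq_integrable xi.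
  exact: measurable_abs2.
- by apply: ae_filter1 (dilopE xi) => x /= -> _.
Qed.

Lemma dilop_linear : linear dilop.
Proof.
move=> s xi eta; apply: L2_aeP.
have h1 := dilopE (s *: xi + eta).
have h2 : ae (fun x => L2_fun (s *: dilop xi + dilop eta) x =
    s * dilop_fun xi x + dilop_fun eta x).
  have e1 := L2_addE (s *: dilop xi) (dilop eta); have e2 := L2_scaleE s (dilop xi).
  have e3 := dilopE xi; have e4 := dilopE eta.
  have e5 : ae (fun x => L2_fun (s *: dilop xi) x = s * dilop_fun xi x).
    by apply: ae_filter2 e2 e3 => x -> ->.
  have e6 : ae (fun x => L2_fun (s *: dilop xi) x + dilop eta x =
      s * dilop_fun xi x + dilop_fun eta x).
    by apply: ae_filter2 e5 e4 => x -> ->.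
  by apply: ae_filter2 e1 e6 => x -> ->.
(* The identity for representatives holds off a null set; its preimages under countably many
   dilations are again null. *)
have h3 : ae (fun x => forall k, L2_fun (s *: xi + eta) (c k * x) =
    s * L2_fun xi (c k * x) + L2_fun eta (c k * x)).
  apply: ae_forall_nat => k.
  apply: (ae_dil (P := fun x => L2_fun (s *: xi + eta) x = s * L2_fun xi x + L2_fun eta x) (c0 k)).
  by apply: ae_filter2 (L2_addE (s *: xi) eta) (L2_scaleE s xi) => x -> ->.
have h4 : ae (fun x => dilop_fun (s *: xi + eta) x = s * dilop_fun xi x + dilop_fun eta x).
  apply: ae_filter1 h3 => x hx; rewrite /dilop_fun.
  have [[k Bk]|nB] := pselect (exists k, B k x).
    by rewrite !(piecewiseE tB _ Bk) /dilop_piece hx mulrDr mulrCA.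
  by rewrite !piecewise_out ?mulr0 ?addr0// => k Bk; apply: nB; exists k.
have h5 : ae (fun x => dilop (s *: xi + eta) x = s * dilop_fun xi x + dilop_fun eta x).
  by apply: ae_filter2 h1 h4 => x -> ->.
by apply: ae_filter2 h5 h2 => x -> ->.
Qed.

Lemma dilop_bounded : bounded_ops dilop.
Proof.
apply: (@bounded_ops_rdot _ _ dilop_linear 1) => // xi.
by rewrite mul1r; exact: rdot_dilop_le.
Qed.

(** All pieces from index n on lie in [0, 2 b n]; each earlier one enlarges the support by the
    factor 1 / c k. Choosing n first and the support afterwards makes both terms small. *)
Lemma dilop_supp xi n : halving b -> (mu (supp (dilop xi)) <=
  (2 * b n)%:E + (\sum_(k < n) (c k)^-1)%:E * mu (supp xi))%E.
Proof.
move=> hb'.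
have ms := measurable_supp xi.
pose D k := (fun x => c k * x) @^-1` supp xi.
have mD k : measurable (D k).
  by rewrite -[X in measurable X]setTI; apply: (measurable_dil (c k)).
pose E n := \big[setU/set0]_(k < n) D k.
have mE m : measurable (E m) by apply: bigsetU_measurable.
have muE m : (mu (E m) <= (\sum_(k < m) (c k)^-1)%:E * mu (supp xi))%E.
  elim: m => [|m IH]; first by rewrite /E !big_ord0 measure0 mul0e.
  rewrite /E !big_ord_recr/=.
  apply: (@le_trans _ _ (mu (E m) + mu (D m))%E); first by apply: measureU2; [exact: mE|exact: mD].
  rewrite EFinD ge0_muleDl ?lee_fin ?invr_ge0 ?(ltW (c0 m))//; last first.
    by apply: sumr_ge0 => k _; rewrite invr_ge0 ltW.
  apply: leeD => //; rewrite -(lebesgue_measure_dil (c0 m) ms) muleA -EFinM.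
  by rewrite mulVf ?gt_eqF// mul1e.
pose J : set R := `[0, 2 * b n]%classic.
have mI : measurable J by exact: measurable_itv.
apply: (@le_trans _ _ (mu J + mu (E n))%E); last first.
  apply: leeD => //; rewrite /J lebesgue_measure_itv/= lte_fin; case: ifP => _.
    by rewrite -EFinB subr0.
  by rewrite lee_fin mulr_ge0// ltW.
apply: (@le_trans _ _ (mu (J `|` E n))); last first.
  by apply: measureU2; [exact: mI|exact: mE].
apply: le_mu_supp; first exact: measurableU.
apply: ae_filter1 (dilopE xi) => x -> hx.
have [[k Bk]|nB] := pselect (exists k, B k x); last first.
  by move: hx; rewrite /dilop_fun piecewise_out ?eqxx// => k Bk; apply: nB; exists k.
have [kn|nk] := ltnP k n.
  right; rewrite /E -bigcup_mkord; exists k => //; rewrite /D /supp /=.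
  move: hx; rewrite /dilop_fun (piecewiseE tB _ Bk) /dilop_piece.
  by apply: contra_neq => ->; rewrite mulr0.
left; move: Bk; rewrite /J /B /dyad /= !in_itv/= => /andP[h1 h2].
rewrite (le_trans (ltW (b0 k)) h1)/=; apply: (le_trans (ltW h2)).
rewrite ler_pM2l//; move: nk; rewrite leq_eqVlt => /predU1P[->//|/(halving_le hb')].
by have := b0 k; lra.
Qed.

(** The adjoint dilates in the opposite direction, so [a] and [b] change roles; only its support is
    needed, and [adjoint_supp] gives that without a formula for it. *)
Lemma dilop_adjoint_supp eta n : halving a -> (mu (supp (adjoint dilop eta)) <=
  (2 * a n)%:E + (\sum_(k < n) c k)%:E * mu (supp eta))%E.
Proof.
move=> ha'.
have ms := measurable_supp eta.
pose D k := (fun x => (c k)^-1 * x) @^-1` supp eta.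
have ci0 k : 0 < (c k)^-1 by rewrite invr_gt0.
have mD k : measurable (D k).
  by rewrite -[X in measurable X]setTI; apply: (measurable_dil (c k)^-1).
pose E n := \big[setU/set0]_(k < n) D k.
have mE m : measurable (E m) by apply: bigsetU_measurable.
have muE m : (mu (E m) <= (\sum_(k < m) c k)%:E * mu (supp eta))%E.
  elim: m => [|m IH]; first by rewrite /E !big_ord0 measure0 mul0e.
  rewrite /E !big_ord_recr/=.
  apply: (@le_trans _ _ (mu (E m) + mu (D m))%E); first by apply: measureU2; [exact: mE|exact: mD].
  rewrite EFinD ge0_muleDl ?lee_fin ?(ltW (c0 m))//; last first.
    by apply: sumr_ge0 => k _; rewrite ltW.
  apply: leeD => //; rewrite -(lebesgue_measure_dil (ci0 m) ms) muleA -EFinM.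
  by rewrite mulfV ?gt_eqF// mul1e.
pose J : set R := `[0, 2 * a n]%classic.
have mI : measurable J by exact: measurable_itv.
apply: (@le_trans _ _ (mu J + mu (E n))%E); last first.
  apply: leeD => //; rewrite /J lebesgue_measure_itv/= lte_fin; case: ifP => _.
    by rewrite -EFinB subr0.
  by rewrite lee_fin mulr_ge0// ltW.
apply: (@le_trans _ _ (mu (J `|` E n))); last first.
  by apply: measureU2; [exact: mI|exact: mE].
have mU : measurable (J `|` E n) by exact: measurableU.
apply: le_mu_supp => //; apply: adjoint_supp => //; first exact: dilop_bounded.
move=> xi hxi; apply: rdot_ae0.
have h3 : ae (fun x => forall k, (J `|` E n) (c k * x) -> xi (c k * x) = 0).
  by apply: ae_forall_nat => k; exact: (ae_dil (c0 k) hxi).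
apply: ae_filter2 h3 (dilopE xi) => x hx; rewrite /rdotf => ->.
have [[k Bk]|nB] := pselect (exists k, B k x); last first.
  by rewrite /dilop_fun piecewise_out ?mul0r ?addr0// => k Bk; apply: nB; exists k.
have [eta0|eta0] := eqVneq (eta x) 0; first by rewrite eta0 !mulr0 addr0.
rewrite /dilop_fun (piecewiseE tB _ Bk) /dilop_piece hx ?mulr0 ?mul0r ?addr0//.
have [kn|nk] := ltnP k n.
  right; rewrite /E -bigcup_mkord; exists k => //; rewrite /D /supp /=.
  by rewrite mulrA mulVf ?mul1r// lt0r_neq0.
left; move/dyad_dil: Bk; rewrite /J /A /dyad /= !in_itv/= => /andP[h1 h2].
rewrite (le_trans (ltW (a0 k)) h1)/=; apply: (le_trans (ltW h2)).
rewrite ler_pM2l//; move: nk; rewrite leq_eqVlt => /predU1P[->//|/(halving_le ha')].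
by have := a0 k; lra.
Qed.

End DilationOperator.

(** * Lower bounds forced by operators in the algebra *)

Section LowerBounds.
Variable R : realType.
Local Notation mu := (@lebesgue_measure R).
Local Notation Re := (@complex.Re R).
Local Notation Im := (@complex.Im R).
Local Notation fn := ({nonneg \bar R} -> {nonneg \bar R}).
Implicit Types (xi eta zeta : L2 R).

Definition indv (S : set R) : L2 R := toL2 (fun x => if x \in S then 1 else 0).

Section Indv.
Variable S : set R.
Hypotheses (mS : measurable S) (Soo : (mu S < +oo)%E).

Lemma integral_if_mem (K : R) : 0 <= K ->
  (\int[mu]_x (if x \in S then K else 0)%:E = K%:E * mu S)%E.
Proof.
move=> K0; rewrite -integral_cst// [RHS]integral_mkcond.
by apply: eq_integral => x _; rewrite patchE; case: ifP.
Qed.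

Lemma abs2_if_mem x : abs2 (if x \in S then 1 else 0 : R[i]) = if x \in S then 1 else 0.
Proof. by case: ifP => _; rewrite /abs2/= ?expr1n ?expr0n/= addr0. Qed.

Lemma indvE : ae (fun x => indv S x = if x \in S then 1 else 0).
Proof.
apply: toL2E; apply/sq_integrable_abs2; split.
- rewrite (_ : _ \o _ = fun x => if x \in S then 1 else 0).
    by apply: measurable_fun_ifT => //; exact: measurable_mem.
  by apply/funext => x /=; case: ifP.
- rewrite (_ : _ \o _ = cst 0) //.
  by apply/funext => x /=; case: ifP.
- under eq_integral do rewrite abs2_if_mem.
  by rewrite integral_if_mem// mul1e.
Qed.

Lemma rdot_indv : (rdot (indv S) (indv S))%:E = mu S.
Proof.
rewrite rdotxxE -[RHS]mul1e -(integral_if_mem ler01); apply: ae_eq_integral => //.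
- exact: measurable_abs2_L2.
- apply/measurable_EFinP; apply: measurable_fun_ifT => //; exact: measurable_mem.
- by apply: ae_filter1 indvE => x -> _; rewrite abs2_if_mem.
Qed.

Lemma mu_supp_indv : (mu (supp (indv S)) <= mu S)%E.
Proof.
apply: le_mu_supp => //; apply: ae_filter1 indvE => x ->.
by case: ifPn => [/set_mem//|_]; rewrite eqxx.
Qed.

End Indv.

Lemma near_rdot (a d : L2 R -> L2 R) xi : linear a -> linear d ->
  (opnorm (a - d)%R < (2^-1)%:E)%E ->
  rdot (a xi - d xi) (a xi - d xi) <= rdot xi xi / 4.
Proof.
move=> la ld h.
have lad : linear (a - d)%R.
  move=> s u v; rewrite -[LHS]/(a (s *: u + v) - d (s *: u + v)).
  rewrite -[X in _ = s *: X + _]/(a u - d u) -[X in _ = _ + X]/(a v - d v).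
  by rewrite la ld scalerBr opprD addrACA.
have := opnorm_rdot_le lad _ (ltW h) xi.
have -> : (a - d)%R xi = a xi - d xi by [].
move=> /(_ _)/le_trans; apply; first by rewrite invr_ge0.
rewrite mulrC ler_wpM2l ?rdot_ge0//.
by rewrite expr2 -invfM -natrM.
Qed.

Lemma C_fam_near (F : set fn) a (e : R) : C_fam F a -> 0 < e ->
  exists f d, [/\ F f, B_fun f d & (opnorm (a - d)%R < e%:E)%E].
Proof. by move=> [_ h] /h[d [f Ff Bfd] hd]; exists f, d. Qed.

Lemma C_fam_id_lower (F : set fn) : C_fam F id ->
  exists2 f, F f & forall t : R, 0 <= t -> ((t * 3 / 4)%:E <= fv f t%:E)%E.
Proof.
move=> Cid; have [|f [d [Ff [bd Pd _] nd]]] := C_fam_near Cid (_ : 0 < 2^-1).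
  by rewrite invr_gt0.
exists f => // t t0; have [ld _] := bd.
pose S : set R := `[0, t]%classic.
have mS : measurable S by exact: measurable_itv.
have muS : mu S = t%:E.
  rewrite lebesgue_measure_itv/= lte_fin; case: ifPn => [_|]; first by rewrite -EFinB subr0.
  by rewrite -leNgt => t1; congr EFin; apply/le_anti/andP.
have Soo : (mu S < +oo)%E by rewrite muS ltry.
have rS : rdot (indv S) (indv S) = t by apply: EFin_inj; rewrite rdot_indv.
have h := near_rdot (indv S) (fun _ _ _ => erefl) ld nd.
have := @flat_supp_ge _ (indv S) (d (indv S)) 1 ler01 _ h.
rewrite rS mul1e => /(_ _)/le_trans; apply.
  by apply: ae_filter1 (indvE mS Soo) => x ->; rewrite abs2_if_mem; case: ifP.
apply: le_trans (Pd (nn t%:E)); apply: le_Phi; rewrite nnE ?lee_fin// -muS.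
exact: mu_supp_indv.
Qed.

Section DilationLower.
Variables a b : nat -> R.
Hypotheses (ha : scale a) (hb : scale b).

Let a0 k : 0 < a k. Proof. by case: ha. Qed.
Let b0 k : 0 < b k. Proof. by case: hb. Qed.

Lemma dilop_indv k : ae (fun x => abs2 (dilop a b (indv (dyad (a k))) x) =
  if x \in dyad (b k) then a k / b k else 0).
Proof.
have mA := measurable_dyad (a k).
have Aoo : (mu (dyad (a k)) < +oo)%E by rewrite mu_dyad ?ltry// ltW.
have h3 : ae (fun x => forall j, indv (dyad (a k)) (a j / b j * x) =
   if (a j / b j * x) \in dyad (a k) then 1 else 0).
  by apply: ae_forall_nat => j; apply: (ae_dil _ (indvE mA Aoo)); rewrite divr_gt0.
apply: ae_filter2 h3 (dilopE ha hb (indv (dyad (a k)))) => x hx ->.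
have [[j Bj]|nB] := pselect (exists j, dyad (b j) x); last first.
  rewrite /dilop_fun piecewise_out; last by move=> j Bj; apply: nB; exists j.
  rewrite ifF; first by rewrite /abs2/= expr0n/= addr0.
  by apply/negP => /set_mem Bk; apply: nB; exists k.
rewrite /dilop_fun (piecewiseE hb.2 _ Bj) abs2_dilop_piece// hx abs2_if_mem.
have Aj : dyad (a j) (a j / b j * x) by move: Bj => /(dyad_dil ha hb).
have [jk|jk] := eqVneq j k.
  by rewrite -jk !mem_set// mulr1.
rewrite ifF ?mulr0; last first.
  apply/negP => /set_mem Ak; move/eqP: jk; apply.
  by apply: (ha.2 _ _ I I); exists (a j / b j * x).
rewrite ifF//; apply/negP => /set_mem Bk; move/eqP: jk; apply.
by apply: (hb.2 _ _ I I); exists x.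
Qed.

(** The image of the indicator of [dyad (a k)] has squared norm a k and constant squared modulus a k
    / b k on [dyad (b k)]. By [flat_supp_ge], a vector that close to it has a support of measure at
    least 3/4 of the quotient, which is b k. *)
Lemma C_fam_dilop_lower (F : set fn) : C_fam F (dilop a b) ->
  exists2 f, F f & forall k, ((b k * 3 / 4)%:E <= fv f (a k)%:E)%E.
Proof.
move=> CU; have [|f [d [Ff [bd Pd _] nd]]] := C_fam_near CU (_ : 0 < 2^-1).
  by rewrite invr_gt0.
exists f => // k; have [ld _] := bd.
have mA := measurable_dyad (a k); have mB := measurable_dyad (b k).
have muA := mu_dyad (ltW (a0 k)); have muB := mu_dyad (ltW (b0 k)).
have Aoo : (mu (dyad (a k)) < +oo)%E by rewrite muA ltry.
set e := indv (dyad (a k)).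
have re : rdot e e = a k by apply: EFin_inj; rewrite rdot_indv.
have c0 : 0 < a k / b k by rewrite divr_gt0.
have rU : rdot (dilop a b e) (dilop a b e) = a k.
  apply: EFin_inj; rewrite rdotxxE.
  transitivity (\int[mu]_x (if x \in dyad (b k) then a k / b k else 0)%:E)%E.
    apply: ae_eq_integral => //.
    - exact: measurable_abs2_L2.
    - apply/measurable_EFinP; apply: measurable_fun_ifT => //; exact: measurable_mem.
    - by apply: ae_filter1 (dilop_indv k) => x -> _.
  by rewrite integral_if_mem ?(ltW c0)// muB -EFinM divfK// gt_eqF.
have h := near_rdot e (dilop_linear ha hb) ld nd.
have := @flat_supp_ge _ (dilop a b e) (d e) _ (ltW c0) _.
rewrite rU -re => /(_ _ h)/wrap[].
  apply: ae_filter1 (dilop_indv k) => x ->; rewrite re; case: ifP => // _; exact: ltW.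
rewrite re => h2.
apply: (@le_trans _ _ (mu (supp (d e)))).
  rewrite -(@lee_pmul2l _ (a k / b k)%:E) ?lte_fin// -EFinM.
  by rewrite (_ : a k / b k * (b k * 3 / 4) = a k * 3 / 4)//; field; rewrite gt_eqF.
apply: le_trans (Pd (nn (a k)%:E)); apply: le_Phi; rewrite nnE ?lee_fin ?(ltW (a0 k))// -muA.
exact: mu_supp_indv.
Qed.

End DilationLower.

Lemma halving_small (e : R) (u : nat -> R) : halving u -> 0 < e -> exists n, u n <= e.
Proof.
move=> [u0 uh] e0.
have le_geo n : u n <= geometric (u 0%N) 2^-1 n.
  elim: n => [|n IH] /=; first by rewrite expr0 mulr1.
  by have := uh n; move: IH; rewrite /= exprS; lra.
have : geometric (u 0%N) 2^-1 @ \oo --> (0 : R).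
  by apply: cvg_geometric; rewrite ger0_norm// invf_lt1// ltr1n.
move=> /cvgrPdist_le/(_ _ e0)[n _ /(_ n (leqnn n))] h; exists n.
apply: le_trans (le_geo n) _; apply: le_trans h; rewrite sub0r normrN; exact: ler_norm.
Qed.

Lemma Phi_small_of_supp (d : L2 R -> L2 R) (u C : nat -> R) : halving u ->
  (forall n, 0 <= C n) ->
  (forall xi n, (mu (supp (d xi)) <= (2 * u n)%:E + (C n)%:E * mu (supp xi))%E) ->
  forall e : R, 0 < e -> exists2 t : R, 0 < t & (Phi d (nn t%:E) <= e%:E)%E.
Proof.
move=> hu C0 h e e0.
have e4 : 0 < e / 4 by rewrite divr_gt0.
have [n un] := halving_small hu e4.
(* The first term is at most e/2 since u n <= e/4, and this argument makes the second at most e/2;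
   the summand 1 covers [C n = 0]. *)
exists (e / (2 * (C n + 1))); first by rewrite divr_gt0// mulr_gt0// ltr_wpDl.
  apply: Phi_le => xi; rewrite nnE; last by rewrite lee_fin divr_ge0 ?mulr_ge0 ?addr_ge0// ltW.
  move=> hxi; apply: le_trans (h xi n) _.
  apply: (@le_trans _ _ ((2 * u n)%:E + (C n)%:E * (e / (2 * (C n + 1)))%:E)%E).
    by apply: leeD => //; apply: lee_wpmul2l => //; rewrite lee_fin.
  rewrite -EFinM -EFinD lee_fin.
  have : C n * (e / (2 * (C n + 1))) <= e / 2.
    rewrite mulrA ler_pdivrMr ?mulr_gt0 ?ltr_wpDl//.
    have := C0 n; nra.
  by lra.
Qed.

Lemma B_fam_dilop (a b : nat -> R) : halving a -> halving b ->
  B_fam (@ICOD0bdd R) (dilop a b).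
Proof.
move=> ha' hb'; have ha := halving_scale ha'; have hb := halving_scale hb'.
have a0 k : 0 < a k by case: ha.
have b0 k : 0 < b k by case: hb.
have bU := dilop_bounded ha hb; have [bV _] := adjoint_spec bU.
have C1 n : 0 <= \sum_(k < n) (a k / b k)^-1.
  by apply: sumr_ge0 => k _; rewrite invr_ge0 divr_ge0// ltW.
have C2 n : 0 <= \sum_(k < n) (a k / b k).
  by apply: sumr_ge0 => k _; rewrite divr_ge0// ltW.
have s1 := Phi_small_of_supp hb' C1 (fun xi n => dilop_supp ha hb xi n hb').
have s2 := Phi_small_of_supp ha' C2 (fun xi n => dilop_adjoint_supp ha hb xi n ha').
(* With n = 0 the sum is empty, and the support bound no longer depends on [xi]. *)
have bd1 : (Phi (dilop a b) (nn +oo) <= (2 * b 0%N)%:E)%E.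
  apply: Phi_le => xi _; apply: le_trans (dilop_supp ha hb xi 0 hb') _.
  by rewrite big_ord0 mul0e adde0.
have bd2 : (Phi (adjoint (dilop a b)) (nn +oo) <= (2 * a 0%N)%:E)%E.
  apply: Phi_le => xi _; apply: le_trans (dilop_adjoint_supp ha hb xi 0 ha') _.
  by rewrite big_ord0 mul0e adde0.
have [g1 [G1 p1 l1]] := Phi_majorant bU s1.
have [g2 [G2 p2 l2]] := Phi_majorant bV s2.
exists (fn_add g1 g2).
  split; first exact: ICOD0_add.
  by apply: ICODbdd_add; apply/ICODbddP; split;
    [case: G1|exists (2 * b 0%N); exact: le_trans bd1|case: G2|exists (2 * a 0%N); exact: le_trans bd2].
split=> // x.
  by apply: le_trans (p1 x) _; rewrite /= leeDl.
by apply: le_trans (p2 x) _; rewrite /= leeDr.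
Qed.


End LowerBounds.

(** * Spreading small supports *)

Section SpreadingOperator.
Variable R : realType.
Local Notation mu := (@lebesgue_measure R).
Local Notation Re := (@complex.Re R).
Local Notation Im := (@complex.Im R).
Local Notation fn := ({nonneg \bar R} -> {nonneg \bar R}).
Implicit Types (xi eta zeta : L2 R).

Variables (a : nat -> R) (f : nat -> L2 R).
Hypothesis ha : halving a.
Hypothesis ff : forall j k, rdot (f j) (f k) = (j == k)%:R.
Hypothesis fif : forall j k, rdot (f j) ('i%C *: f k) = 0.
Hypothesis f2 : forall k, ae (fun x => abs2 (f k x) <= 2).
Hypothesis f01 : forall k, ae (fun x => `[0, 1]%classic x \/ f k x = 0).

Let a0 k : 0 < a k. Proof. by case: ha. Qed.
Let A k := dyad (a k).
Let mA k : measurable (A k). Proof. exact: measurable_dyad. Qed.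
Let tA : trivIset setT A. Proof. exact: trivIset_halving. Qed.
Let muA k : mu (A k) = (a k)%:E. Proof. by rewrite mu_dyad// ltW. Qed.

(** The complex inner product of [eta] with [f k]; [ff] and [fif] together state orthonormality for
    it. *)
Definition coef k eta : R[i] := Complex (rdot eta (f k)) (rdot eta ('i%C *: f k)).

Lemma coef_linear k (s : R[i]) eta zeta :
  coef k (s *: eta + zeta) = s * coef k eta + coef k zeta.
Proof.
have cE (c : R[i]) xi : c *: xi = (Re c)%:C%C *: xi + (Im c)%:C%C *: ('i%C *: xi).
  rewrite scalerA -scalerDl; congr (_ *: _); case: c => p q /=.
  by apply/eqP; rewrite eq_complex /= !(mul0r, mulr0, mulr1, addr0, add0r, subr0) !eqxx.
have dE xi : rdot ('i%C *: eta) xi = - rdot eta ('i%C *: xi).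
  have ci : ('i%C)^*%C = - 'i%C :> R[i].
    by apply/eqP; rewrite eq_complex /= oppr0 !eqxx.
  by rewrite rdot_conj ci scaleNr rdotNr.
have iiE : 'i%C *: ('i%C *: f k) = - f k.
  by rewrite scalerA -expr2 sqr_i scaleN1r.
apply/eqP; rewrite eq_complex /coef !rdotDl (cE s) !rdotDl !rdotZl !dE iiE rdotNr opprK.
case: s => p q /=; apply/andP; split; apply/eqP; ring.
Qed.

Lemma coef_f j k : coef k (f j) = (j == k)%:R.
Proof.
by rewrite /coef ff fif; apply/eqP; rewrite eq_complex; case: (j == k); rewrite /= !eqxx.
Qed.

Lemma Bessel eta n : \sum_(k < n) abs2 (coef k eta) <= rdot eta eta.
Proof.
(* [v n] is what remains of [eta] after its first n coefficients are removed; its squared norm is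
   the difference of the two sides. *)
pose fix v n := if n is m.+1 then v m - coef m eta *: f m else eta.
have cv m k : (m <= k)%N -> coef k (v m) = coef k eta.
  elim: m => [//|m IH] mk /=.
  rewrite addrC -scaleNr coef_linear coef_f IH; last exact: ltnW.
  by rewrite (ltn_eqF mk) mulr0 add0r.
have vv : rdot (v n) (v n) = rdot eta eta - \sum_(k < n) abs2 (coef k eta).
  elim: n => [|m IH]; first by rewrite big_ord0 subr0.
  rewrite big_ord_recr /= rdotBl !rdotBr IH.
  set c := coef m eta.
  have h1 : rdot (v m) (c *: f m) = abs2 c.
    have -> : c *: f m = (Re c)%:C%C *: f m + (Im c)%:C%C *: ('i%C *: f m).
      rewrite scalerA -scalerDl; congr (_ *: _); case: (c) => p q /=.
      by apply/eqP; rewrite eq_complex /= !(mul0r, mulr0, mulr1, addr0, add0r, subr0) !eqxx.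
    rewrite rdotDr !rdotZr.
    have := cv m m (leqnn m); rewrite -/c /coef => cE.
    by rewrite /abs2 -cE /= !expr2.
  have h2 : rdot (c *: f m) (c *: f m) = abs2 c.
    rewrite rdot_conj scalerA.
    have -> : c^*%C * c = (abs2 c)%:C%C.
      by case: (c) => p q; apply/eqP; rewrite eq_complex /= /abs2 /=; apply/andP; split; apply/eqP; ring.
    by rewrite rdotZr ff eqxx mulr1.
  by rewrite (rdotC _ (v m)) h1 h2; ring.
by have := rdot_ge0 (v n); rewrite vv; lra.
Qed.

(** The weight normalizes the indicator of [A k], so that Bessel's inequality bounds the norm of the
    assembled function. *)
Definition spread_piece eta k (x : R) : R[i] := (Num.sqrt (a k)^-1)%:C%C * coef k eta.

Definition spread_fun eta : R -> R[i] := piecewise A (spread_piece eta).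

Definition spreadop eta : L2 R := toL2 (spread_fun eta).

Lemma spread_piece_measurable eta k : measurable_fun setT (Re \o spread_piece eta k) /\
  measurable_fun setT (Im \o spread_piece eta k).
Proof. by split; exact: measurable_cst. Qed.

Lemma integral_spread eta :
  (\int[mu]_x (abs2 (spread_fun eta x))%:E <= (rdot eta eta)%:E)%E.
Proof.
rewrite integral_abs2_piecewise//; last 2 first.
- by move=> k; case: (spread_piece_measurable eta k).
- by move=> k; case: (spread_piece_measurable eta k).
apply: lime_le.
  by apply: is_cvg_nneseries => k _ _; apply: integral_ge0 => x _; rewrite lee_fin abs2_ge0.
apply: nearW => n.
have E k : (\int[mu]_(x in A k) (abs2 (spread_piece eta k x))%:E = (abs2 (coef k eta))%:E)%E.
  transitivity ((abs2 (spread_piece eta k 0%R))%:E * mu (A k))%E.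
    by rewrite -integral_cst//; exact: mA.
  rewrite muA -EFinM; congr EFin.
  rewrite /spread_piece /abs2 Defs.ReM Defs.ImM /= !mul0r subr0 addr0.
  rewrite !exprMn sqr_sqrtr ?invr_ge0 ?(ltW (a0 k))//.
  by field; rewrite gt_eqF.
under eq_bigr do rewrite E.
by rewrite sumEFin lee_fin big_mkord; exact: Bessel.
Qed.

Lemma spread_sq_integrable eta : spread_fun eta \in @sq_integrable R.
Proof.
have [mr mi] : measurable_fun setT (Re \o spread_fun eta) /\ measurable_fun setT (Im \o spread_fun eta).
  by apply: piecewise_measurable => // k; case: (spread_piece_measurable eta k).
apply/sq_integrable_abs2; split => //.
by apply: le_lt_trans (integral_spread eta) _; rewrite ltry.
Qed.

Lemma spreadE eta : ae (fun x => spreadop eta x = spread_fun eta x).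
Proof. exact: toL2E (spread_sq_integrable eta). Qed.

Lemma spreadop_linear : linear spreadop.
Proof.
move=> s xi eta; apply: L2_aeP.
have h1 := spreadE (s *: xi + eta).
have h2 : ae (fun x => L2_fun (s *: spreadop xi + spreadop eta) x =
    s * spread_fun xi x + spread_fun eta x).
  have e1 := L2_addE (s *: spreadop xi) (spreadop eta); have e2 := L2_scaleE s (spreadop xi).
  have e5 : ae (fun x => L2_fun (s *: spreadop xi) x = s * spread_fun xi x).
    by apply: ae_filter2 e2 (spreadE xi) => x -> ->.
  have e6 : ae (fun x => L2_fun (s *: spreadop xi) x + spreadop eta x =
      s * spread_fun xi x + spread_fun eta x).
    by apply: ae_filter2 e5 (spreadE eta) => x -> ->.
  by apply: ae_filter2 e1 e6 => x -> ->.
apply: ae_filter2 h1 h2 => x -> ->.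
rewrite /spread_fun; have [[k Bk]|nB] := pselect (exists k, A k x).
  by rewrite !(piecewiseE tA _ Bk) /spread_piece coef_linear mulrDr mulrCA.
by rewrite !piecewise_out ?mulr0 ?addr0// => k Bk; apply: nB; exists k.
Qed.

Lemma spreadop_bounded : bounded_ops spreadop.
Proof.
apply: (@bounded_ops_rdot _ _ spreadop_linear 1) => // xi.
rewrite mul1r -lee_fin rdotxxE; apply: le_trans (integral_spread xi).
rewrite le_eqVlt; apply/orP; left; apply/eqP; apply: ae_eq_integral => //.
- exact: measurable_abs2_L2.
- have /sq_integrable_abs2[mr mi _] := spread_sq_integrable xi.
  exact: measurable_abs2.
- by apply: ae_filter1 (spreadE xi) => x /= -> _.
Qed.

Lemma spreadop_supp xi : (mu (supp (spreadop xi)) <= (2 * a 0%N)%:E)%E.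
Proof.
pose J : set R := `[0, 2 * a 0%N]%classic.
have mJ : measurable J by exact: measurable_itv.
apply: (@le_trans _ _ (mu J)); last first.
  rewrite /J lebesgue_measure_itv/= lte_fin; case: ifP => _; first by rewrite -EFinB subr0.
  by rewrite lee_fin mulr_ge0// ltW.
apply: le_mu_supp => //; apply: ae_filter1 (spreadE xi) => x -> hx.
have [[k Bk]|nB] := pselect (exists k, A k x); last first.
  by move: hx; rewrite /spread_fun piecewise_out ?eqxx// => k Bk; apply: nB; exists k.
move: Bk; rewrite /J /A /dyad /= !in_itv/= => /andP[h1 h2].
rewrite (le_trans (ltW (a0 k)) h1)/=; apply: (le_trans (ltW h2)).
rewrite ler_pM2l//; case: k h1 h2 => // k _ _.
by have := halving_le ha (ltn0Sn k); have := a0 k.+1; lra.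
Qed.

(** A vector vanishing on [0, 1] has all coefficients zero, so [spreadop] kills it, and
    [adjoint_supp] applies with [W] the unit interval. *)
Lemma spreadop_adjoint_supp eta : (mu (supp (adjoint spreadop eta)) <= 1)%E.
Proof.
pose J : set R := `[0, 1]%classic.
have mJ : measurable J by exact: measurable_itv.
apply: (@le_trans _ _ (mu J)); last first.
  by rewrite /J lebesgue_measure_itv/= lte_fin ltr01 -EFinB subr0.
apply: le_mu_supp => //; apply: adjoint_supp => //; first exact: spreadop_bounded.
move=> xi hxi.
have c0 k : coef k xi = 0.
  have h1 : rdot xi (f k) = 0.
    apply: rdot_ae0; apply: ae_filter2 hxi (f01 k) => x; rewrite /rdotf => h [/h ->|->].
      by rewrite !mul0r addr0.
    by rewrite !mulr0 addr0.
  have h2 : rdot xi ('i%C *: f k) = 0.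
    have h3 : ae (fun x => `[0, 1]%classic x \/ L2_fun ('i%C *: f k) x = 0).
      apply: ae_filter2 (f01 k) (L2_scaleE 'i%C (f k)) => x [|]; first by left.
      by move=> -> ->; right; rewrite mulr0.
    apply: rdot_ae0; apply: ae_filter2 hxi h3 => x; rewrite /rdotf => h [/h ->|->].
      by rewrite !mul0r addr0.
    by rewrite !mulr0 addr0.
  by rewrite /coef h1 h2.
apply: rdot_ae0; apply: ae_filter1 (spreadE xi) => x; rewrite /rdotf => ->.
suff -> : spread_fun xi x = 0 by rewrite !mul0r addr0.
rewrite /spread_fun; have [[k Bk]|nB] := pselect (exists k, A k x).
  by rewrite (piecewiseE tA _ Bk) /spread_piece c0 mulr0.
by rewrite piecewise_out// => k Bk; apply: nB; exists k.
Qed.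

(* [spreadop] is [eta |-> sum_k <eta, f_k> e_k]; only its adjoint spreads
   supports. *)
Lemma spreadop_adjoint_indv k :
  adjoint spreadop (indv (A k)) = (Num.sqrt (a k))%:C%C *: f k.
Proof.
have Aoo : (mu (A k) < +oo)%E by rewrite muA ltry.
have [_ hT] := adjoint_spec spreadop_bounded.
have key xi : rdot xi (adjoint spreadop (indv (A k))) = rdot xi ((Num.sqrt (a k))%:C%C *: f k).
  rewrite -hT rdotZr.
  pose t := Num.sqrt (a k)^-1 * rdot xi (f k).
  transitivity (\int[mu]_x (if x \in A k then t else 0)).
    apply: rdot_ae; first by apply: measurable_fun_ifT => //; exact: measurable_mem.
    apply: ae_filter2 (spreadE xi) (indvE (mA k) Aoo) => x; rewrite /rdotf => -> ->.
    case: ifPn => [/set_mem Ax|_]; last by rewrite !mulr0 addr0.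
    by rewrite /spread_fun (piecewiseE tA _ Ax) /spread_piece Defs.ReM /= mul0r subr0 mulr1 mulr0 addr0.
  transitivity (\int[mu]_(x in A k) t).
    rewrite [RHS]Rintegral_mkcond; apply: eq_Rintegral => x _; rewrite patchE.
    by case: ifP.
  transitivity (t * fine (mu (A k))); first by rewrite -Rintegral_cst//; exact: mA.
  rewrite muA /= /t sqrtrV ?(ltW (a0 k))//.
  rewrite mulrAC; congr (_ * _); rewrite -[X in _ * X]sqr_sqrtr ?(ltW (a0 k))//.
  by field; rewrite gt_eqF// sqrtr_gt0.
apply/eqP; rewrite -subr_eq0; apply/eqP/rdot_eq0.
by rewrite rdotBr !key subrr.
Qed.

(** The image of the indicator of [A k] has squared norm a k and squared modulus at most 2 a k, so a
    close vector has a support of measure at least (3/4) / 2, whatever k is. *)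
Lemma C_fam_spread_lower (F : set fn) : C_fam F (adjoint spreadop) ->
  exists2 g, F g & forall k, ((3 / 8)%:E <= fv g (a k)%:E)%E.
Proof.
move=> CU; have [|g [d [Fg [bd Pd _] nd]]] := C_fam_near CU (_ : 0 < 2^-1).
  by rewrite invr_gt0.
exists g => // k; have [ld _] := bd.
have Aoo : (mu (A k) < +oo)%E by rewrite muA ltry.
have [[lT _] _] := adjoint_spec spreadop_bounded.
set e := indv (A k).
have re : rdot e e = a k by apply: EFin_inj; rewrite rdot_indv.
have := near_rdot e lT ld nd; rewrite spreadop_adjoint_indv re.
set u : L2 R := _ *: f k => h.
have ru : rdot u u = a k.
  by rewrite /u rdotZl rdotZr ff eqxx mulr1 -expr2 sqr_sqrtr// ltW.
have u2 : ae (fun x => abs2 (L2_fun u x) <= 2 * a k).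
  apply: ae_filter2 (f2 k) (L2_scaleE (Num.sqrt (a k))%:C%C (f k)) => x h2 ->.
  rewrite /abs2 Defs.ReM Defs.ImM /= !mul0r subr0 addr0.
  rewrite !exprMn sqr_sqrtr ?(ltW (a0 k))// -mulrDr mulrC.
  by rewrite ler_pM2r.
have a20 : 0 <= 2 * a k by rewrite mulr_ge0// ltW.
have := @flat_supp_ge _ u (d e) _ a20 u2; rewrite ru => /(_ h) h2.
apply: (@le_trans _ _ (mu (supp (d e)))).
  rewrite -(@lee_pmul2l _ (2 * a k)%:E) ?lte_fin ?mulr_gt0// -EFinM.
  by rewrite (_ : 2 * a k * (3 / 8) = a k * 3 / 4)//; field.
apply: le_trans (Pd (nn (a k)%:E)); apply: le_Phi; rewrite nnE ?lee_fin ?(ltW (a0 k))// -muA.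
exact: mu_supp_indv.
Qed.

Lemma B_fam_spread : B_fam (@ICODbdd R) (adjoint spreadop).
Proof.
have bT := spreadop_bounded; have [bV _] := adjoint_spec bT.
(* A common bound for the supports of [spreadop] (at most 2 a 0) and of its adjoint (at most 1). *)
pose c := 2 * a 0%N + 1.
have c0 : 0 <= c by rewrite addr_ge0// mulr_ge0// ltW.
have cE : (0 <= c%:E)%E by rewrite lee_fin.
have jc := icod_jump cE.
have E x : (0 <= x)%E -> fv (fn_of (fun x => if x == 0%E then 0%E else c%:E)) x =
    if x == 0%E then 0%E else c%:E.
  by move=> x0; rewrite fv_fn_of//; case: ifP.
have key d : bounded_ops d -> (forall xi, (mu (supp (d xi)) <= c%:E)%E) ->
   forall x, (Phi d x <= (fn_of (fun x => if x == 0%E then 0%E else c%:E) x)%:num)%E.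
  move=> [ld _] hd x; rewrite -fvE E//; case: eqP => [x0|_].
    by rewrite Phi0// (L2_lin0 ld).
  by apply: Phi_le => xi _; exact: hd.
exists (fn_of (fun x => if x == 0%E then 0%E else c%:E)).
  apply/ICODbddP; split; first exact: ICOD_fn_of.
  by exists c; rewrite E// leey.
split; [exact: bV| |].
  apply: key; first exact: bV.
  move=> xi; apply: le_trans (spreadop_adjoint_supp xi) _.
  by rewrite lee_fin lerDr mulr_ge0// ltW.
rewrite (adjointK bT); apply: key; first exact: bT.
move=> xi; apply: le_trans (spreadop_supp xi) _.
by rewrite lee_fin lerDl.
Qed.

End SpreadingOperator.

(** * Orthonormal cosines on the unit interval *)

Section Cos.
Variable R : realType.
Local Notation mu := (@lebesgue_measure R).

Lemma is_derive_sin_lin (w x : R) : w != 0 ->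
  is_derive x 1 (fun y => w^-1 * sin (w * y)) (cos (w * x)).
Proof.
move=> w0.
have h1 : is_derive x 1 (fun y : R => w * y) w.
  have -> : (fun y : R => w * y) = w \*: (id : R -> R) by [].
  apply: is_derive_eq. by rewrite /GRing.scale /= mulr1.
have h2 : is_derive x 1 (fun y => sin (w * y)) (cos (w * x) * w).
  have := @is_derive1_comp R (@sin R) (fun y => w * y) x _ _ (is_derive_sin (w * x)) h1.
  done.
have -> : (fun y => w^-1 * sin (w * y)) = w^-1 \*: (fun y => sin (w * y)) by [].
apply: is_derive_eq. by rewrite /GRing.scale /= mulrC mulfK.
Qed.


Lemma continuous_cos_lin (w : R) : continuous (fun x => cos (w * x)).
Proof.
move=> x; apply: (@continuous_comp _ _ _ (fun x => w * x) (@cos R)).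
  by apply: continuousM; [exact: cst_continuous|exact: cvg_id].
exact: continuous_cos.
Qed.

Lemma integral_cos_lin (w : R) : w != 0 -> sin w = 0 ->
  (\int[mu]_(x in `[0%R, 1%R]) (cos (w * x))%:E = 0)%E.
Proof.
move=> w0 sw; pose F x := w^-1 * sin (w * x).
have dF (x : R) : is_derive x 1 F (cos (w * x)) := is_derive_sin_lin x w0.
have cF : continuous F.
  move=> x; apply: differentiable_continuous; apply/derivable1_diffP.
  by case: (dF x).
rewrite (@continuous_FTC2 _ (fun x => cos (w * x)) F)//.
- by rewrite /F mulr1 sw !mulr0 sin0 mulr0 -EFinB subrr.
- exact/continuous_subspaceT/continuous_cos_lin.
- split.
  + by move=> x _; case: (dF x).
  + by apply: cvg_at_right_filter; exact: cF.
  + by apply: cvg_at_left_filter; exact: cF.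
- by move=> x _; rewrite derive1E; case: (dF x).
Qed.

Let w (k : nat) : R := pi *+ 2 *+ k.

Lemma sin_w k : sin (w k) = 0.
Proof. by rewrite /w -[_ *+ k]add0r (periodicn (@sinD2pi R)) sin0. Qed.

Lemma integral_cos_nat (k : nat) : (0 < k)%N ->
  (\int[mu]_(x in `[0%R, 1%R]) (cos (w k * x))%:E = 0)%E.
Proof.
move=> k0; apply: integral_cos_lin; last exact: sin_w.
rewrite /w gt_eqF// pmulrn_lgt0// pmulrn_lgt0// . exact: pi_gt0.
Qed.

(** The frequency starts at [w 1]: the constant function of frequency 0 would need another
    normalization than the factor [Num.sqrt 2]. *)
Definition cosf (k : nat) (x : R) : R[i] :=
  if x \in `[0, 1]%classic then (Num.sqrt 2 * cos (w k.+1 * x))%:C%C else 0.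

Definition cosv k : L2 R := toL2 (cosf k).

Lemma abs2_cosf k x : abs2 (cosf k x) <= if x \in `[0, 1]%classic then 2 else 0.
Proof.
rewrite /cosf; case: ifP => _; last by rewrite /abs2/= expr0n/= addr0.
rewrite /abs2/= expr0n/= addr0 exprMn sqr_sqrtr// ger_pMr//.
Qed.

Lemma measurable_cosf k : measurable_fun setT (@complex.Re R \o cosf k) /\
  measurable_fun setT (@complex.Im R \o cosf k).
Proof.
split.
  rewrite (_ : _ \o _ = fun x => if x \in `[0, 1]%classic then Num.sqrt 2 * cos (w k.+1 * x) else 0).
    apply: measurable_fun_ifT => //; first by apply: measurable_mem; exact: measurable_itv.
    apply: measurable_funM => //; apply: continuous_measurable_fun.
    exact: continuous_cos_lin.
  by apply/funext => x; rewrite /cosf /=; case: ifP.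
rewrite (_ : _ \o _ = cst 0) //.
by apply/funext => x; rewrite /cosf /=; case: ifP.
Qed.

Lemma cosvE k : ae (fun x => cosv k x = cosf k x).
Proof.
have [mr mi] := measurable_cosf k.
have mI : measurable (`[0, 1]%classic : set R) by exact: measurable_itv.
apply: toL2E; apply/sq_integrable_abs2; split => //.
apply: (@le_lt_trans _ _ (\int[mu]_x (if x \in `[0%R, 1%R]%classic then 2 else 0)%:E)%E).
  apply: ge0_le_integral => //.
  - by move=> x _; rewrite lee_fin abs2_ge0.
  - exact: measurable_abs2.
  - by apply/measurable_EFinP; apply: measurable_fun_ifT => //; exact: measurable_mem.
  - by move=> x _; rewrite lee_fin abs2_cosf.
rewrite integral_if_mem// lebesgue_measure_itv/= lte_fin ltr01 -EFinB -EFinM.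
by rewrite ltry.
Qed.

Lemma cosv_bound k : ae (fun x => abs2 (cosv k x) <= 2).
Proof.
apply: ae_filter1 (cosvE k) => x ->; apply: le_trans (abs2_cosf k x) _.
by case: ifP.
Qed.

Lemma cosv_out k : ae (fun x => `[0, 1]%classic x \/ cosv k x = 0).
Proof.
apply: ae_filter1 (cosvE k) => x ->; rewrite /cosf.
by case: ifPn => [/set_mem|]; [left|right].
Qed.

Lemma rdot_cosv_i j k : rdot (cosv j) ('i%C *: cosv k) = 0.
Proof.
apply: rdot_ae0.
have h : ae (fun x => L2_fun ('i%C *: cosv k) x = 'i%C * cosf k x).
  by apply: ae_filter2 (L2_scaleE 'i%C (cosv k)) (cosvE k) => x -> ->.
apply: ae_filter2 (cosvE j) h => x; rewrite /rdotf => -> ->.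
rewrite Defs.ReM Defs.ImM /cosf; case: ifP => _ /=; ring.
Qed.

Lemma rdot_cosv j k : rdot (cosv j) (cosv k) = (j == k)%:R.
Proof.
wlog jk : j k / (j <= k)%N.
  move=> h; have [|/ltnW] := leqP j k; first exact: h.
  by move=> /h; rewrite rdotC eq_sym.
have mI : measurable (`[0, 1]%classic : set R) by exact: measurable_itv.
(* Product-to-sum formula, its factor 2 coming from the normalization. As j <= k, the subtraction is
   not truncated and vanishes only on the diagonal; the frequency j + k + 2 never does. *)
pose g (x : R) : R := cos (w (k - j) * x) + cos (w (j.+1 + k.+1) * x).
have -> : rdot (cosv j) (cosv k) = \int[mu]_(x in `[0, 1]) g x.
  have cg : continuous g.
    by move=> x; apply: continuousD; exact: continuous_cos_lin.
  rewrite Rintegral_mkcond; apply: rdot_ae.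
    by apply/(measurable_restrictT _ mI); apply: measurable_funTS; exact: continuous_measurable_fun.
  apply: ae_filter2 (cosvE j) (cosvE k) => x; rewrite /rdotf patchE => -> ->.
  rewrite /cosf; case: ifP => _ /=; last by rewrite !mulr0 addr0.
  rewrite mulr0 addr0 mulrACA -expr2 sqr_sqrtr// /g.
  have -> : w (k - j) * x = w k.+1 * x - w j.+1 * x.
    by rewrite /w -mulrBl -mulrnBr ?ltnS// subSS.
  have -> : w (j.+1 + k.+1) * x = w k.+1 * x + w j.+1 * x.
    by rewrite /w -mulrDl -mulrnDr addnC.
  by rewrite cosB cosD; ring.
have ci (v : R) : mu.-integrable `[0, 1] (EFin \o (fun x => cos (v * x))).
  apply: continuous_compact_integrable; first exact: segment_compact.
  exact/continuous_subspaceT/continuous_cos_lin.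
rewrite /g RintegralD; [|exact: mI|exact: ci|exact: ci].
rewrite [X in _ + X]/Rintegral integral_cos_nat ?addSn//= addr0.
have [<-|jnk] := eqVneq j k.
  rewrite subnn /w mulr0n.
  under eq_Rintegral do rewrite mul0r cos0.
  by rewrite Rintegral_cst//= lebesgue_measure_itv/= lte_fin ltr01 -EFinB/= subr0 mul1r.
rewrite /Rintegral integral_cos_nat// subn_gt0 ltn_neqAle jnk; exact: jk.
Qed.

End Cos.

(** * Inclusions between the algebras *)

Section Poset.
Variable R : realType.
Local Notation mu := (@lebesgue_measure R).
Local Notation fn := ({nonneg \bar R} -> {nonneg \bar R}).
Implicit Types (F G : set fn) (f g h : fn) (a : L2 R -> L2 R).
Local Open Scope ereal_scope.

Lemma B_fun_le f g : (forall x, 0 <= x -> fv g x <= fv f x) -> B_fun g `<=` B_fun f.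
Proof.
move=> gf a [ba Pa Pa']; split; [exact: ba| |] => x.
  by apply: le_trans (Pa x) _; rewrite -!fvE; apply: gf; exact: nonneg_num_ge0.
by apply: le_trans (Pa' x) _; rewrite -!fvE; apply: gf; exact: nonneg_num_ge0.
Qed.

Lemma B_fam_le F G : (forall g, G g -> exists2 f, F f & forall x, 0 <= x -> fv g x <= fv f x) ->
  B_fam G `<=` B_fam F.
Proof. by move=> h a [g /h[f Ff gf] Ba]; exists f => //; exact: (B_fun_le gf). Qed.

Lemma B_fam_bounded F : B_fam F `<=` @bounded_ops R.
Proof. by move=> a [f _ [ba _ _]]; exact: ba. Qed.

Lemma opnorm_subrr a (e : R) : (0 < e)%R -> opnorm (a - a)%R < e%:E.
Proof.
move=> e0; apply: (@le_lt_trans _ _ 0); last by rewrite lte_fin.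
apply: ge_ereal_sup => _ [xi _ <-]; rewrite lee_fin le_L2_norm//.
by rewrite -[(a - a)%R xi]/(a xi - a xi)%R subrr rdot0l expr0n.
Qed.

Lemma B_fam_sub_C_fam F : B_fam F `<=` C_fam F.
Proof.
move=> a Ba; split; first exact: (B_fam_bounded Ba).
by move=> e e0; exists a => //; exact: opnorm_subrr.
Qed.

Lemma C_fam_mono F G : B_fam F `<=` B_fam G -> C_fam F `<=` C_fam G.
Proof.
move=> FG a [ba h]; split; first exact: ba.
by move=> e /h[b Bb hb]; exists b => //; exact: FG.
Qed.

Lemma sub_C_fam F G : F `<=` G -> C_fam F `<=` C_fam G.
Proof. by move=> FG; apply: C_fam_mono => a [f /FG Gf Ba]; exists f. Qed.

Definition has_jump F := exists f (c : R),
  [/\ F f, (0 < c)%R & forall x, 0 < x -> c%:E <= fv f x].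

Definition above_id F := exists2 f, F f & forall x, 0 <= x -> x <= fv f x.

(** Distinguishes the top algebra from that of ICODfin; the argument is a real number, since an
    infinite value at +oo alone is allowed in ICODfin. *)
Definition has_oo F := exists f (x : R), [/\ F f, (0 <= x)%R & fv f x%:E = +oo].

Lemma admissible_nsum F f n : admissible F -> F f ->
  exists2 g, F g & forall x, fv g x = n.+1%:R%:E * fv f x.
Proof.
move=> [_ _ Fadd _] Ff; elim: n => [|n [g Fg gE]].
  by exists f => // x; rewrite mul1e.
exists (fn_add f g); first exact: Fadd.
move=> x; rewrite fv_add gE -[X in X + _]mul1e -ge0_muleDl ?lee_fin// -EFinD.
Qed.

Lemma admissible_fv_incr F f x y : admissible F -> F f -> 0 <= x -> x <= y ->
  fv f x <= fv f y.
Proof. by move=> [_ FI _ _] /FI/incrP; apply. Qed.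

Lemma exists_nat_gt (x : R) : exists n, (x <= n.+1%:R)%R.
Proof. by exists (Num.truncn x); rewrite ltW// truncnS_gt. Qed.

Lemma ICOD0_majorant a : bounded_ops a ->
  (forall e : R, (0 < e)%R -> exists2 t : R, (0 < t)%R & Phi a (nn t%:E) <= e%:E) ->
  (forall e : R, (0 < e)%R -> exists2 t : R, (0 < t)%R & Phi (adjoint a) (nn t%:E) <= e%:E) ->
  exists g, [/\ ICOD0 g, B_fun g a &
    fv g +oo <= Phi a (nn +oo) + Phi (adjoint a) (nn +oo)].
Proof.
move=> ba s1 s2; have [bV _] := adjoint_spec ba.
have [g1 [G1 p1 l1]] := Phi_majorant ba s1.
have [g2 [G2 p2 l2]] := Phi_majorant bV s2.
exists (fn_add g1 g2); split; first exact: ICOD0_add.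
  split; [exact: ba| |] => x.
    by apply: le_trans (p1 x) _; rewrite /= leeDl.
  by apply: le_trans (p2 x) _; rewrite /= leeDr.
by rewrite fv_add; apply: leeD.
Qed.

Lemma no_jump_small F f : admissible F -> ~ has_jump F -> F f ->
  forall e : R, (0 < e)%R -> exists2 t : R, (0 < t)%R & fv f t%:E <= e%:E.
Proof.
move=> aF nj Ff e e0; apply: contrapT => h; apply: nj; exists f, e; split => //.
have ht (t : R) : (0 < t)%R -> e%:E <= fv f t%:E.
  by move=> t0; rewrite leNgt; apply/negP => /ltW ft; apply: h; exists t.
case=> [t t0|_|//]; first by apply: ht; rewrite -lte_fin.
apply: le_trans (ht 1%R ltr01) _.
by apply: (admissible_fv_incr aF Ff); rewrite ?lee_fin ?leey.
Qed.

Lemma no_jump_Phi_small F a f : admissible F -> ~ has_jump F -> F f -> B_fun f a ->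
  forall e : R, (0 < e)%R ->
    (exists2 t : R, (0 < t)%R & Phi a (nn t%:E) <= e%:E) /\
    (exists2 t : R, (0 < t)%R & Phi (adjoint a) (nn t%:E) <= e%:E).
Proof.
move=> aF nj Ff [_ Pa Pa'] e e0; have [t t0 ft] := no_jump_small aF nj Ff e0.
by split; exists t => //; apply: le_trans ft.
Qed.

Lemma no_jump_B_fam F : admissible F -> ~ has_jump F -> B_fam F `<=` B_fam (@ICOD0 R).
Proof.
move=> aF nj a [f Ff Ba]; have [ba _ _] := Ba.
have sm := no_jump_Phi_small aF nj Ff Ba.
have [||g [Gg Bg _]] := @ICOD0_majorant a ba.
- by move=> e /sm[].
- by move=> e /sm[].
by exists g.
Qed.

Lemma not_above_id_bound F a f : admissible F -> ~ above_id F -> F f -> B_fun f a ->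
  exists s : R, (0 <= s)%R /\ forall xi,
    mu (supp (a xi)) <= s%:E /\ mu (supp (adjoint a xi)) <= s%:E.
Proof.
move=> aF nid Ff Ba; have [ba _ _] := Ba; have [_ FI _ Fcomp] := aF.
have [s s0 hs] : exists2 s : R, (0 <= s)%R & fv f (fv f s%:E) < s%:E.
  (* The composite [f \o f] also belongs to [F], so it fails to dominate the identity somewhere. *)
  have [x [x0 hx]] : exists x, 0 <= x /\ fv (f \o f) x < x.
    apply: contrapT => h; apply: nid; exists (f \o f); first exact: Fcomp.
    by move=> x x0; rewrite leNgt; apply/negP => hx; apply: h; exists x.
  rewrite (fv_comp f f) in hx; case: x x0 hx => [x x0 hx|_ hx|//]; first by exists x.
  (* A failure at +oo moves to a finite point: if r = f(f(+oo)) is finite, then s = r + 1 satisfies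
     f(f(s)) <= r < s. *)
  have := fv_ge0 f (fv f +oo); case E : (fv f (fv f +oo)) hx => [r|//|//] _ r0.
  exists (r + 1)%R; first by rewrite addr_ge0.
  apply: (@le_lt_trans _ _ r%:E); last by rewrite lte_fin ltrDl.
  rewrite -E; apply: (admissible_fv_incr aF Ff); first exact: fv_ge0.
  by apply: (admissible_fv_incr aF Ff); rewrite ?leey ?lee_fin ?addr_ge0.
have hs' : (f (f (nn s%:E)))%:num < s%:E by move: hs; rewrite /fv nnK.
exists s; split=> // xi; split; last exact: (Phi_adjoint_le (FI _ Ff) Ba s0 hs').
have := Phi_adjoint_le (FI _ Ff) (B_fun_adjoint Ba) s0 hs' xi.
by rewrite (adjointK ba).
Qed.

Lemma Phi_le_jump (c : \bar R) a : linear a -> 0 <= c ->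
  (forall xi, mu (supp (a xi)) <= c) ->
  forall x : {nonneg \bar R}, Phi a x <= (fn_of (fun x => if x == 0 then 0 else c) x)%:num.
Proof.
move=> la c0 h x; rewrite -fvE fv_fn_of; [|exact: nonneg_num_ge0|by case: ifP].
case: eqP => [x0|_]; first by rewrite Phi0// (L2_lin0 la).
by apply: Phi_le => xi _; exact: h.
Qed.

Lemma not_above_id_B_fam F : admissible F -> ~ above_id F ->
  B_fam F `<=` B_fam (@ICODbdd R).
Proof.
move=> aF nid a [f Ff Ba]; have [ba _ _] := Ba.
have [[la _] [[lb _] _]] := (ba, adjoint_spec ba).
have [s [s0 hs]] := not_above_id_bound aF nid Ff Ba.
have sE : 0 <= s%:E by rewrite lee_fin.
exists (fn_of (fun x => if x == 0 then 0 else s%:E)).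
  apply/ICODbddP; split; first exact/ICOD_fn_of/icod_jump.
  by exists s; rewrite fv_fn_of ?leey.
split; first exact: ba.
  by apply: (Phi_le_jump la sE) => xi; case: (hs xi).
by apply: (Phi_le_jump lb sE) => xi; case: (hs xi).
Qed.

Lemma no_jump_not_above_id_B_fam F : admissible F -> ~ has_jump F -> ~ above_id F ->
  B_fam F `<=` B_fam (@ICOD0bdd R).
Proof.
move=> aF nj nid a [f Ff Ba]; have [ba _ _] := Ba.
have sm := no_jump_Phi_small aF nj Ff Ba.
have [s [s0 hs]] := not_above_id_bound aF nid Ff Ba.
have [||g [Gg Bg gs]] := @ICOD0_majorant a ba.
- by move=> e /sm[].
- by move=> e /sm[].
exists g => //; split=> //; apply/ICODbddP; split; first by case: Gg.
exists (s + s)%R; apply: le_trans gs _; rewrite EFinD.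
by apply: leeD; apply: Phi_le => xi _; case: (hs xi).
Qed.

(** Only the finite value f(1) matters: subadditivity with s = 1 bounds [Phi] by f(1) (1 + x), and
    the sum of a jump and a linear function in ICODfin lies above that. *)
Lemma no_oo_B_fam F : admissible F -> ~ has_oo F -> B_fam F `<=` B_fam (@ICODfin R).
Proof.
move=> aF noo a [f Ff Ba]; have [ba Pa Pa'] := Ba.
have [[la _] [bV _]] := (ba, adjoint_spec ba); have [lb _] := bV.
have f1 : fv f 1 < +oo.
  by rewrite ltey; apply/eqP => h; apply: noo; exists f, 1%R.
(* The summand 1 keeps c positive, so that [h2] is +oo at +oo even if f(1) = 0. *)
pose c := (fine (fv f 1) + 1)%R.
have fc : fv f 1 <= c%:E.
  have ffin : fv f 1 \is a fin_num by rewrite ge0_fin_numE// fv_ge0.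
  by rewrite -[leLHS]fineK// lee_fin lerDl.
have c0 : (0 < c)%R by rewrite ltr_wpDl// fine_ge0// fv_ge0.
have cE : 0 <= c%:E by rewrite lee_fin ltW.
pose h1 (x : \bar R) : \bar R := if x == 0 then 0 else c%:E.
pose h2 (x : \bar R) : \bar R := c%:E * x.
have i1 : icod h1 by exact: icod_jump.
have i2 : icod h2 by apply: icod_lin; exact: ltW.
have E1 x : 0 <= x -> fv (fn_of h1) x = h1 x by move=> x0; rewrite fv_fn_of//; exact: icod_ge0.
have E2 x : 0 <= x -> fv (fn_of h2) x = h2 x by move=> x0; rewrite fv_fn_of//; exact: icod_ge0.
have key d : linear d -> (forall x, Phi d x <= (f x)%:num) ->
    forall x, Phi d x <= (fn_add (fn_of h1) (fn_of h2) x)%:num.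
  move=> ld Pd x; rewrite -fvE fv_add E1 ?nonneg_num_ge0// E2 ?nonneg_num_ge0//.
  have [x0|x0] := eqVneq x%:num 0.
    by rewrite Phi0 ?(L2_lin0 ld)// adde_ge0// (icod_ge0 i1, icod_ge0 i2).
  rewrite /h1 (negbTE x0) /h2 -[x]nnK nnE ?nonneg_num_ge0//.
  case: (x%:num) (nonneg_num_ge0 x) x0 => [t t0 tn0|_ _|//]; last first.
    by rewrite gt0_muley ?lte_fin// addeC addye ?leey// -ltNye ltNyr.
  rewrite lee_fin in t0.
  apply: le_trans (Phi_affine_le ld ltr01 t0) _; rewrite divr1.
  have p1 : Phi d (nn 1) <= c%:E by exact: le_trans (Pd (nn 1)) fc.
  by apply: leeD => //; rewrite muleC; apply: lee_wpmul2r; rewrite ?lee_fin.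
exists (fn_add (fn_of h1) (fn_of h2)).
  apply/ICODfinP; split; first by apply: ICOD_add; exact: ICOD_fn_of.
  move=> t t0; rewrite fv_add E1 ?lee_fin// E2 ?lee_fin// /h1 /h2.
  by case: ifP => _; rewrite -EFinM ?add0e -?EFinD ltry.
by split; [exact: ba|exact: key|exact: key].
Qed.

Lemma has_jump_scale F (M : R) : admissible F -> has_jump F ->
  exists2 f, F f & forall x, 0 < x -> M%:E <= fv f x.
Proof.
move=> aF [f [c [Ff c0 hc]]]; have [n hn] := exists_nat_gt (M / c).
have [g Fg gE] := admissible_nsum n aF Ff; exists g => // x x0; rewrite gE.
apply: (@le_trans _ _ (n.+1%:R%:E * c%:E)).
  by rewrite -EFinM lee_fin -ler_pdivrMr.
by apply: lee_wpmul2l; [rewrite lee_fin|exact: hc].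
Qed.

Lemma above_id_scale F (n : nat) : admissible F -> above_id F ->
  exists2 f, F f & forall x, 0 <= x -> n.+1%:R%:E * x <= fv f x.
Proof.
move=> aF [f Ff hf]; have [g Fg gE] := admissible_nsum n aF Ff.
exists g => // x x0; rewrite gE; apply: lee_wpmul2l; first by rewrite lee_fin.
exact: hf.
Qed.

Lemma has_jump_B_fam F : admissible F -> has_jump F -> B_fam (@ICODbdd R) `<=` B_fam F.
Proof.
move=> aF jF; apply: B_fam_le => g /ICODbddP[Ig [M hM]].
have [f Ff hf] := has_jump_scale M aF jF; exists f => // x.
rewrite le_eqVlt => /predU1P[<-|x0]; first by rewrite (ICOD_fv0 Ig) fv_ge0.
apply: le_trans (hf _ x0); apply: le_trans hM.
by apply: ICOD_incr_fv; rewrite ?leey// ltW.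
Qed.

(** By concavity, g(x) <= g(1) + x g(1); a scaled jump dominates the first term and a multiple of
    the identity the second. *)
Lemma has_jump_above_id_B_fam F : admissible F -> has_jump F -> above_id F ->
  B_fam (@ICODfin R) `<=` B_fam F.
Proof.
move=> aF jF idF; apply: B_fam_le => g /ICODfinP[Ig gfin].
pose r := fine (fv g 1).
have rE : fv g 1 = r%:E.
  by rewrite fineK// ge0_fin_numE ?fv_ge0//; exact: gfin.
have [f Ff hf] := has_jump_scale r aF jF.
have [n hn] := exists_nat_gt r.
have [h Fh hh] := above_id_scale n aF idF.
have [_ _ Fadd _] := aF.
exists (fn_add f h); first exact: Fadd.
move=> x; rewrite le_eqVlt => /predU1P[<-|x0]; first by rewrite (ICOD_fv0 Ig) fv_ge0.
rewrite fv_add; case: x x0 => [x x0|_|//]; last first.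
  suff -> : fv h +oo = +oo by rewrite addey ?leey// -ltNye (lt_le_trans ltNy0)// fv_ge0.
  by apply/eqP; rewrite -leye_eq; apply: le_trans (hh _ _); rewrite // gt0_muley// lte_fin.
rewrite lte_fin in x0.
apply: le_trans (ICOD_linear_growth Ig ltr01 (ltW x0)) _; rewrite divr1 rE.
apply: leeD; first exact: hf.
apply: le_trans (hh _ _); last by rewrite lee_fin ltW.
by rewrite muleC; apply: lee_wpmul2r; rewrite lee_fin// ltW.
Qed.

(** A scaled jump lifts every positive argument beyond the point where [f] is infinite, so the
    composite is +oo on (0, oo] and bounds every operator. *)
Lemma has_jump_has_oo_B_fam F : admissible F -> has_jump F -> has_oo F ->
  @bounded_ops R `<=` B_fam F.
Proof.
move=> aF jF [f [x0 [Ff x00 fx0]]] a ba.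
have [[la _] [[lb _] _]] := (ba, adjoint_spec ba).
have [f1 Ff1 hf1] := has_jump_scale x0 aF jF.
have [_ _ _ Fcomp] := aF.
exists (f \o f1); first exact: Fcomp.
have key d : linear d -> forall x, Phi d x <= ((f \o f1) x)%:num.
  move=> ld x; rewrite -fvE (fv_comp f f1).
  have [xz|xz] := eqVneq x%:num 0; first by rewrite Phi0 ?(L2_lin0 ld) ?fv_ge0.
  suff -> : fv f (fv f1 x%:num) = +oo by rewrite leey.
  apply/eqP; rewrite -leye_eq -fx0; apply: (admissible_fv_incr aF Ff).
    by rewrite lee_fin.
  by apply: hf1; rewrite lt_neqAle eq_sym xz nonneg_num_ge0.
by split; [exact: ba|exact: key|exact: key].
Qed.

End Poset.

(** * Separating operators and the classification of the interval *)

Section Covers.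
Variable R : realType.
Local Notation mu := (@lebesgue_measure R).
Local Notation fn := ({nonneg \bar R} -> {nonneg \bar R}).
Implicit Types (F G : set fn) (f g h : fn) (a : L2 R -> L2 R).
Local Open Scope ereal_scope.

Lemma C_fam_id_above_id F : admissible F -> C_fam F id -> above_id F.
Proof.
move=> aF /C_fam_id_lower[f Ff hf].
(* Index 1 means two copies of [f]: doubling compensates for the factor 3/4. *)
have [g Fg gE] := admissible_nsum 1 aF Ff.
have real_le (t : R) : (0 <= t)%R -> t%:E <= fv g t%:E.
  move=> t0; rewrite gE; apply: (@le_trans _ _ (2%:E * (t * 3 / 4)%:E)).
    by rewrite -EFinM lee_fin; lra.
  by apply: lee_wpmul2l; rewrite ?lee_fin//; exact: hf.
exists g => // -[t t0|_|//]; first by apply: real_le; rewrite -lee_fin.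
rewrite leye_eq; apply/eqP/eqyP => t t0.
apply: le_trans (real_le t (ltW t0)) _.
by apply: (admissible_fv_incr aF Fg); rewrite ?leey// lee_fin ltW.
Qed.

Lemma B_fam_id : B_fam (@ICOD0 R) id.
Proof.
have il : icod (fun x : \bar R => 1%:E * x) by exact: icod_lin.
have E x : 0 <= x -> fv (fn_of (fun x => 1%:E * x)) x = x.
  by move=> x0; rewrite fv_fn_of// mul1e.
have bid : bounded_ops (@id (L2 R)).
  by apply: (@bounded_ops_rdot _ _ _ 1%R) => // xi; rewrite mul1r.
have aid : adjoint (@id (L2 R)) = id by apply: adjoint_uniq.
have P x : Phi (@id (L2 R)) x <= (fn_of (fun x => 1%:E * x) x)%:num.
  by rewrite -fvE E ?nonneg_num_ge0//; apply: Phi_le.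
exists (fn_of (fun x => 1%:E * x)).
  apply/ICOD0P; split; first exact: ICOD_fn_of.
  by move=> e e0; exists e => //; rewrite E// lee_fin ltW.
by split; [exact: bid|exact: P|rewrite aid; exact: P].
Qed.

Lemma ICODbdd_not_above_id : ~ above_id (@ICODbdd R).
Proof.
move=> [f /ICODbddP[_ [M hM]] hf].
have : (+oo : \bar R) <= M%:E by apply: le_trans hM; exact: hf.
by rewrite leye_eq.
Qed.

Lemma ICOD0_no_jump : ~ has_jump (@ICOD0 R).
Proof.
move=> [f [c [/ICOD0P[_ f0] c0 hf]]].
have c2 : (0 < c / 2)%R by rewrite divr_gt0.
have [t t0 ft] := f0 _ c2.
have := le_trans (hf t%:E _) ft; rewrite lte_fin lee_fin => /(_ t0).
by lra.
Qed.

Lemma C_fam_ICODbdd_has_jump F : admissible F ->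
  C_fam (@ICODbdd R) `<=` C_fam F -> has_jump F.
Proof.
move=> aF sF.
have hh := halving_exp R.
have := B_fam_spread hh (@rdot_cosv R) (@rdot_cosv_i R) (@cosv_out R).
move=> /B_fam_sub_C_fam /sF.
move=> /(C_fam_spread_lower hh (@rdot_cosv R) (@rdot_cosv_i R) (@cosv_bound R))[f Ff hf].
exists f, (3 / 8)%R; split => //.
have real_le (t : R) : (0 < t)%R -> (3 / 8)%:E <= fv f t%:E.
  move=> t0; have [k hk] := halving_small hh t0.
  apply: le_trans (hf k) _; apply: (admissible_fv_incr aF Ff).
    by rewrite lee_fin exprn_ge0.
  by rewrite lee_fin.
case=> [t t0|_|//]; first by apply: real_le; rewrite -lte_fin.
apply: le_trans (real_le 1%R ltr01) _.
by apply: (admissible_fv_incr aF Ff); rewrite ?leey// lee_fin.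
Qed.

(** The separating operator dilates [2^-k, 2^(1-k)[ onto [2^k, 2^(k+1)[ for all k: near it only
    functions with f(1) >= f(2^-k) >= (3/4) 2^k for every k are possible, so f(1) would be
    infinite. *)
Lemma bounded_ops_not_ICODfin : ~ (@bounded_ops R `<=` C_fam (@ICODfin R)).
Proof.
move=> sF; have ha := halving_scale (halving_exp R); have hb := scale_exp R.
have /sF/(C_fam_dilop_lower ha hb)[f /ICODfinP[If ffin] hf] := dilop_bounded ha hb.
have f1 : forall k, (2 ^+ k * 3 / 4)%:E <= fv f 1.
  move=> k; apply: le_trans (hf k) _; apply: ICOD_incr_fv; first exact: If.
    by rewrite lee_fin exprn_ge0.
  by rewrite lee_fin exprn_ile1// invf_le1// ler1n.
have := ffin 1%R ler01; rewrite ltey => /eqP; apply; apply/eqyP => t t0.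
have [n hn] := exists_nat_gt (2 * t)%R.
apply: le_trans (f1 n.+1); rewrite lee_fin.
have : (n.+1%:R <= 2 ^+ n.+1 :> R)%R by rewrite -natrX ler_nat ltnW// ltn_expl.
by lra.
Qed.

(* With [b_k = 2^-k], the dilation for [a] forces [f (a k) >= (3/4) 2^-k], which
   controls [g] between [a k] and [a k.-1]. *)
Lemma halving_choice g : ICOD0 g -> exists a : nat -> R, halving a /\
  forall k, fv g (a k)%:E <= (2^-1 ^+ k.+1)%:E.
Proof.
move=> /ICOD0P[Ig g0].
have e0 k : (0 < 2^-1 ^+ k :> R)%R by rewrite exprn_gt0.
have /choice[d hd] : forall k, exists t : R, (0 < t)%R /\ fv g t%:E <= (2^-1 ^+ k.+1)%:E.
  by move=> k; have [t t0 gt] := g0 _ (e0 k.+1); exists t.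
pose fix a k := if k is j.+1 then Num.min (d j.+1) (a j / 2)%R else d 0%N.
have a0 k : (0 < a k)%R.
  elim: k => [|k IH] /=; first by case: (hd 0%N).
  by rewrite lt_min divr_gt0// andbT; case: (hd k.+1).
have ad k : (a k <= d k)%R by case: k => [//|k] /=; rewrite ge_min lexx.
exists a; split.
  split=> // k; rewrite /= mulrC -ler_pdivlMr//.
  by rewrite ge_min lexx orbT.
move=> k; have [_] := hd k; apply: le_trans.
by apply: ICOD_incr_fv; rewrite ?lee_fin// ltW.
Qed.

(** [C_fam F] contains the dilations between all halving scales, so [F] dominates any given function
    of ICOD0 near 0; away from 0 a multiple of the identity does. *)
Lemma above_id_B_fam F : admissible F -> above_id F ->
  C_fam (@ICOD0bdd R) `<=` C_fam F -> B_fam (@ICOD0 R) `<=` B_fam F.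
Proof.
move=> aF idF sF; apply: B_fam_le => g Gg; have Ig : ICOD g by case: Gg.
have [a [hla ga]] := halving_choice Gg.
have hlb := halving_exp R.
have ha := halving_scale hla; have hb := halving_scale hlb.
have [a0 _] := ha.
have /B_fam_sub_C_fam/sF/(C_fam_dilop_lower ha hb)[f Ff hf] := B_fam_dilop hla hlb.
have [f2 Ff2 f2E] := admissible_nsum 1 aF Ff.
have [n hn] := exists_nat_gt (a 0%N)^-1.
have [h Fh hh] := above_id_scale n aF idF.
have [_ _ Fadd _] := aF.
exists (fn_add f2 h); first exact: Fadd.
move=> x; rewrite le_eqVlt => /predU1P[<-|x0]; first by rewrite (ICOD_fv0 Ig) fv_ge0.
rewrite fv_add; case: x x0 => [x x0|_|//]; last first.
  suff -> : fv h +oo = +oo by rewrite addey ?leey// -ltNye (lt_le_trans ltNy0)// fv_ge0.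
  by apply/eqP; rewrite -leye_eq; apply: le_trans (hh _ _); rewrite // gt0_muley// lte_fin.
rewrite lte_fin in x0.
(* From a 0 on, concavity gives g(x) <= 1/2 + (x / a 0) / 2 <= x / a 0, which [h] dominates because
   n + 1 >= 1 / a 0. *)
have [ax|xa] := leP (a 0%N) x.
  apply: (@le_trans _ _ (fv h x%:E)); last by rewrite leeDr// fv_ge0.
  apply: le_trans (hh _ _); last by rewrite lee_fin ltW.
  apply: le_trans (ICOD_linear_growth Ig (a0 0%N) (ltW x0)) _.
  apply: (@le_trans _ _ ((2^-1)%:E + (x / a 0%N)%:E * (2^-1)%:E)).
    have g12 : fv g (a 0%N)%:E <= (2^-1)%:E by have := ga 0%N; rewrite expr1.
    apply: leeD => //; apply: lee_wpmul2l => //.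
    by rewrite lee_fin divr_ge0// ltW.
  rewrite -!EFinM -EFinD lee_fin.
  have x1 : (1 <= x / a 0%N)%R by rewrite ler_pdivlMr// mul1r.
  apply: (@le_trans _ _ (x / a 0%N)%R); first by lra.
  by rewrite mulrC ler_wpM2r// ltW.
apply: (@le_trans _ _ (fv f2 x%:E)); last by rewrite leeDl// fv_ge0.
have ex : exists k, (a k <= x)%R by exact: halving_small.
pose k := ex_minn ex.
have [ak kmin] : (a k <= x)%R /\ forall j, (a j <= x)%R -> (k <= j)%N.
  by rewrite /k; case: ex_minnP.
clearbody k; case: k ak kmin => [|j] ak kmin; first by rewrite leNgt xa in ak.
have xj : (x < a j)%R.
  by rewrite ltNge; apply/negP => /kmin; rewrite ltnn.
apply: (@le_trans _ _ (fv g (a j)%:E)).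
  by apply: ICOD_incr_fv; rewrite // lee_fin ltW.
apply: le_trans (ga j) _; rewrite f2E.
(* The exponent in [ga j] is already that of the next scale point: f(a j.+1) >= (3/4) 2^-(j+1) with
   a j.+1 <= x, so twice [f] is enough. *)
apply: (@le_trans _ _ (2%:E * (2^-1 ^+ j.+1 * 3 / 4)%:E)).
  rewrite -EFinM lee_fin; have : (0 < 2^-1 ^+ j.+1 :> R)%R by rewrite exprn_gt0.
  by lra.
apply: lee_wpmul2l => //; apply: le_trans (hf j.+1) _.
by apply: (admissible_fv_incr aF Ff); rewrite lee_fin// ltW.
Qed.

Lemma B_fam_ICOD : B_fam (@ICOD R) = @bounded_ops R.
Proof.
apply/seteqP; split; first exact: B_fam_bounded.
pose j (x : \bar R) : \bar R := if x == 0 then 0 else +oo.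
have ij : icod j by apply: icod_jump; rewrite leey.
have E x : 0 <= x -> fv (fn_of j) x = j x.
  by move=> x0; rewrite fv_fn_of//; exact: icod_ge0.
have If : ICOD (fn_of j) by exact: ICOD_fn_of.
apply: has_jump_has_oo_B_fam; first exact: admissible_ICOD.
  exists (fn_of j), 1%R; split => // x x0.
  by rewrite E ?(ltW x0)// /j gt_eqF// leey.
exists (fn_of j), 1%R; split => //.
by rewrite E ?lee_fin// /j eqe oner_eq0.
Qed.

Lemma C_fam_ICOD : C_fam (@ICOD R) = @bounded_ops R.
Proof.
apply/seteqP; split; first by move=> a [].
by rewrite -B_fam_ICOD; exact: B_fam_sub_C_fam.
Qed.

Local Notation C0bdd := (C_fam (@ICOD0bdd R)).
Local Notation C0 := (C_fam (@ICOD0 R)).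
Local Notation Cbdd := (C_fam (@ICODbdd R)).
Local Notation Cfin := (C_fam (@ICODfin R)).
Local Notation CT := (C_fam (@ICOD R)).

Lemma C0bdd_sub_C0 : C0bdd `<=` C0. Proof. by apply: sub_C_fam => f []. Qed.
Lemma C0bdd_sub_Cbdd : C0bdd `<=` Cbdd. Proof. by apply: sub_C_fam => f []. Qed.
Lemma C0_sub_Cfin : C0 `<=` Cfin. Proof. by apply: sub_C_fam; exact: ICOD0_fin. Qed.
Lemma Cbdd_sub_Cfin : Cbdd `<=` Cfin. Proof. by apply: sub_C_fam; exact: ICODbdd_fin. Qed.
Lemma Cfin_sub_CT : Cfin `<=` CT. Proof. by apply: sub_C_fam => f []. Qed.

Lemma id_C0 : C0 id. Proof. exact: (B_fam_sub_C_fam B_fam_id). Qed.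

Lemma id_not_Cbdd : ~ Cbdd id.
Proof.
by move/(C_fam_id_above_id (@admissible_ICODbdd R)); exact: ICODbdd_not_above_id.
Qed.

Lemma Cbdd_not_sub_C0 : ~ (Cbdd `<=` C0).
Proof. by move/(C_fam_ICODbdd_has_jump (@admissible_ICOD0 R)); exact: ICOD0_no_jump. Qed.

Lemma in_poset F : admissible F -> support_expansion_algebras (C_fam F).
Proof. by move=> aF; exists F. Qed.

(** One case for each combination of the two properties. With both, only an inclusion is available,
    since members of [F] may still be infinite at finite arguments. *)
Lemma interval_classification F : admissible F -> C0bdd `<=` C_fam F ->
  [\/ C_fam F = C0bdd, C_fam F = C0, C_fam F = Cbdd | Cfin `<=` C_fam F].
Proof.
move=> aF sF.
have [jF|nj] := pselect (has_jump F); have [iF|ni] := pselect (above_id F).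
- by apply: Or44; apply: C_fam_mono; exact: has_jump_above_id_B_fam.
- apply: Or43; apply/seteqP; split; apply: C_fam_mono.
    exact: not_above_id_B_fam.
  exact: has_jump_B_fam.
- apply: Or42; apply/seteqP; split; apply: C_fam_mono.
    exact: no_jump_B_fam.
  exact: above_id_B_fam.
- apply: Or41; apply/seteqP; split => //; apply: C_fam_mono.
  exact: no_jump_not_above_id_B_fam.
Qed.

End Covers.

Theorem theorem2 (R : realType) :
  [/\ covered_in_poset (C_fam (@ICOD0bdd R)) (C_fam (@ICOD0 R)),
      covered_in_poset (C_fam (@ICOD0bdd R)) (C_fam (@ICODbdd R)),
      covered_in_poset (C_fam (@ICOD0 R)) (C_fam (@ICODfin R)),
      covered_in_poset (C_fam (@ICODbdd R)) (C_fam (@ICODfin R)) &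
      covered_in_poset (C_fam (@ICODfin R)) (C_fam (@ICOD R))] /\
  C_fam (@ICOD R) = @bounded_ops R /\
  forall E : set (L2 R -> L2 R),
    strictly_between (C_fam (@ICOD0bdd R)) (C_fam (@ICODfin R)) E <->
    E = C_fam (@ICOD0 R) \/ E = C_fam (@ICODbdd R).
Proof.
(* Two facts separate the four lower algebras: the identity lies in the algebra of ICOD0 but not in
   that of ICODbdd, and the latter is not contained in the former. The last strict inclusion uses
   the expanding dilation. *)
have s1 : C_fam (@ICOD0bdd R) `<` C_fam (@ICOD0 R).
  split; first exact: C0bdd_sub_C0.
  by move=> h; apply: (@id_not_Cbdd R); apply: C0bdd_sub_Cbdd; apply: h; exact: id_C0.
have s2 : C_fam (@ICOD0bdd R) `<` C_fam (@ICODbdd R).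
  split; first exact: C0bdd_sub_Cbdd.
  by move=> h; apply: (@Cbdd_not_sub_C0 R) => a /h; exact: C0bdd_sub_C0.
have s3 : C_fam (@ICOD0 R) `<` C_fam (@ICODfin R).
  split; first exact: C0_sub_Cfin.
  by move=> h; apply: (@Cbdd_not_sub_C0 R) => a /Cbdd_sub_Cfin/h.
have s4 : C_fam (@ICODbdd R) `<` C_fam (@ICODfin R).
  split; first exact: Cbdd_sub_Cfin.
  by move=> h; apply: (@id_not_Cbdd R); apply: h; apply: C0_sub_Cfin; exact: id_C0.
have s5 : C_fam (@ICODfin R) `<` C_fam (@ICOD R).
  split; first exact: Cfin_sub_CT.
  by rewrite C_fam_ICOD; exact: bounded_ops_not_ICODfin.
have [p1 p2 p3 p4 p5] := And5 (in_poset (@admissible_ICOD0bdd R))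
  (in_poset (@admissible_ICOD0 R)) (in_poset (@admissible_ICODbdd R))
  (in_poset (@admissible_ICODfin R)) (in_poset (@admissible_ICOD R)).
have irr (A : set (L2 R -> L2 R)) : ~ A `<` A by move=> [_]; apply.
split; last split.
- split; split => // -[_ [[F aF ->] lo hi]].
  + case: (interval_classification aF lo.1) => h.
    * by rewrite h in lo; exact: irr lo.
    * by rewrite h in hi; exact: irr hi.
    * by rewrite h in hi; apply: (@Cbdd_not_sub_C0 R); case: hi.
    * by apply: s3.2 => a /h; exact: hi.1.
  + case: (interval_classification aF lo.1) => h.
    * by rewrite h in lo; exact: irr lo.
    * by rewrite h in hi; apply: (@id_not_Cbdd R); apply: hi.1; exact: id_C0.
    * by rewrite h in hi; exact: irr hi.
    * by apply: s4.2 => a /h; exact: hi.1.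
  + case: (interval_classification aF (subset_trans s1.1 lo.1)) => h.
    * by rewrite h in lo; apply: s1.2; exact: lo.1.
    * by rewrite h in lo; exact: irr lo.
    * by rewrite h in lo; apply: (@id_not_Cbdd R); apply: lo.1; exact: id_C0.
    * exact: hi.2 h.
  + case: (interval_classification aF (subset_trans s2.1 lo.1)) => h.
    * by rewrite h in lo; apply: s2.2; exact: lo.1.
    * by rewrite h in lo; apply: (@Cbdd_not_sub_C0 R); exact: lo.1.
    * by rewrite h in lo; exact: irr lo.
    * exact: hi.2 h.
  (* The classification no longer decides here. [F] has a jump because its algebra contains that of
     ICODbdd, and an infinite value at a finite argument then yields all bounded operators. *)
  + have [oo|noo] := pselect (has_oo F); last first.
      by apply: lo.2; apply: C_fam_mono; exact: no_oo_B_fam.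
    apply: hi.2; rewrite C_fam_ICOD.
    apply: subset_trans (@B_fam_sub_C_fam _ F); apply: has_jump_has_oo_B_fam => //.
    by apply: C_fam_ICODbdd_has_jump => //; exact: subset_trans s4.1 lo.1.
- exact: C_fam_ICOD.
- move=> E; split=> [[[F aF ->] lo hi]|[->|->]]; last 2 first.
  + by split.
  + by split.
  case: (interval_classification aF lo.1) => h.
  + by rewrite h in lo; case: (irr _ lo).
  + by left.
  + by right.
  + by case: (hi.2 h).
Qed.
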